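(* Let $B_1$ be the Blaschke product with simple zeros $z_n=n+i$, $n\in\mathbb{N}$. For every $A>0$, the majorant $W_A(t)=\exp(-A|t|^{1/2})$ belongs to $\mathrm{Adm}_-(B_1)$. On the other hand, if $w$ is a nonnegative function on $(-\infty,0]$ and $\Omega=-\log w$ satisfies $|t|^{1/2}=o(\Omega(t))$ as $t\to-\infty$, then $w\notin\mathrm{Adm}_-(B_1)$.
   Context: $H^2$ is the Hardy space of the upper half-plane $\mathbb{C}^+$; for an inner function $\Theta$, $K_\Theta=H^2\ominus\Theta H^2$. For a Blaschke product $B$, $w\in\mathrm{Adm}_-(B)$ means there is a nonzero $f\in K_B$ with $|f(x)|\le w(x)$ for a.e. $x<0$. *)

(* Defs.v *)
(* Complex numbers are  R[i]  (mathcomp-real-closed)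
   over an arbitrary  R : realType; R[i]^o carries the normed-module structure
   over the scalar field R[i] itself, so that  derivable f z 1  on R[i]^o is
   complex differentiability. *)
From HB Require Import structures.
From mathcomp Require Import all_boot all_order all_algebra.
From mathcomp Require Import all_classical all_reals all_analysis.
From mathcomp Require Export complex.
Export Order.TTheory GRing.Theory Num.Theory.
Export numFieldNormedType.Exports.

Set Implicit Arguments.
Unset Strict Implicit.
Unset Printing Implicit Defensive.

Local Open Scope ring_scope.
Local Open Scope complex_scope.
Local Open Scope classical_set_scope.

Section Hardy.
Variable R : realType.

(* holomorphic on the upper half-plane  C^+ = { z | Im z > 0 } *)
Definition holo_UHP (f : R[i] -> R[i]) : Prop :=
  forall z : R[i], 0 < complex.Im z -> derivable (f : R[i]^o -> R[i]^o) z 1.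

(* Hardy space H^2(C^+):  sup_{y>0} \int_R |f(x+iy)|^2 dx < oo *)
Definition H2 (f : R[i] -> R[i]) : Prop :=
  holo_UHP f /\
  exists M : R, forall y : R, 0 < y ->
    (\int[@lebesgue_measure R]_x ((Normc.normc (f (x +i* y))) ^+ 2)%:E <= M%:E)%E.

(* the L^2(R) inner product at height y:  \int_R f(x+iy) conj(g(x+iy)) dx *)
Definition ip_at (f g : R[i] -> R[i]) (y : R) : R[i] :=
  (Rintegral (@lebesgue_measure R) setT
       (fun x : R => complex.Re (f (x +i* y) * (g (x +i* y))^*))) +i*
  (Rintegral (@lebesgue_measure R) setT
       (fun x : R => complex.Im (f (x +i* y) * (g (x +i* y))^*))).

(* orthogonality in H^2: the inner product of the boundary values, i.e.
   lim_{y -> 0+} <f(. + iy), g(. + iy)>_{L^2(R)}, vanishes *)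
Definition H2_orth (f g : R[i] -> R[i]) : Prop :=
  (ip_at f g : R -> R[i]^o) y @[y --> (0:R)^'+] --> (0 : R[i]^o).

(* model space  K_Theta = H^2 (-) Theta H^2 *)
Definition model_space (Theta : R[i] -> R[i]) (f : R[i] -> R[i]) : Prop :=
  H2 f /\ forall g, H2 g -> H2_orth f (fun z => Theta z * g z).

(* normalised Blaschke factor of the upper half-plane with zero a
   (normalised to be positive at i) *)
Definition bfactor (a z : R[i]) : R[i] :=
  if a == 'i then (z - 'i) / (z + 'i)
  else let u := ('i - a) / ('i - a^*) in
       (u^* / (Normc.normc u)%:C) * ((z - a) / (z - a^*)).

(* Blaschke product with zeros zs n, n = 0,1,2,... *)
Definition blaschke (zs : nat -> R[i]) (z : R[i]) : R[i] :=
  limn (fun N => (\prod_(n < N) bfactor (zs n) z : R[i]^o)).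

(* B_1 : simple zeros z_n = n + i, n = 1, 2, 3, ... *)
Definition B1 : R[i] -> R[i] := blaschke (fun n => (n.+1)%:R +i* 1).

(* boundary value of f at x equals c:  f(x+iy) -> c  as y -> 0+ *)
Definition bv_is (f : R[i] -> R[i]) (x : R) (c : R[i]) : Prop :=
  (fun y : R => (f (x +i* y) : R[i]^o)) y @[y --> (0:R)^'+] --> (c : R[i]^o).

(* w \in Adm_-(B):  exists nonzero f \in K_B with |f(x)| <= w(x) a.e. x < 0 *)
Definition Adm_minus (B : R[i] -> R[i]) (w : R -> R) : Prop :=
  exists f : R[i] -> R[i],
    [/\ model_space B f,
        exists z : R[i], 0 < complex.Im z /\ f z != 0 &
        {ae @lebesgue_measure R, forall x : R,
           x < 0 -> exists c : R[i], bv_is f x c /\ Normc.normc c <= w x}].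

End Hardy.

(* Main.v *)
Require Import Defs.
From HB Require Import structures.
From mathcomp Require Import all_boot all_order all_algebra.
From mathcomp Require Import all_classical all_reals all_analysis.
From mathcomp Require Import measurable_realfun.
From mathcomp Require Import complex.
From mathcomp Require Import ring lra.
Import Order.TTheory GRing.Theory Num.Theory.
Import numFieldNormedType.Exports.
Set Implicit Arguments.
Unset Strict Implicit.
Unset Printing Implicit Defensive.
Local Open Scope ring_scope.
Local Open Scope complex_scope.
Local Open Scope classical_set_scope.

(** Decay of order exp (- A |t|^(1/2)) is critical because z = - u^2 turns it into
exponential decay on a half-plane.

Let e_n be the Takenaka-Malmquist system of B1.  The sum of the |e_n|^2 is bounded not
only near the real line but on the whole region Im z >= 0, Im z <= - 2 or Re z <= 0.  By
Bessel's inequality the expansion of f in K_B1 converges uniformly there, so f continues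
to a bounded function F.  The map z = - u^2 sends Re u >= 1 into that region, where a
majorant with |t|^(1/2) = o(Omega) makes F (- u^2) smaller than every exponential on the
real half-line; Phragmen-Lindelof gives F (- u^2) = 0, hence f = 0.

Conversely, let b_n be the Taylor coefficients of (1 - s)^8 exp (- a s / (1 - s)).  They
are O (n^-3), so that f z, the sum of b_n / (z - conj z_n), lies in K_B1.  Writing
1 / (n + 1 + t - i) as the integral of exp (- (n + 1 + t - i) x) over x > 0 exhibits
f (- t) as a Laplace transform of a function that is O (exp (- a / x)), and
t x + a / x >= 2 (a t)^(1/2).  The pole of f at conj z_0 shows that f is not zero. *)

(** Boundary functions are the obstacle. Inner products are limits of integrals over the lines Im z
    = y, on which neither the e_n among themselves nor f and B1 H^2 are exactly orthogonal.
    Estimates are therefore kept uniform in 0 < y <= 1, so that the limits in N and in y can be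
    exchanged, and Cauchy-Schwarz is used as t M + N / t with a free weight t.

    The region omits the half-strip that contains the poles conj z_n. On it |b_n|^2 exceeds 1 at
    most by a multiple of a Poisson kernel at the integer n, and the sum of these kernels is
    bounded.

    The continuation F is only known to be a uniform limit of holomorphic functions; the maximum
    principle is stated for such limits, so that holomorphy of F is never proved.

    The exponent 8: the coefficients of exp (- a s / (1 - s)) are bounded by O (n), and every two
    factors 1 - s gain one power of n. The resulting O (n^-3) is summable against the weight n, the
    price for comparing all 1 / (z - conj z_n) with the single square-integrable function 1 / (z +
    i). *)

Notation nc := Normc.normc.

(** * Modulus, real part and imaginary part *)

Section Modulus.
Variable R : realType.
Implicit Types (x y z : R[i]) (r : R).

Lemma ncM x y : nc (x * y) = nc x * nc y. Proof. exact: Normc.normcM. Qed.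
Lemma ncV x : nc x^-1 = (nc x)^-1. Proof. exact: Normc.normcV. Qed.
Lemma nc0 : nc (0 : R[i]) = 0. Proof. exact: Normc.normc0. Qed.
Lemma nc1 : nc (1 : R[i]) = 1. Proof. exact: Normc.normc1. Qed.
Lemma ncN x : nc (- x) = nc x. Proof. exact: (@normcN R x). Qed.
Lemma ncD x y : nc (x + y) <= nc x + nc y. Proof. exact: (@le_normcD R x y). Qed.
Lemma ncB x y : nc (x - y) <= nc x + nc y.
Proof. by rewrite -(ncN y) ncD. Qed.
Lemma nc_dist x y : nc (x - y) = nc (y - x).
Proof. by rewrite -ncN opprB. Qed.
Lemma nc_ge0 x : 0 <= nc x. Proof. by case: x => a b /=; exact: sqrtr_ge0. Qed.
Lemma nc_eq0 x : (nc x == 0) = (x == 0).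
Proof.
by apply/eqP/eqP => [/Normc.eq0_normc//|->]; rewrite nc0.
Qed.
Lemma nc_gt0 x : (0 < nc x) = (x != 0).
Proof. by rewrite lt0r nc_ge0 andbT nc_eq0. Qed.
Lemma ncX x n : nc (x ^+ n) = nc x ^+ n.
Proof. by elim: n => [|n IH]; rewrite ?expr0 ?nc1// !exprS ncM IH. Qed.
Lemma nc_sq x : nc x ^+ 2 = complex.Re x ^+ 2 + complex.Im x ^+ 2.
Proof. by case: x => a b /=; rewrite sqr_sqrtr// addr_ge0 ?sqr_ge0. Qed.
Lemma nc_Re x : `|complex.Re x| <= nc x.
Proof.
rewrite -(ler_pXn2r (n := 2)) ?nnegrE ?nc_ge0//.
by rewrite nc_sq real_normK ?num_real// lerDl sqr_ge0.
Qed.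
Lemma nc_Im x : `|complex.Im x| <= nc x.
Proof.
rewrite -(ler_pXn2r (n := 2)) ?nnegrE ?nc_ge0//.
by rewrite nc_sq real_normK ?num_real// lerDr sqr_ge0.
Qed.
Lemma nc_real r : nc r%:C = `|r|.
Proof. by rewrite /= expr0n addr0 sqrtr_sqr. Qed.
Lemma nc_imag r : nc (0 +i* r) = `|r|.
Proof. by rewrite /= expr0n add0r sqrtr_sqr. Qed.
Lemma complexRI x : x = (complex.Re x)%:C + (0 +i* complex.Im x).
Proof. by case: x => a b; apply/eqP; rewrite eq_complex /= addr0 add0r !eqxx. Qed.
Lemma nc_ReIm x : nc x <= `|complex.Re x| + `|complex.Im x|.
Proof. by rewrite {1}(complexRI x) -nc_real -nc_imag ncD. Qed.
Lemma nc_conj x : nc (x^*) = nc x.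
Proof. by case: x => a b /=; rewrite sqrrN. Qed.
Lemma ncBD x y : nc x - nc y <= nc (x - y).
Proof. by rewrite lerBlDr -{1}(subrK y x) ncD. Qed.
Lemma nc_sum (I : Type) (s : seq I) (P : pred I) (F : I -> R[i]) :
  nc (\sum_(i <- s | P i) F i) <= \sum_(i <- s | P i) nc (F i).
Proof.
elim/big_ind2: _ => // [|a b c d h1 h2]; first by rewrite nc0.
exact: le_trans (ncD _ _) (lerD h1 h2).
Qed.
Lemma ReD x y : complex.Re (x + y) = complex.Re x + complex.Re y.
Proof. by case: x; case: y. Qed.
Lemma ImD x y : complex.Im (x + y) = complex.Im x + complex.Im y.
Proof. by case: x; case: y. Qed.
Lemma ReN x : complex.Re (- x) = - complex.Re x. Proof. by case: x. Qed.
Lemma ImN x : complex.Im (- x) = - complex.Im x. Proof. by case: x. Qed.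
Lemma ReM x y : complex.Re (x * y) =
  complex.Re x * complex.Re y - complex.Im x * complex.Im y.
Proof. by case: x; case: y. Qed.
Lemma ImM x y : complex.Im (x * y) =
  complex.Re x * complex.Im y + complex.Im x * complex.Re y.
Proof. by case: x; case: y. Qed.
Lemma eqC x y : complex.Re x = complex.Re y -> complex.Im x = complex.Im y -> x = y.
Proof. by case: x => a b; case: y => c d /= -> ->. Qed.
Lemma conjB x y : (x - y)^* = x^* - y^*.
Proof. exact: (rmorphB (@conjc R)). Qed.
Lemma conjMz x : x * x^* = (nc x ^+ 2)%:C.
Proof.
case: x => a b; apply: eqC; rewrite ?ReM ?ImM nc_sq /=; first by ring.
by ring.
Qed.

End Modulus.

(** * Complex differentiability through slope functions *)

Section Caratheodory.
Variable R : realType.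
Implicit Types (f g : R[i] -> R[i]) (z w c : R[i]).

Definition ccont f z := forall e : R, 0 < e -> exists2 d : R, 0 < d &
  forall w, nc (w - z) < d -> nc (f w - f z) < e.

(* Caratheodory's formulation of differentiability: it makes the rules of
   calculus identities between slopes. *)
Definition cdiff f z := exists2 phi, ccont phi z & exists2 d : R, 0 < d &
  forall w, nc (w - z) < d -> f w - f z = phi w * (w - z).

Lemma ccont_cst c z : ccont (fun=> c) z.
Proof. by move=> e e0; exists 1 => // w _; rewrite subrr nc0. Qed.

Lemma ccont_id z : ccont id z.
Proof. by move=> e e0; exists e. Qed.

Lemma ccont_local f g z (d : R) : 0 < d ->
  (forall w, nc (w - z) < d -> f w = g w) -> ccont f z -> ccont g z.
Proof.
move=> d0 fg cf e /cf[d' d'0 h]; exists (Num.min d d').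
  by rewrite lt_min d0.
move=> w; rewrite lt_min => /andP[wd /h]; rewrite !fg// subrr nc0//.
Qed.

Lemma ccontD f g z : ccont f z -> ccont g z -> ccont (fun w => f w + g w) z.
Proof.
move=> cf cg e e0; have e20 : 0 < e / 2 by rewrite divr_gt0.
have [d d0 hd] := cf _ e20; have [d' d'0 hd'] := cg _ e20.
exists (Num.min d d'); first by rewrite lt_min d0.
move=> w; rewrite lt_min => /andP[/hd h1 /hd' h2].
have -> : f w + g w - (f z + g z) = (f w - f z) + (g w - g z) by ring.
by apply: le_lt_trans (ncD _ _) _; rewrite (splitr e) ltrD.
Qed.

Lemma ccont_bound f z : ccont f z -> exists2 d : R, 0 < d &
  forall w, nc (w - z) < d -> nc (f w) < nc (f z) + 1.
Proof.
move=> /(_ 1 ltr01)[d d0 h]; exists d => // w /h; have := ncBD (f w) (f z).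
lra.
Qed.

Lemma ccontM f g z : ccont f z -> ccont g z -> ccont (fun w => f w * g w) z.
Proof.
move=> cf cg e e0.
have M0 : 0 < nc (f z) + nc (g z) + 1 by have := nc_ge0 (f z); have := nc_ge0 (g z); lra.
set M := _ + 1 in M0.
have e20 : 0 < e / (2 * M) by rewrite divr_gt0 ?mulr_gt0.
have [d d0 hd] := cf _ e20; have [d' d'0 hd'] := cg _ e20.
have [d2 d20 hd2] := ccont_bound cg.
exists (Num.min d (Num.min d' d2)); first by rewrite !lt_min d0 d'0.
move=> w; rewrite !lt_min => /and3P[/hd h1 /hd' h2 /hd2 h3].
have -> : f w * g w - f z * g z = (f w - f z) * g w + f z * (g w - g z) by ring.
apply: le_lt_trans (ncD _ _) _; rewrite !ncM.
have h4 : nc (f w - f z) * nc (g w) <= e / (2 * M) * (nc (g z) + 1).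
  by apply: ler_pM; rewrite ?nc_ge0// ltW.
have h5 : nc (f z) * nc (g w - g z) <= nc (f z) * (e / (2 * M)).
  by rewrite ler_wpM2l ?nc_ge0// ltW.
apply: (@le_lt_trans _ _ (e / (2 * M) * M)).
  by move: h4 h5; rewrite /M; lra.
have -> : e / (2 * M) * M = e / 2 by field; rewrite gt_eqF.
lra.
Qed.

Lemma ccontN f z : ccont f z -> ccont (fun w => - f w) z.
Proof.
move=> cf e /cf[d d0 h]; exists d => // w /h.
by rewrite -opprD ncN.
Qed.

Lemma ccontB f g z : ccont f z -> ccont g z -> ccont (fun w => f w - g w) z.
Proof. by move=> cf cg; apply: ccontD => //; exact: ccontN. Qed.

Lemma ccont_neq0 f z : ccont f z -> f z != 0 -> exists2 d : R, 0 < d &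
  forall w, nc (w - z) < d -> nc (f z) / 2 < nc (f w).
Proof.
move=> cf; rewrite -nc_gt0 => fz0.
have [|d d0 h] := cf (nc (f z) / 2); first by rewrite divr_gt0.
exists d => // w /h; rewrite nc_dist; have := ncBD (f z) (f w); lra.
Qed.

Lemma ccontV f z : ccont f z -> f z != 0 -> ccont (fun w => (f w)^-1) z.
Proof.
move=> cf fz e e0; have fz0 : 0 < nc (f z) by rewrite nc_gt0.
have [d d0 hd] := ccont_neq0 cf fz.
have [|d' d'0 hd'] := cf (e * (nc (f z) ^+ 2 / 2)).
  by rewrite mulr_gt0// divr_gt0// exprn_gt0.
exists (Num.min d d'); first by rewrite lt_min d0.
move=> w; rewrite lt_min => /andP[/hd h1 /hd' h2].
have fw : f w != 0 by rewrite -nc_gt0; apply: le_lt_trans h1; rewrite divr_ge0 ?nc_ge0.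
have fw0 : 0 < nc (f w) by rewrite nc_gt0.
have -> : (f w)^-1 - (f z)^-1 = (f z - f w) / (f w * f z) by field; rewrite fw fz.
rewrite ncM ncV ncM nc_dist ltr_pdivrMr ?mulr_gt0//.
apply: lt_le_trans h2 _; rewrite ler_wpM2l ?(ltW e0)//.
have := ltW h1; nra.
Qed.

Lemma ccont_comp f g z : ccont f z -> ccont g (f z) -> ccont (fun w => g (f w)) z.
Proof.
by move=> cf cg e /cg[d /cf[d' d'0 h'] h]; exists d' => // w /h' /h.
Qed.

Lemma cdiff_cont f z : cdiff f z -> ccont f z.
Proof.
move=> [phi cp [d d0 h]].
apply: (@ccont_local (fun w => f z + phi w * (w - z)) _ _ d d0).
  by move=> w /h <-; rewrite addrC subrK.
apply: ccontD; first exact: ccont_cst.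
by apply: ccontM => //; apply: ccontB; [exact: ccont_id|exact: ccont_cst].
Qed.

Lemma cdiff_local f g z (d : R) : 0 < d ->
  (forall w, nc (w - z) < d -> f w = g w) -> cdiff f z -> cdiff g z.
Proof.
move=> d0 fg [phi cp [d' d'0 h]]; exists phi => //; exists (Num.min d d').
  by rewrite lt_min d0.
by move=> w; rewrite lt_min => /andP[wd /h <-]; rewrite !fg// subrr nc0.
Qed.

Lemma cdiff_ext f g z : f =1 g -> cdiff f z -> cdiff g z.
Proof. by move=> fg; apply: (cdiff_local ltr01). Qed.

Lemma cdiff_cst c z : cdiff (fun=> c) z.
Proof.
exists (fun=> 0); first exact: ccont_cst.
by exists 1 => // w _; rewrite subrr mul0r.
Qed.

Lemma cdiff_id z : cdiff id z.
Proof.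
exists (fun=> 1); first exact: ccont_cst.
by exists 1 => // w _; rewrite mul1r.
Qed.

Lemma cdiffD f g z : cdiff f z -> cdiff g z -> cdiff (fun w => f w + g w) z.
Proof.
move=> [phi cp [d d0 h]] [psi cq [d' d'0 h']].
exists (fun w => phi w + psi w); first exact: ccontD.
exists (Num.min d d'); first by rewrite lt_min d0.
move=> w; rewrite lt_min => /andP[/h h1 /h' h2].
by rewrite mulrDl -h1 -h2; ring.
Qed.

Lemma cdiffM f g z : cdiff f z -> cdiff g z -> cdiff (fun w => f w * g w) z.
Proof.
move=> df dg; have cg := cdiff_cont dg.
case: df dg => [phi cp [d d0 h]] [psi cq [d' d'0 h']].
exists (fun w => phi w * g w + f z * psi w).
  by apply: ccontD; apply: ccontM => //; exact: ccont_cst.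
exists (Num.min d d'); first by rewrite lt_min d0.
move=> w; rewrite lt_min => /andP[/h h1 /h' h2].
have -> : f w * g w - f z * g z = (f w - f z) * g w + f z * (g w - g z) by ring.
by rewrite h1 h2; ring.
Qed.

Lemma cdiffN f z : cdiff f z -> cdiff (fun w => - f w) z.
Proof.
move=> df; apply: (@cdiff_ext (fun w => (-1) * f w)) => [w|]; first by rewrite mulN1r.
by apply: cdiffM => //; exact: cdiff_cst.
Qed.

Lemma cdiffB f g z : cdiff f z -> cdiff g z -> cdiff (fun w => f w - g w) z.
Proof. by move=> df dg; apply: cdiffD => //; exact: cdiffN. Qed.

Lemma cdiffV f z : cdiff f z -> f z != 0 -> cdiff (fun w => (f w)^-1) z.
Proof.
move=> df fz; have cf := cdiff_cont df.
case: df => [phi cp [d d0 h]]; have [d' d'0 h'] := ccont_neq0 cf fz.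
exists (fun w => - phi w * ((f w)^-1 * (f z)^-1)).
  apply: ccontM; first exact: ccontN.
  by apply: ccontM; [exact: ccontV|exact: ccont_cst].
exists (Num.min d d'); first by rewrite lt_min d0.
move=> w; rewrite lt_min => /andP[/h h1 /h' h2].
have fw : f w != 0 by rewrite -nc_gt0; apply: le_lt_trans h2; rewrite divr_ge0 ?nc_ge0.
have -> : (f w)^-1 - (f z)^-1 = - (f w - f z) / (f w * f z) by field; rewrite fw fz.
by rewrite h1 invfM; ring.
Qed.

Lemma cdiff_comp f g z : cdiff f z -> cdiff g (f z) -> cdiff (fun w => g (f w)) z.
Proof.
move=> df; have cf := cdiff_cont df.
case: df => [phi cp [d d0 h]] [psi cq [d' d'0 h']].
exists (fun w => psi (f w) * phi w).
  by apply: ccontM => //; exact: ccont_comp.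
have [d2 d20 h2] := cf _ d'0.
exists (Num.min d d2); first by rewrite lt_min d0.
move=> w; rewrite lt_min => /andP[/h h1 /h2 /h' ->].
by rewrite h1 mulrA.
Qed.

Lemma cdiffX f z n : cdiff f z -> cdiff (fun w => f w ^+ n) z.
Proof.
move=> df; elim: n => [|n IH]; first exact: (cdiff_ext (fun=> erefl) (cdiff_cst 1 z)).
apply: (@cdiff_ext (fun w => f w * f w ^+ n)) => [w|]; first by rewrite exprS.
exact: cdiffM.
Qed.

Lemma cdiff_sum (I : Type) (s : seq I) (P : pred I) (F : I -> R[i] -> R[i]) z :
  (forall i, P i -> cdiff (F i) z) -> cdiff (fun w => \sum_(i <- s | P i) F i w) z.
Proof.
move=> dF; elim: s => [|i s IH].
  by apply: (cdiff_ext _ (cdiff_cst 0 z)) => w; rewrite big_nil.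
case Pi : (P i); last by apply: (cdiff_ext _ IH) => w; rewrite big_cons Pi.
apply: (@cdiff_ext (fun w => F i w + \sum_(j <- s | P j) F j w)) => [w|].
  by rewrite big_cons Pi.
by apply: cdiffD => //; exact: dF.
Qed.

Lemma cdiff_prod (I : Type) (s : seq I) (P : pred I) (F : I -> R[i] -> R[i]) z :
  (forall i, P i -> cdiff (F i) z) -> cdiff (fun w => \prod_(i <- s | P i) F i w) z.
Proof.
move=> dF; elim: s => [|i s IH].
  by apply: (cdiff_ext _ (cdiff_cst 1 z)) => w; rewrite big_nil.
case Pi : (P i); last by apply: (cdiff_ext _ IH) => w; rewrite big_cons Pi.
apply: (@cdiff_ext (fun w => F i w * \prod_(j <- s | P j) F j w)) => [w|].
  by rewrite big_cons Pi.
by apply: cdiffM => //; exact: dF.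
Qed.

Lemma gt0C (e : R[i]) : 0 < e -> 0 < complex.Re e /\ e = (complex.Re e)%:C.
Proof.
rewrite ltcE /= => /andP[/eqP h1 h2]; split=> //.
by apply: eqC.
Qed.

Lemma ncE z : `|z| = (nc z)%:C.
Proof. by case: z. Qed.

Lemma derivable_cdiff f z : derivable (f : R[i]^o -> R[i]^o) z 1 -> cdiff f z.
Proof.
move=> /cvg_ex[/= l hl].
pose phi w := if w == z then l else (f w - f z) / (w - z).
exists phi; last first.
  exists 1 => // w _; rewrite /phi; case: eqVneq => [->|wz].
    by rewrite !subrr mulr0.
  by rewrite divfK// subr_eq0.
move=> e e0.
have /cvgrPdist_lt /(_ e%:C) := hl.
have e0C : 0 < e%:C :> R[i] by rewrite ltcR.
move=> /(_ e0C) [d /= /gt0C[d0 dE]] h.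
exists (complex.Re d) => // w wz.
rewrite /phi eqxx; case: eqVneq => [_|wz0]; first by rewrite subrr nc0.
have /= := h (w - z); rewrite sub0r normrN ncE dE ltcR => /(_ wz).
rewrite subr_eq0 => /(_ wz0); rewrite ncE ltcR nc_dist.
by rewrite /GRing.scale /= mulr1 subrK mulrC.
Qed.

Lemma cdiff_derivable f z : cdiff f z -> derivable (f : R[i]^o -> R[i]^o) z 1.
Proof.
move=> [phi cp [d d0 h]]; apply/cvg_ex; exists (phi z).
apply/cvgrPdist_lt => e /gt0C[e0 ->].
have [d' d'0 h'] := cp _ e0.
exists (Num.min d d')%:C; first by rewrite /= ltcR lt_min d0.
move=> w /=; rewrite sub0r normrN ncE ltcR lt_min => /andP[w1 w2] w0.
rewrite /GRing.scale /= mulr1 ncE ltcR nc_dist.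
have wE : w + z - z = w by rewrite addrK.
rewrite h wE// mulrC mulfK//.
by apply: h'; rewrite wE.
Qed.

End Caratheodory.

(** * Integrals of complex-valued functions of a real variable *)

Section ComplexIntegral.
Variable R : realType.
Local Notation mu := (@lebesgue_measure R).
Implicit Types (D : set (measurableTypeR R)) (p q : R -> R[i]) (a b c : R) (k : R[i]).

Definition pcont D p := forall x, D x -> forall e : R, 0 < e ->
  exists2 d : R, 0 < d & forall t, D t -> `|t - x| < d -> nc (p t - p x) < e.

Definition cintegrable D p :=
  mu.-integrable D (EFin \o (fun x => complex.Re (p x))) /\
  mu.-integrable D (EFin \o (fun x => complex.Im (p x))).

Definition cint D p : R[i] :=
  Rintegral mu D (fun x => complex.Re (p x)) +i*
  Rintegral mu D (fun x => complex.Im (p x)).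

Lemma pcont_sub D E p : E `<=` D -> pcont D p -> pcont E p.
Proof.
move=> ED cp x /ED Dx e /(cp x Dx)[d d0 h]; exists d => // t /ED Dt; exact: h.
Qed.

Lemma pcont_comp D p (f : R[i] -> R[i]) : pcont D p ->
  (forall x, D x -> ccont f (p x)) -> pcont D (fun x => f (p x)).
Proof.
move=> cp cf x Dx e /(cf x Dx)[d /(cp x Dx)[d' d'0 h'] h].
by exists d' => // t Dt /(h' t Dt)/h.
Qed.

Lemma pcont_lip D p (L : R) : (forall x t, D x -> D t -> nc (p t - p x) <= L * `|t - x|) ->
  pcont D p.
Proof.
move=> h x Dx e e0; exists (e / (`|L| + 1)); first by rewrite divr_gt0// ltr_wpDl.
move=> t Dt; rewrite ltr_pdivlMr ?ltr_wpDl// => te.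
apply: le_lt_trans (h x t Dx Dt) _; apply: le_lt_trans te.
have := ler_norm L; have := normr_ge0 (t - x); nra.
Qed.

Lemma pcont_ReE D p : pcont D p ->
  {within D, continuous (fun x => complex.Re (p x))}.
Proof.
move=> cp; apply/subspace_continuousP => x Dx; apply/cvgrPdist_lt => e /(cp x Dx)[d d0 h].
exists d => //= t /= xt Dt; apply: le_lt_trans (h t Dt _); last by rewrite distrC.
by rewrite distrC -ReN -ReD nc_Re.
Qed.

Lemma pcont_ImE D p : pcont D p ->
  {within D, continuous (fun x => complex.Im (p x))}.
Proof.
move=> cp; apply/subspace_continuousP => x Dx; apply/cvgrPdist_lt => e /(cp x Dx)[d d0 h].
exists d => //= t /= xt Dt; apply: le_lt_trans (h t Dt _); last by rewrite distrC.
by rewrite distrC -ImN -ImD nc_Im.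
Qed.

Lemma pcont_integrable a b p : pcont `[a, b] p -> cintegrable `[a, b] p.
Proof.
move=> cp; split; apply: continuous_compact_integrable; try exact: segment_compact.
  exact: pcont_ReE.
exact: pcont_ImE.
Qed.

Lemma pcont_measurableRe p : pcont setT p ->
  measurable_fun setT (fun x => complex.Re (p x)).
Proof.
move=> /pcont_ReE; exact: subspace_continuous_measurable_fun.
Qed.

Lemma pcont_measurableIm p : pcont setT p ->
  measurable_fun setT (fun x => complex.Im (p x)).
Proof.
move=> /pcont_ImE; exact: subspace_continuous_measurable_fun.
Qed.

Lemma integrable_eq D (f g : R -> R) : measurable D -> {in D, f =1 g} ->
  mu.-integrable D (EFin \o f) -> mu.-integrable D (EFin \o g).
Proof. by move=> mD fg; apply: eq_integrable => // x xD /=; rewrite fg. Qed.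

Lemma integrable_addR D (f g : R -> R) : measurable D -> mu.-integrable D (EFin \o f) ->
  mu.-integrable D (EFin \o g) -> mu.-integrable D (EFin \o (fun x => f x + g x)).
Proof. by move=> mD h1 h2; apply: (eq_integrable mD _ _ _ (integrableD mD h1 h2)). Qed.

Lemma integrable_subR D (f g : R -> R) : measurable D -> mu.-integrable D (EFin \o f) ->
  mu.-integrable D (EFin \o g) -> mu.-integrable D (EFin \o (fun x => f x - g x)).
Proof. by move=> mD h1 h2; apply: (eq_integrable mD _ _ _ (integrableB mD h1 h2)). Qed.

Lemma integrable_mulR D (f : R -> R) c : measurable D -> mu.-integrable D (EFin \o f) ->
  mu.-integrable D (EFin \o (fun x => c * f x)).
Proof. by move=> mD h1; apply: (eq_integrable mD _ _ _ (integrableZl mD c h1)). Qed.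

Lemma cintegrable_eq D p q : measurable D -> {in D, p =1 q} -> cintegrable D p -> cintegrable D q.
Proof.
by move=> mD pq [h1 h2]; split; [apply: integrable_eq h1|apply: integrable_eq h2] => // x xD;
  rewrite pq.
Qed.

Lemma cintegrableD D p q : measurable D -> cintegrable D p -> cintegrable D q ->
  cintegrable D (fun x => p x + q x).
Proof.
move=> mD [p1 p2] [q1 q2]; split.
  apply: integrable_eq (integrable_addR mD p1 q1) => // x _.
  by rewrite ReD.
apply: integrable_eq (integrable_addR mD p2 q2) => // x _.
by rewrite ImD.
Qed.

Lemma cintegrableZ D p k : measurable D -> cintegrable D p ->
  cintegrable D (fun x => k * p x).
Proof.
move=> mD [p1 p2]; split.
  apply: integrable_eq (integrable_subR mD (integrable_mulR (complex.Re k) mD p1)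
    (integrable_mulR (complex.Im k) mD p2)) => // x _.
  by rewrite ReM.
apply: integrable_eq (integrable_addR mD (integrable_mulR (complex.Re k) mD p2)
  (integrable_mulR (complex.Im k) mD p1)) => // x _.
by rewrite ImM.
Qed.

Lemma eq_cint D p q : {in D, p =1 q} -> cint D p = cint D q.
Proof.
move=> pq; rewrite /cint; congr (_ +i* _); apply: eq_Rintegral => x xD; by rewrite pq.
Qed.

Lemma cintD D p q : measurable D -> cintegrable D p -> cintegrable D q ->
  cint D (fun x => p x + q x) = cint D p + cint D q.
Proof.
move=> mD [p1 p2] [q1 q2]; apply: eqC; rewrite ?ReD ?ImD /=.
  by rewrite -RintegralD//; apply: eq_Rintegral => x _; rewrite ReD.
by rewrite -RintegralD//; apply: eq_Rintegral => x _; rewrite ImD.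
Qed.

Lemma cintZ D p k : measurable D -> cintegrable D p ->
  cint D (fun x => k * p x) = k * cint D p.
Proof.
move=> mD [p1 p2]; apply: eqC; rewrite ?ReM ?ImM /=.
  rewrite -!RintegralZl// -RintegralB//; try exact: integrable_mulR.
  by apply: eq_Rintegral => x _; rewrite ReM.
rewrite -!RintegralZl// -RintegralD//; try exact: integrable_mulR.
by apply: eq_Rintegral => x _; rewrite ImM.
Qed.

Lemma cintB D p q : measurable D -> cintegrable D p -> cintegrable D q ->
  cint D (fun x => p x - q x) = cint D p - cint D q.
Proof.
move=> mD ip iq.
rewrite (@eq_cint _ _ (fun x => p x + (-1) * q x)); last by move=> x _; rewrite mulN1r.
rewrite cintD ?cintZ ?mulN1r//; exact: cintegrableZ.
Qed.

Lemma cint_sum D (I : Type) (s : seq I) (F : I -> R -> R[i]) : measurable D ->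
  (forall i, cintegrable D (F i)) ->
  cintegrable D (fun x => \sum_(i <- s) F i x) /\
  cint D (fun x => \sum_(i <- s) F i x) = \sum_(i <- s) cint D (F i).
Proof.
move=> mD iF; elim: s => [|i s [IH1 IH2]].
  have i0 : cintegrable D (fun=> 0 : R[i]) by by split; exact: integrable0.
  split; first by apply: cintegrable_eq i0 => // x _; rewrite big_nil.
  rewrite big_nil (@eq_cint _ _ (fun=> 0)); last by move=> x _; rewrite big_nil.
  by apply: eqC => /=; rewrite Rintegral_cst// mul0r.
split.
  apply: cintegrable_eq (cintegrableD mD (iF i) IH1) => // x _.
  by rewrite big_cons.
rewrite big_cons -IH2 -cintD//; apply: eq_cint => x _; by rewrite big_cons.
Qed.

(** The factor 2 is the price of bounding real and imaginary parts separately; it reappears in every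
    later length estimate. *)
Lemma cint_le D p (g : R -> R) : measurable D -> cintegrable D p ->
  mu.-integrable D (EFin \o g) -> (forall x, D x -> nc (p x) <= g x) ->
  nc (cint D p) <= 2 * Rintegral mu D g.
Proof.
move=> mD [p1 p2] ig pg; apply: le_trans (nc_ReIm _) _ => /=.
rewrite mulr_natl mulr2n; apply: lerD.
  apply: le_trans (le_normr_Rintegral mD p1) _; apply: le_Rintegral => //.
    exact: integrable_norm.
  by move=> x Dx; apply: le_trans (nc_Re _) (pg _ Dx).
apply: le_trans (le_normr_Rintegral mD p2) _; apply: le_Rintegral => //.
  exact: integrable_norm.
by move=> x Dx; apply: le_trans (nc_Im _) (pg _ Dx).
Qed.

Lemma mu_itv a b : a <= b -> fine (mu `[a, b]) = b - a.
Proof.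
move=> ab; rewrite lebesgue_measure_itv /= lte_fin; case: ltP => //= ba.
by apply/eqP; rewrite eq_sym subr_eq0 eq_le ab ba.
Qed.

Lemma integrable_itv_cst a b c : mu.-integrable `[a, b] (EFin \o (fun=> c)).
Proof.
apply: continuous_compact_integrable; first exact: segment_compact.
by move=> x; exact: cst_continuous.
Qed.

Lemma cint_le_itv a b p c : a <= b -> pcont `[a, b] p ->
  (forall x, a <= x <= b -> nc (p x) <= c) ->
  nc (cint `[a, b] p) <= 2 * c * (b - a).
Proof.
move=> ab cp pc; apply: le_trans (cint_le (g := fun=> c) _ _ _ _) _ => //.
- exact: pcont_integrable.
- exact: integrable_itv_cst.
by rewrite Rintegral_cst//= -mulrA mu_itv.
Qed.

Lemma cint_itv_cst a b k : a <= b -> cint `[a, b] (fun=> k) = (b - a)%:C * k.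
Proof.
move=> ab; rewrite /cint !Rintegral_cst//= mu_itv//.
by apply: eqC; rewrite ?ReM ?ImM /=; ring.
Qed.

Lemma Rint_split (f : R -> R) a b c : a <= b -> b <= c ->
  mu.-integrable `[a, c] (EFin \o f) ->
  Rintegral mu `[a, c] f = Rintegral mu `[a, b] f + Rintegral mu `[b, c] f.
Proof.
move=> ab bc ifc; have := @Rintegral_itvB R f (BLeft a) (BRight c) b ifc.
rewrite !bnd_simp => /(_ ab bc) /eqP; rewrite subr_eq => /eqP ->.
rewrite addrC; congr (_ + _).
apply: Rintegral_itv_obnd_cbnd.
apply: integrableS ifc => //.
by apply: subset_itvr; rewrite bnd_simp.
Qed.

Lemma cint_split a b c p : a <= b -> b <= c -> pcont `[a, c] p ->
  cint `[a, c] p = cint `[a, b] p + cint `[b, c] p.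
Proof.
move=> ab bc /pcont_integrable[p1 p2].
by apply: eqC; rewrite ?ReD ?ImD /=; apply: Rint_split.
Qed.

End ComplexIntegral.

(** * Goursat's theorem on rectangles *)

Section Goursat.
Variable R : realType.
Implicit Types (f g : R[i] -> R[i]) (a b c d x y : R) (z w : R[i]).

Definition inrect a b c d z :=
  (a <= complex.Re z <= b) && (c <= complex.Im z <= d).

Lemma inrect_sub a b c d a' b' c' d' z : a <= a' -> b' <= b -> c <= c' -> d' <= d ->
  inrect a' b' c' d' z -> inrect a b c d z.
Proof.
move=> aa bb cc dd /andP[/andP[h1 h2] /andP[h3 h4]]; rewrite /inrect.
by rewrite (le_trans aa h1) (le_trans h2 bb) (le_trans cc h3) (le_trans h4 dd).
Qed.

(** Regularity is asked for on the boundary only, so that rectangles around a singular point can be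
    handled. *)
Definition onbd a b c d z := inrect a b c d z &&
  [|| complex.Re z == a, complex.Re z == b, complex.Im z == c | complex.Im z == d].

Lemma onbd_in a b c d z : onbd a b c d z -> inrect a b c d z.
Proof. by case/andP. Qed.

(** Counterclockwise contour integral: dz is dx on the horizontal sides and i dy on the vertical
    ones. *)
Definition rect f a b c d : R[i] :=
  cint `[a, b] (fun x => f (x +i* c)) - cint `[a, b] (fun x => f (x +i* d)) +
  'i * (cint `[c, d] (fun y => f (b +i* y)) - cint `[c, d] (fun y => f (a +i* y))).

Lemma pcont_hor f a b y : (forall x, a <= x <= b -> ccont f (x +i* y)) ->
  pcont `[a, b] (fun x => f (x +i* y)).
Proof.
move=> cf; apply: pcont_comp => [|x]; last by rewrite /= in_itv /=; exact: cf.
apply: (@pcont_lip R _ _ 1) => x t _ _; rewrite mul1r.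
have -> : t +i* y - x +i* y = (t - x)%:C by apply: eqC; rewrite ?ReD ?ImD ?ReN ?ImN /=; ring.
by rewrite nc_real.
Qed.

Lemma pcont_ver f c d x : (forall y, c <= y <= d -> ccont f (x +i* y)) ->
  pcont `[c, d] (fun y => f (x +i* y)).
Proof.
move=> cf; apply: pcont_comp => [|y]; last by rewrite /= in_itv /=; exact: cf.
apply: (@pcont_lip R _ _ 1) => y t _ _; rewrite mul1r.
have -> : x +i* t - x +i* y = 0 +i* (t - y) by apply: eqC; rewrite ?ReD ?ImD ?ReN ?ImN /=; ring.
by rewrite nc_imag.
Qed.

Lemma pcont_horT f y : (forall x, ccont f (x +i* y)) ->
  pcont setT (fun x => f (x +i* y)).
Proof.
move=> cf; apply: pcont_comp => [|x _]; last exact: cf.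
apply: (@pcont_lip R _ _ 1) => x t _ _; rewrite mul1r.
have -> : t +i* y - x +i* y = (t - x)%:C by apply: eqC; rewrite ?ReD ?ImD ?ReN ?ImN /=; ring.
by rewrite nc_real.
Qed.

Section fixed.
Variables (f : R[i] -> R[i]) (a b c d : R).
Hypotheses (ab : a <= b) (cd : c <= d).
Hypothesis cf : forall z, onbd a b c d z -> ccont f z.

Let hor y x1 x2 : (y == c) || (y == d) -> a <= x1 -> x2 <= b ->
  pcont `[x1, x2] (fun x => f (x +i* y)).
Proof.
move=> ycd h1 h2; apply: pcont_hor => x /andP[h4 h5]; apply: cf.
rewrite /onbd /inrect /= (le_trans h1 h4) (le_trans h5 h2).
by case/orP: ycd => /eqP ->; rewrite lexx cd eqxx ?orbT.
Qed.

Let ver x y1 y2 : (x == a) || (x == b) -> c <= y1 -> y2 <= d ->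
  pcont `[y1, y2] (fun y => f (x +i* y)).
Proof.
move=> xab h1 h2; apply: pcont_ver => y /andP[h4 h5]; apply: cf.
rewrite /onbd /inrect /= (le_trans h1 h4) (le_trans h5 h2).
by case/orP: xab => /eqP ->; rewrite lexx ab eqxx ?orbT.
Qed.

(** The integrals over the common side cancel as terms, whatever f does there, so that continuity on
    the outer boundary suffices. *)
Lemma rect_splitx m : a <= m <= b -> rect f a b c d = rect f a m c d + rect f m b c d.
Proof.
move=> /andP[am mb]; rewrite /rect.
rewrite (@cint_split R a m b (fun x => f (x +i* c)))//; last by apply: hor; rewrite ?eqxx ?orbT.
rewrite (@cint_split R a m b (fun x => f (x +i* d)))//; last by apply: hor; rewrite ?eqxx ?orbT.
by ring.
Qed.

Lemma rect_splity m : c <= m <= d -> rect f a b c d = rect f a b c m + rect f a b m d.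
Proof.
move=> /andP[cm md]; rewrite /rect.
rewrite (@cint_split R c m d (fun y => f (a +i* y)))//; last by apply: ver; rewrite ?eqxx ?orbT.
rewrite (@cint_split R c m d (fun y => f (b +i* y)))//; last by apply: ver; rewrite ?eqxx ?orbT.
by ring.
Qed.

Lemma rect_bound (M : R) : (forall z, onbd a b c d z -> nc (f z) <= M) ->
  nc (rect f a b c d) <= 4 * M * ((b - a) + (d - c)).
Proof.
move=> fM; rewrite /rect.
have h1 : nc (cint `[a, b] (fun x => f (x +i* c))) <= 2 * M * (b - a).
  apply: cint_le_itv => // [|x xab]; first by apply: hor; rewrite ?eqxx ?orbT.
  by apply: fM; rewrite /onbd /inrect /= xab lexx cd eqxx ?orbT.
have h2 : nc (cint `[a, b] (fun x => f (x +i* d))) <= 2 * M * (b - a).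
  apply: cint_le_itv => // [|x xab]; first by apply: hor; rewrite ?eqxx ?orbT.
  by apply: fM; rewrite /onbd /inrect /= xab lexx cd eqxx ?orbT.
have h3 : nc (cint `[c, d] (fun y => f (a +i* y))) <= 2 * M * (d - c).
  apply: cint_le_itv => // [|x xab]; first by apply: ver; rewrite ?eqxx ?orbT.
  by apply: fM; rewrite /onbd /inrect /= xab lexx ab eqxx ?orbT.
have h4 : nc (cint `[c, d] (fun y => f (b +i* y))) <= 2 * M * (d - c).
  apply: cint_le_itv => // [|x xab]; first by apply: ver; rewrite ?eqxx ?orbT.
  by apply: fM; rewrite /onbd /inrect /= xab lexx ab eqxx ?orbT.
apply: le_trans (ncD _ _) _; rewrite ncM nc_imag normr1 mul1r.
have h5 := ncB (cint `[a, b] (fun x => f (x +i* c))) (cint `[a, b] (fun x => f (x +i* d))).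
have h6 := ncB (cint `[c, d] (fun y => f (b +i* y))) (cint `[c, d] (fun y => f (a +i* y))).
lra.
Qed.

Lemma rectB g : (forall z, onbd a b c d z -> ccont g z) ->
  rect (fun z => f z - g z) a b c d = rect f a b c d - rect g a b c d.
Proof.
move=> cg.
have h1 y : (y == c) || (y == d) -> cint `[a, b] (fun x => f (x +i* y) - g (x +i* y)) =
  cint `[a, b] (fun x => f (x +i* y)) - cint `[a, b] (fun x => g (x +i* y)).
  move=> ycd; apply: cintB => //; apply: pcont_integrable; first exact: hor.
  apply: pcont_hor => x xab; apply: cg; rewrite /onbd /inrect /= xab.
  by case/orP: ycd => /eqP ->; rewrite lexx cd eqxx ?orbT.
have h2 x : (x == a) || (x == b) -> cint `[c, d] (fun y => f (x +i* y) - g (x +i* y)) =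
  cint `[c, d] (fun y => f (x +i* y)) - cint `[c, d] (fun y => g (x +i* y)).
  move=> xab; apply: cintB => //; apply: pcont_integrable; first exact: ver.
  apply: pcont_ver => y ycd; apply: cg; rewrite /onbd /inrect /= ycd.
  by case/orP: xab => /eqP ->; rewrite lexx ab eqxx ?orbT.
by rewrite /rect !h1 ?eqxx ?orbT// !h2 ?eqxx ?orbT//; ring.
Qed.

End fixed.

Lemma rect_quad f a m b c n d : a <= m <= b -> c <= n <= d ->
  (forall z, inrect a b c d z -> ccont f z) ->
  rect f a b c d = (rect f a m c n + rect f m b c n) + (rect f a m n d + rect f m b n d).
Proof.
move=> /andP[am mb] /andP[cn nd] cf.
have ab := le_trans am mb; have cd := le_trans cn nd.
rewrite (@rect_splity _ _ _ _ _ ab (fun z h => cf z (onbd_in h)) n) ?cn//.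
rewrite (@rect_splitx _ a b c n _ _ m) ?am//; last first.
  by move=> z /andP[/andP[h1 h2] _]; apply: cf; rewrite /inrect; lra.
rewrite (@rect_splitx _ a b n d _ _ m) ?am//.
by move=> z /andP[/andP[h1 h2] _]; apply: cf; rewrite /inrect; lra.
Qed.

Lemma rect_affine (k l : R[i]) a b c d : a <= b -> c <= d ->
  rect (fun z => k + l * z) a b c d = 0.
Proof.
move=> ab cd.
have cl z : ccont (fun z => k + l * z) z.
  by apply: ccontD; [exact: ccont_cst|apply: ccontM; [exact: ccont_cst|exact: ccont_id]].
have ih y : cintegrable `[a, b] (fun x => k + l * (x +i* y)).
  by apply: pcont_integrable; apply: (@pcont_hor (fun z => k + l * z)).
have iv x : cintegrable `[c, d] (fun y => k + l * (x +i* y)).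
  by apply: pcont_integrable; apply: (@pcont_ver (fun z => k + l * z)).
rewrite /rect -!cintB//.
rewrite (@eq_cint _ _ _ (fun=> l * (0 +i* (c - d)))); last first.
  move=> x _; rewrite opprD addrACA subrr add0r -mulrBr; congr (_ * _).
  by apply: eqC; rewrite ?ReD ?ImD ?ReN ?ImN /=; ring.
rewrite [X in _ + _ * X](@eq_cint _ _ _ (fun=> l * (b - a)%:C)); last first.
  move=> x _; rewrite opprD addrACA subrr add0r -mulrBr; congr (_ * _).
  by apply: eqC; rewrite ?ReD ?ImD ?ReN ?ImN /=; ring.
rewrite !cint_itv_cst//.
have -> : 0 +i* (c - d) = - ('i * (d - c)%:C) :> R[i].
  by apply: eqC; rewrite ?ReN ?ImN ?ReM ?ImM /=; ring.
by ring.
Qed.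

Lemma le_sum4 (x1 x2 x3 x4 t s s1 s2 : R) : 4 * t <= s -> s <= s1 + s2 ->
  s1 <= x1 + x2 -> s2 <= x3 + x4 -> [|| t <= x1, t <= x2, t <= x3 | t <= x4].
Proof.
move=> h0 h h1 h2; case: leP => //= g1; case: leP => //= g2; case: leP => //= g3.
by rewrite leNgt; apply/negP => g4; lra.
Qed.

Lemma archi_pow2 (e s : R) : 0 < e -> exists n, s / 2 ^+ n < e.
Proof.
move=> e0; exists (Num.bound (`|s| / e)).
rewrite ltr_pdivrMr ?exprn_gt0//; apply: le_lt_trans (ler_norm s) _.
have /archi_boundP : 0 <= `|s| / e by rewrite divr_ge0// ltW.
rewrite ltr_pdivrMr// => h; apply: lt_le_trans h _; rewrite mulrC ler_pM2l//.
by rewrite -natrX ler_nat ltnW// ltn_expl.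
Qed.

Lemma halving_step (u u' v v' w w1 : R) : u <= v -> v + w <= u' -> 0 <= w1 -> w = w1 + w1 ->
  (v' == v) || (v' == v + w1) -> [/\ u <= v', v' + w1 <= u' & v <= v' <= v + w1].
Proof. by move=> ? ? ? ? /orP[] /eqP ->; split; lra. Qed.

Lemma dist_itv (u w x y : R) : u <= x <= u + w -> u <= y <= u + w -> `|x - y| <= w.
Proof. by rewrite ler_norml; lra. Qed.

(** Quadrisection: one of four subrectangles carries at least a quarter of the integral. The chosen
    rectangles shrink to a point, where f is affine up to o (|z - z0|). Affine functions integrate
    to 0 and the perimeter shrinks like the diameter, so the integral at generation n is o
    (4^-n). *)
Lemma goursat f a b c d : a <= b -> c <= d ->
  (forall z, inrect a b c d z -> cdiff f z) -> rect f a b c d = 0.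
Proof.
move=> ab cd df.
have cf z : inrect a b c d z -> ccont f z by move/df/cdiff_cont.
apply/eqP; rewrite -nc_eq0; apply/eqP; apply/le_anti; rewrite nc_ge0 andbT leNgt.
apply/negP; set N := nc _ => N0.
(* Width and height after n bisections; a rectangle of generation n is recorded by its lower left
   corner alone. *)
pose W n : R := (b - a) / 2 ^+ n; pose H n : R := (d - c) / 2 ^+ n.
pose Q n (s : R * R) := rect f s.1 (s.1 + W n) s.2 (s.2 + H n).
have W0 n : 0 <= W n by rewrite divr_ge0 ?subr_ge0// exprn_ge0.
have H0 n : 0 <= H n by rewrite divr_ge0 ?subr_ge0// exprn_ge0.
have WS n : W n = W n.+1 + W n.+1.
  by rewrite /W exprS; field; rewrite expf_neq0.
have HS n : H n = H n.+1 + H n.+1.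
  by rewrite /H exprS; field; rewrite expf_neq0.
pose P n (s : R * R) := [/\ a <= s.1, s.1 + W n <= b, c <= s.2, s.2 + H n <= d &
  N / 4 ^+ n <= nc (Q n s)].
(* The premise [P n s] makes the relation total, so that [choice] applies to all corners. *)
pose T n (s s' : R * R) := P n s -> P n.+1 s' /\
  ((s.1 <= s'.1 <= s.1 + W n.+1) && (s.2 <= s'.2 <= s.2 + H n.+1)).
have step (ns : nat * (R * R)) : exists s', T ns.1 ns.2 s'.
  case: ns => n s /=; rewrite /T.
  case: (pselect (P n s)) => [|nP]; last by exists s.
  case: s => x y [xa xb yc yd NQ]; rewrite /= in xa xb yc yd.
  have W1 := W0 n.+1; have H1 := H0 n.+1; have WSn := WS n; have HSn := HS n.
  have cf' z : inrect x (x + W n) y (y + H n) z -> ccont f z.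
    by move=> zin; apply: cf; exact: inrect_sub zin.
  pose x' := x + W n.+1; pose y' := y + H n.+1.
  have Qsplit : Q n (x, y) = (Q n.+1 (x, y) + Q n.+1 (x', y)) + (Q n.+1 (x, y') + Q n.+1 (x', y')).
    have xE : x + W n = x' + W n.+1 by rewrite /x'; lra.
    have yE : y + H n = y' + H n.+1 by rewrite /y'; lra.
    by rewrite /Q /= xE yE; apply: rect_quad; rewrite -?xE -?yE// /x' /y'; lra.
  have [s' s'P] : exists2 s', N / 4 ^+ n.+1 <= nc (Q n.+1 s') &
      ((s'.1 == x) || (s'.1 == x')) && ((s'.2 == y) || (s'.2 == y')).
    have N4 : N / 4 ^+ n = 4 * (N / 4 ^+ n.+1).
      by rewrite exprS; field; rewrite expf_neq0.
    have t1 := ncD (Q n.+1 (x, y) + Q n.+1 (x', y)) (Q n.+1 (x, y') + Q n.+1 (x', y')).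
    have t2 := ncD (Q n.+1 (x, y)) (Q n.+1 (x', y)).
    have t3 := ncD (Q n.+1 (x, y')) (Q n.+1 (x', y')).
    rewrite Qsplit N4 in NQ.
    have /or4P[h|h|h|h] := le_sum4 NQ t1 t2 t3.
    - by exists (x, y) => //=; rewrite !eqxx.
    - by exists (x', y) => //=; rewrite !eqxx orbT.
    - by exists (x, y') => //=; rewrite !eqxx orbT.
    - by exists (x', y') => //=; rewrite !eqxx !orbT.
  move=> /andP[e1 e2]; exists s' => _.
  have [g1 g2 g3] := halving_step xa xb W1 WSn e1.
  have [g4 g5 g6] := halving_step yc yd H1 HSn e2.
  by split; [split|rewrite g3 g6].
have [F FP] := choice step.
pose s := fix s n := if n is m.+1 then F (m, s m) else (a, c).
have sP n : P n (s n).
  elim: n => [|n IH] /=; last by have [] := FP (n, s n) IH.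
  have WE : a + W 0%N = b by rewrite /W expr0 divr1 addrC subrK.
  have HE : c + H 0%N = d by rewrite /H expr0 divr1 addrC subrK.
  by split; rewrite /Q /= ?WE ?HE ?lexx // expr0 divr1 lexx.
have sS n : ((s n).1 <= (s n.+1).1 <= (s n).1 + W n.+1) && ((s n).2 <= (s n.+1).2 <= (s n).2 + H n.+1).
  by have [] := FP (n, s n) (sP n).
(* Nested intervals: the supremum of the left endpoints lies in all of them. *)
have lim_ (u V : nat -> R) : (forall n, 0 <= V n) -> (forall n, V n = V n.+1 + V n.+1) ->
    (forall n, u n <= u n.+1 <= u n + V n.+1) ->
    exists l, forall n, u n <= l <= u n + V n.
  move=> V0 VS uS.
  have um m k : u m <= u (m + k)%N /\ u (m + k)%N + V (m + k)%N <= u m + V m.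
    elim: k => [|k [IH1 IH2]]; rewrite ?addn0// addnS.
    have /andP[h1 h2] := uS (m + k)%N; have := VS (m + k)%N; lra.
  have ub m n : u m <= u n + V n.
    case: (leqP m n) => [/subnKC <-|/ltnW/subnKC <-].
      by have [h1 h2] := um m (n - m)%N; have := V0 (m + (n - m))%N; lra.
    by have [h1 h2] := um n (m - n)%N; have := V0 (n + (m - n))%N; lra.
  exists (sup (range u)) => n; apply/andP; split.
    apply: ub_le_sup; last by exists n.
    by exists (u 0%N + V 0%N) => _ [m _ <-]; exact: ub.
  by apply: ge_sup; [exists (u 0%N); exists 0%N|move=> _ [m _ <-]; exact: ub].
have [|x0 hx] := lim_ (fun n => (s n).1) W W0 WS; first by move=> n; have /andP[] := sS n.
have [|y0 hy] := lim_ (fun n => (s n).2) H H0 HS; first by move=> n; have /andP[] := sS n.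
pose z0 := x0 +i* y0.
have z0in : inrect a b c d z0.
  have [h1 h2 h3 h4 _] := sP 0%N; have /andP[h5 h6] := hx 0%N; have /andP[h7 h8] := hy 0%N.
  rewrite /inrect /=; lra.
have [phi cphi [d0 d00 phiE]] := df _ z0in.
pose S := (b - a) + (d - c).
have S0 : 0 <= S by rewrite addr_ge0 ?subr_ge0.
(* With this precision 4 e S^2 < N, which contradicts the lower bound N / 4^n; the summand 1 covers
   degenerate rectangles, where S = 0. *)
have e0 : 0 < N / (8 * (S ^+ 2 + 1)).
  by rewrite divr_gt0// mulr_gt0// ltr_wpDl ?sqr_ge0.
set e := N / _ in e0.
have [d1 d10 hd1] := cphi _ e0.
have [|n nP] := @archi_pow2 (Num.min d0 d1) S; first by rewrite lt_min d00.
have [h1 h2 h3 h4 hQ] := sP n.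
have SE : S / 2 ^+ n = W n + H n by rewrite /W /H -mulrDl.
have near z : inrect (s n).1 ((s n).1 + W n) (s n).2 ((s n).2 + H n) z -> nc (z - z0) <= S / 2 ^+ n.
  move=> /andP[g1 g2].
  apply: le_trans (nc_ReIm _) _; rewrite ReD ImD ReN ImN /= SE.
  by apply: lerD; [exact: dist_itv g1 (hx n)|exact: dist_itv g2 (hy n)].
have inn z : inrect (s n).1 ((s n).1 + W n) (s n).2 ((s n).2 + H n) z -> inrect a b c d z.
  exact: inrect_sub.
(* Tangent of f at [z0]. Subtracting it leaves (phi z - phi z0) (z - z0), of size at most e times
   the diameter. *)
pose aff z := (f z0 - phi z0 * z0) + phi z0 * z.
have caff z : ccont aff z.
  by apply: ccontD; [exact: ccont_cst|apply: ccontM; [exact: ccont_cst|exact: ccont_id]].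
have QE : Q n (s n) = rect (fun z => f z - aff z) (s n).1 ((s n).1 + W n) (s n).2 ((s n).2 + H n).
  rewrite rectB; rewrite ?lerDl//; first by rewrite rect_affine ?subr0// lerDl.
  by move=> z /onbd_in /inn /cf.
have : nc (Q n (s n)) <= 4 * (e * (S / 2 ^+ n)) * (S / 2 ^+ n).
  rewrite QE; apply: le_trans (rect_bound (M := e * (S / 2 ^+ n)) _ _ _ _) _; rewrite ?lerDl//.
  - by move=> z /onbd_in /inn /cf cz; apply: ccontB.
  - move=> z /onbd_in zin; have nz := near z zin; have nz' := le_lt_trans nz nP.
    move: nz'; rewrite lt_min => /andP[/phiE E /hd1 hd].
    have -> : f z - aff z = (phi z - phi z0) * (z - z0).
      by rewrite /aff mulrBl -E; ring.
    by rewrite ncM ler_pM ?nc_ge0// ltW.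
  by rewrite ![(s n).1 + _]addrC ![(s n).2 + _]addrC !addrK -SE.
move/(le_trans hQ).
have -> : 4 * (e * (S / 2 ^+ n)) * (S / 2 ^+ n) = (4 * e * S ^+ 2) / 4 ^+ n.
  have -> : 4 = 2 ^+ 2 :> R by rewrite expr2 -natrM.
  by rewrite -exprM mulnC exprM; field; rewrite expf_neq0.
rewrite ler_pM2r ?invr_gt0 ?exprn_gt0//.
have -> : 4 * e * S ^+ 2 = N * (S ^+ 2 / (S ^+ 2 + 1)) / 2.
  by rewrite /e; field; rewrite gt_eqF// ltr_wpDl ?sqr_ge0.
have S1 : S ^+ 2 / (S ^+ 2 + 1) <= 1.
  by rewrite ler_pdivrMr ?mul1r ?lerDl// ltr_wpDl ?sqr_ge0.
rewrite leNgt => /negP; apply.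
apply: (@le_lt_trans _ _ (N / 2)); last by rewrite ltr_pdivrMr// ltr_pMr// ltr1n.
by rewrite ler_pM2r ?invr_gt0// ler_piMr// ltW.
Qed.

End Goursat.

(** * Goursat's theorem with a bounded isolated singularity *)

Section Hole.
Variable R : realType.
Implicit Types (f g : R[i] -> R[i]) (a b c d p q x y : R) (z w : R[i]).

(** Cutting a square of half-side r around the singular point leaves four rectangles to which
    Goursat's theorem applies; the square itself contributes O (r) because f is bounded there. *)
Lemma goursat_hole f a b c d p q : a < p < b -> c < q < d ->
  (forall z, inrect a b c d z -> z != p +i* q -> cdiff f z) ->
  (exists M d0 : R, 0 < d0 /\ forall z, nc (z - p +i* q) < d0 -> z != p +i* q -> nc (f z) <= M) ->
  rect f a b c d = 0.
Proof.
move=> /andP[ap pb] /andP[cq qd] df [M [d0 [d00 fM]]].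
have cf z : inrect a b c d z -> z != p +i* q -> ccont f z by move=> h1 h2; exact/cdiff_cont/df.
pose M1 := `|M|.
have key (r : R) : 0 < r -> a <= p - r -> p + r <= b -> c <= q - r -> q + r <= d -> 2 * r < d0 ->
    nc (rect f a b c d) <= 16 * M1 * r.
  move=> r0 h1 h2 h3 h4 h5.
  have [pr qr] : p - r <= p + r /\ q - r <= q + r by split; lra.
  have [ab cd] : a <= b /\ c <= d by split; lra.
  have [apr pbr] : p - r <= b /\ a <= p + r by split; lra.
  have [cqr qdr] : q - r <= d /\ c <= q + r by split; lra.
  have [m1 m2] : (c <= q - r <= d) /\ (q - r <= q + r <= d) by rewrite h3 cqr qr h4.
  have [m3 m4] : (a <= p - r <= b) /\ (p - r <= p + r <= b) by rewrite h1 apr pr h2.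
  have zr x y : (`|x - p| >= r) || (`|y - q| >= r) -> x +i* y != p +i* q.
    apply: contraL => /eqP[-> ->].
    by rewrite !subrr normr0 orbb -ltNge r0.
  have zz x1 x2 y1 y2 : a <= x1 -> x2 <= b -> c <= y1 -> y2 <= d ->
      [|| x2 <= p - r, p + r <= x1, y2 <= q - r | q + r <= y1] -> x1 <= x2 -> y1 <= y2 ->
      rect f x1 x2 y1 y2 = 0.
    move=> g1 g2 g3 g4 g5 g6 g7; apply: goursat => // -[x y] zin.
    apply: df; first exact: inrect_sub zin.
    have /andP[/= /andP[k1 k2] /andP[k3 k4]] := zin.
    apply: zr; rewrite !ler_normr; case/or4P: g5 => g5.
    - by apply/orP; left; apply/orP; right; rewrite opprB lerBrDr addrC -lerBrDr (le_trans k2).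
    - by apply/orP; left; apply/orP; left; rewrite lerBrDr addrC (le_trans _ k1).
    - by apply/orP; right; apply/orP; right; rewrite opprB lerBrDr addrC -lerBrDr (le_trans k4).
    - by apply/orP; right; apply/orP; left; rewrite lerBrDr addrC (le_trans _ k3).
  have bd x1 x2 y1 y2 : a <= x1 -> x2 <= b -> c <= y1 -> y2 <= d ->
      x1 <= p - r -> p + r <= x2 -> y1 <= q - r -> q + r <= y2 ->
      forall z, onbd x1 x2 y1 y2 z -> ccont f z.
    move=> g1 g2 g3 g4 g5 g6 g7 g8 [x y] /andP[zin /= k].
    apply: cf; first exact: inrect_sub zin.
    apply: zr; rewrite !ler_normr; case/or4P: k => /eqP ->.
    - by apply/orP; left; apply/orP; right; rewrite opprB lerBrDr addrC -lerBrDr.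
    - by apply/orP; left; apply/orP; left; rewrite lerBrDr addrC.
    - by apply/orP; right; apply/orP; right; rewrite opprB lerBrDr addrC -lerBrDr.
    - by apply/orP; right; apply/orP; left; rewrite lerBrDr addrC.
  have -> : rect f a b c d = rect f (p - r) (p + r) (q - r) (q + r).
    rewrite (@rect_splity _ f a b c d _ _ (q - r))//; last exact: bd.
    rewrite (zz a b c (q - r)) ?add0r ?lexx ?orbT//.
    rewrite (@rect_splity _ f a b (q - r) d _ _ (q + r))//; last exact: bd.
    rewrite (zz a b (q + r) d) ?addr0 ?lexx ?orbT//.
    rewrite (@rect_splitx _ f a b (q - r) (q + r) _ _ (p - r))//; last exact: bd.
    rewrite (zz a (p - r)) ?add0r ?lexx ?orbT//.
    rewrite (@rect_splitx _ f (p - r) b (q - r) (q + r) _ _ (p + r))//; last exact: bd.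
    by rewrite (zz (p + r) b) ?addr0 ?lexx ?orbT.
  have M10 : 0 <= M1 := normr_ge0 _.
  apply: le_trans (rect_bound (M := M1) pr qr _ _) _; last by rewrite le_eqVlt; apply/orP; left; apply/eqP; ring.
    exact: bd.
  move=> [x y] /andP[/andP[/= k1 k2] /= k].
  apply: le_trans (fM _ _ _) (ler_norm _).
    apply: le_lt_trans (nc_ReIm _) _; rewrite ReD ImD ReN ImN /=.
    by apply: le_lt_trans h5; rewrite mulr_natl mulr2n; apply: lerD; rewrite ler_distl.
  apply: zr; rewrite !ler_normr; case/or4P: k => /eqP ->.
  - by rewrite opprB subKr lexx orbT.
  - by rewrite addrAC subrr add0r lexx.
  - by rewrite [- (q - r - q)]opprB subKr lexx !orbT.
  - by rewrite [q + r - q]addrAC subrr add0r lexx !orbT.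
apply/eqP; rewrite -nc_eq0; apply/eqP/le_anti; rewrite nc_ge0 andbT.
apply/ler_addgt0Pl => e e0; rewrite addr0.
(* Small enough for the square to fit into the rectangle and into the disc where f is bounded, and
   for 16 M1 r to stay below e. *)
pose r := Num.min (Num.min (p - a) (b - p)) (Num.min (Num.min (q - c) (d - q))
  (Num.min (d0 / 3) (e / (16 * (M1 + 1))))).
have M10 : 0 <= M1 by exact: normr_ge0.
have r0 : 0 < r.
  by rewrite !lt_min !subr_gt0 ap pb cq qd !divr_gt0 // mulr_gt0 // ltr_wpDl.
have := lexx r; rewrite {2}/r; clearbody r.
rewrite !le_min => /andP[/andP[g1 g2] /andP[/andP[g3 g4] /andP[g5 g6]]].
apply: le_trans (key r r0 _ _ _ _ _) _; try lra.
apply: (@le_trans _ _ (16 * (M1 + 1) * r)); first by rewrite ler_wpM2r ?(ltW r0)//; lra.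
by rewrite mulrC -ler_pdivlMr//; lra.
Qed.

End Hole.

(** * Cauchy's formula on a rectangle, as a comparison of two integrands *)

Section CauchyRectangle.
Variable R : realType.
Implicit Types (f g : R[i] -> R[i]) (a b c d p q x y : R) (z w : R[i]).

(** Both integrands have the same residue at l, so their difference is bounded there. No winding
    number is computed: the right-hand integrand decays quadratically, and its integral over a whole
    line will be explicit for a suitable m. *)
Lemma cauchy_rect f a b c d (l m : R[i]) :
  a < complex.Re l < b -> c < complex.Im l < d ->
  (forall z, inrect a b c d z -> cdiff f z) -> complex.Im m < c ->
  rect (fun z => f z * (z - l)^-1) a b c d =
  rect (fun z => f l * (l - m) * ((z - m)^-1 * (z - l)^-1)) a b c d.
Proof.
case: l => p q /= ap cq df mc; set l := p +i* q.
have dl k z : z != k -> cdiff (fun z => (z - k)^-1) z.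
  move=> zk; apply: cdiffV; last by rewrite subr_eq0.
  by apply: cdiffB; [exact: cdiff_id|exact: cdiff_cst].
have zm z : inrect a b c d z -> z != m.
  move=> /andP[_ /andP[h _]]; apply: contraTneq mc => <-; rewrite -leNgt; exact: h.
have bdl z : onbd a b c d z -> z != l.
  move=> /andP[_]; apply: contraTneq => -> /=; rewrite !negb_or.
  case/andP: ap => h1 h2; case/andP: cq => h3 h4.
  by rewrite (gt_eqF h1) (lt_eqF h2) (gt_eqF h3) (lt_eqF h4).
have dA z : inrect a b c d z -> z != l -> cdiff (fun z => f z * (z - l)^-1) z.
  by move=> h1 h2; apply: cdiffM; [exact: df|exact: dl].
have dC z : inrect a b c d z -> z != l ->
    cdiff (fun z => f l * (l - m) * ((z - m)^-1 * (z - l)^-1)) z.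
  move=> h1 h2; apply: cdiffM; first exact: cdiff_cst.
  by apply: cdiffM; apply: dl => //; exact: zm.
have lin : inrect a b c d l by rewrite /inrect /=; lra.
apply/eqP; rewrite -subr_eq0 -rectB; last first.
- by move=> z zb; apply/cdiff_cont/dC; [exact: onbd_in|exact: bdl].
- by move=> z zb; apply/cdiff_cont/dA; [exact: onbd_in|exact: bdl].
- by lra.
- by lra.
apply/eqP; apply: (goursat_hole ap cq).
  by move=> z h1 h2; apply: cdiffB; [exact: dA|exact: dC].
(* The slope of [f z * (z - m)] at [l], divided by [z - m], is the difference of the two
   integrands. *)
have : cdiff (fun z => f z * (z - m)) l.
  apply: cdiffM; first exact: df.
  by apply: cdiffB; [exact: cdiff_id|exact: cdiff_cst].
move=> [phi cphi [d1 d10 phiE]].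
have lm : l - m != 0 by rewrite subr_eq0 zm.
have c2 : ccont (fun z => z - m) l by apply: ccontB; [exact: ccont_id|exact: ccont_cst].
have [d2 d20 h2] := ccont_bound (ccontM cphi (ccontV c2 lm)).
have [d3 d30 h3] := ccont_neq0 c2 lm.
exists (nc (phi l * (l - m)^-1) + 1), (Num.min d1 (Num.min d2 d3)).
rewrite !lt_min d10 d20 d30; split => // z.
rewrite !lt_min => /and3P[/phiE E /h2 /ltW g2 /h3 g3] zl.
have zm0 : z - m != 0.
  by rewrite -nc_gt0; apply: le_lt_trans g3; rewrite divr_ge0 ?nc_ge0.
have zl0 : z - l != 0 by rewrite subr_eq0.
apply: le_trans g2; have -> : f z / (z - l) - f l * (l - m) * ((z - m)^-1 / (z - l)) =
  (f z * (z - m) - f l * (l - m)) / ((z - l) * (z - m)) by field; rewrite zm0 zl0.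
rewrite E le_eqVlt; apply/orP; left; apply/eqP; congr nc.
by field; rewrite zm0 zl0.
Qed.

End CauchyRectangle.

(** * Fundamental theorem of calculus and product rule for complex-valued functions *)

Section FundamentalTheorem.
Variable R : realType.
Local Notation mu := (@lebesgue_measure R).
Implicit Types (a b c x y t : R).

(** Differentiability of G relative to [a, b] with derivative g, written as an error estimate so
    that the endpoints need no separate treatment. *)
Definition slopes a b (G g : R -> R[i]) := forall x, a <= x <= b -> forall e : R, 0 < e ->
  exists2 d : R, 0 < d & forall t, a <= t <= b -> `|t - x| < d ->
    nc (G t - G x - (t - x)%:C * g x) <= e * `|t - x|.

Lemma ftc_real a b (G g : R -> R) : a < b -> {within `[a, b], continuous g} ->
  (forall x, a <= x <= b -> forall e : R, 0 < e ->
  exists2 d : R, 0 < d & forall t, a <= t <= b -> `|t - x| < d ->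
    `|G t - G x - (t - x) * g x| <= e * `|t - x|) ->
  Rintegral mu `[a, b] g = G b - G a.
Proof.
move=> ab cg dG.
have cG x : a <= x <= b -> forall e : R, 0 < e -> exists2 d : R, 0 < d &
    forall t, a <= t <= b -> `|t - x| < d -> `|G x - G t| < e.
  move=> xab e e0; have [d d0 hd] := dG x xab _ ltr01.
  have K0 : 0 < 2 + `|g x| by rewrite ltr_wpDr.
  exists (Num.min d (e / (2 + `|g x|))); first by rewrite lt_min d0 divr_gt0.
  move=> t tab; rewrite lt_min ltr_pdivlMr// => /andP[/(hd t tab) h1 h2].
  apply: le_lt_trans h2; rewrite distrC.
  have -> : G t - G x = (G t - G x - (t - x) * g x) + (t - x) * g x by ring.
  apply: le_trans (ler_normD _ _) _; rewrite normrM.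
  have := normr_ge0 (t - x); have := normr_ge0 (g x); nra.
have dx x : a < x < b -> (h^-1 *: (G (h *: 1 + x) - G x)) @[h --> 0^'] --> g x.
  move=> /andP[ax xb]; apply/cvgrPdist_le => e e0.
  have xab : a <= x <= b by rewrite !ltW.
  have [d d0 hd] := dG x xab _ e0.
  exists (Num.min d (Num.min (x - a) (b - x))) => /=.
    by rewrite !lt_min d0 !subr_gt0 ax.
  move=> h /=; rewrite sub0r normrN !lt_min => /and3P[h1 h2 h3] h0.
  rewrite /GRing.scale /= mulr1.
  have hx : a <= h + x <= b.
    by move: h2 h3; rewrite !ltr_norml => /andP[? ?] /andP[? ?]; lra.
  have := hd _ hx; rewrite addrK => /(_ h1) hh.
  have h00 : 0 < `|h| by rewrite normr_gt0.
  rewrite -(ler_pM2r h00) -normrM; apply: le_trans hh.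
  have -> : (g x - h^-1 * (G (h + x) - G x)) * h = - (G (h + x) - G x - h * g x) by field.
  by rewrite normrN.
have aab : a <= a <= b by rewrite lexx ltW.
have bab : a <= b <= b by rewrite lexx ltW.
rewrite /Rintegral (@continuous_FTC2 _ _ G)//.
- split.
  + by move=> x; rewrite in_itv /= => /dx h; apply/cvg_ex; exists (g x).
  + apply/cvgrPdist_lt => e /(cG a aab)[d d0 hd].
    exists (Num.min d (b - a)); first by rewrite /= lt_min d0 subr_gt0.
    move=> t /=; rewrite lt_min distrC => /andP[h1 h2] at_; apply: hd => //.
    by rewrite (ltW at_)/=; move: h2; rewrite ltr_norml; lra.
  + apply/cvgrPdist_lt => e /(cG b bab)[d d0 hd].
    exists (Num.min d (b - a)); first by rewrite /= lt_min d0 subr_gt0.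
    move=> t /=; rewrite lt_min distrC => /andP[h1 h2] tb; apply: hd => //.
    by rewrite (ltW tb) andbT; move: h2; rewrite ltr_norml; lra.
- move=> x; rewrite in_itv /= => /dx h; rewrite derive1E; exact: cvg_lim h.
Qed.

Lemma cint_ftc a b (G g : R -> R[i]) : a < b -> pcont `[a, b] g -> slopes a b G g ->
  cint `[a, b] g = G b - G a.
Proof.
move=> ab cg dG.
apply: eqC; rewrite ?ReD ?ImD ?ReN ?ImN /=.
  apply: (@ftc_real _ _ (fun x => complex.Re (G x))) => //; first exact: pcont_ReE.
  move=> x xab e /(dG x xab)[d d0 hd]; exists d => // t tab td.
  apply: le_trans (hd t tab td); apply: le_trans (nc_Re _).
  by rewrite !(ReD, ReN, ReM) /= mul0r subr0.
apply: (@ftc_real _ _ (fun x => complex.Im (G x))) => //; first exact: pcont_ImE.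
move=> x xab e /(dG x xab)[d d0 hd]; exists d => // t tab td.
apply: le_trans (hd t tab td); apply: le_trans (nc_Im _).
by rewrite !(ImD, ImN, ImM) /= mul0r addr0.
Qed.

Lemma slopes_cint a b (g : R -> R[i]) : pcont `[a, b] g ->
  slopes a b (fun x => cint `[a, x] g) g.
Proof.
move=> cg x /andP[ax xb] e e0.
(* Half of e compensates the factor 2 of [cint_le_itv]. *)
have e20 : 0 < e / 2 by rewrite divr_gt0.
have xI : `[a, b]%classic x by rewrite /= in_itv /= ax.
have [d d0 hd] := cg x xI _ e20.
exists d => // t /andP[at_ tb] td.
have sub c1 c2 : a <= c1 -> c2 <= b -> pcont `[c1, c2] g.
  move=> h1 h2; apply: pcont_sub cg => s /=; rewrite !in_itv /= => /andP[h3 h4].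
  by rewrite (le_trans h1 h3) (le_trans h4 h2).
have key c1 c2 : a <= c1 -> c1 <= c2 -> c2 <= b -> (c1 == x) || (c2 == x) ->
    `|c1 - x| < d -> `|c2 - x| < d ->
    nc (cint `[a, c2] g - cint `[a, c1] g - (c2 - c1)%:C * g x) <= e * (c2 - c1).
  move=> h1 h2 h3 h4 h5 h6.
  have s12 := sub _ _ h1 h3.
  rewrite (@cint_split _ a c1 c2)//; last exact: sub.
  rewrite [cint `[a, c1] g + _]addrC addrK -cint_itv_cst// -cintB//; last 2 first.
  - exact: pcont_integrable.
  - by apply: pcont_integrable => s _ e' e'0; exists 1 => // s' _ _; rewrite subrr nc0.
  apply: le_trans (cint_le_itv (c := e / 2) _ _ _) _ => //.
  - move=> s /s12 hs e' /hs[d' d'0 hd']; exists d' => // s' s'12 /(hd' s' s'12).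
    by have -> : g s' - g x - (g s - g x) = g s' - g s by ring.
  - move=> s /andP[k1 k2]; apply/ltW/hd.
      by rewrite /= in_itv /= (le_trans h1 k1) (le_trans k2 h3).
    by move: h5 h6; rewrite !ltr_norml => /andP[? ?] /andP[? ?]; lra.
  - by rewrite mulrCA divff ?mulr1.
have [xt|tx] := leP x t.
  rewrite ger0_norm ?subr_ge0//; apply: key => //; rewrite ?eqxx// subrr normr0.
  exact: d0.
rewrite ltr0_norm ?subr_lt0// opprB -ncN.
have -> : - (cint `[a, t] g - cint `[a, x] g - (t - x)%:C * g x) =
   cint `[a, x] g - cint `[a, t] g - (x - t)%:C * g x.
  have -> : (x - t)%:C = - (t - x)%:C :> R[i] by apply: eqC; rewrite ?ReN ?ImN /=; ring.
  by ring.
by apply: key => //; rewrite ?eqxx ?orbT ?(ltW tx)// subrr normr0.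
Qed.

Lemma slopes_mul a b (F f G g : R -> R[i]) (K : R) : slopes a b F f -> slopes a b G g ->
  (forall x, a <= x <= b -> nc (F x) <= K /\ nc (f x) <= K /\ nc (G x) <= K /\ nc (g x) <= K) ->
  slopes a b (fun x => F x * G x) (fun x => f x * G x + F x * g x).
Proof.
move=> sF sG bd x xab e e0.
have [F1 [f1 [G1 g1]]] := bd x xab; have K0 : 0 <= K by apply: le_trans F1; exact: nc_ge0.
have e1 : 0 < e / (4 * (K + 1)) by rewrite divr_gt0// mulr_gt0// ltr_wpDl.
have [d1 d10 h1] := sF x xab _ e1; have [d2 d20 h2] := sG x xab _ e1.
have [d3 d30 h3] := sF x xab _ ltr01.
exists (Num.min d1 (Num.min d2 (Num.min d3 (e / (4 * (K + 1) ^+ 2))))).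
  by rewrite !lt_min d10 d20 d30 divr_gt0// mulr_gt0// exprn_gt0// ltr_wpDl.
move=> t tab; rewrite !lt_min => /and4P[/(h1 t tab) k1 /(h2 t tab) k2 /(h3 t tab) k3].
set D := `|t - x| in k1 k2 k3 *; have D0 : 0 <= D := normr_ge0 _.
rewrite ltr_pdivlMr ?mulr_gt0 ?exprn_gt0 ?ltr_wpDl// => k4.
have [F2 [f2 [G2 g2]]] := bd t tab.
have FD : nc (F t - F x) <= (K + 1) * D.
  have -> : F t - F x = (F t - F x - (t - x)%:C * f x) + (t - x)%:C * f x by ring.
  apply: le_trans (ncD _ _) _; rewrite ncM nc_real -/D; nra.
have -> : F t * G t - F x * G x - (t - x)%:C * (f x * G x + F x * g x) =
  (F t - F x - (t - x)%:C * f x) * G x + (G t - G x - (t - x)%:C * g x) * F t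
   + (F t - F x) * ((t - x)%:C * g x) by ring.
apply: le_trans (ncD _ _) _; apply: le_trans (lerD (ncD _ _) (lexx _)) _.
rewrite !ncM nc_real -/D.
set E := e / _ in e1 k1 k2.
have EE : E * (4 * (K + 1)) = e by rewrite /E divfK// mulf_neq0// gt_eqF// ltr_wpDl.
have g0 := nc_ge0 (g x); have G0 := nc_ge0 (G x); have F0 := nc_ge0 (F t).
have t1 : nc (F t - F x - (t - x)%:C * f x) * nc (G x) <= E * D * K.
  by apply: ler_pM; rewrite ?nc_ge0.
have t2 : nc (G t - G x - (t - x)%:C * g x) * nc (F t) <= E * D * K.
  by apply: ler_pM; rewrite ?nc_ge0.
have t3 : nc (F t - F x) * (D * nc (g x)) <= (K + 1) * D * (D * K).
  by apply: ler_pM; rewrite ?nc_ge0 ?mulr_ge0// ler_wpM2l.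
have t4 : (K + 1) * D * (D * K) <= e / 4 * D.
  have -> : (K + 1) * D * (D * K) = D * (K * (K + 1)) * D by ring.
  rewrite ler_wpM2r//; nra.
have t5 : E * D * K <= e / 4 * D.
  have -> : e / 4 * D = E * D * (K + 1) by rewrite -EE; field.
  by rewrite ler_wpM2l ?lerDl// mulr_ge0// ltW.
have e0D : 0 <= e * D by rewrite mulr_ge0// ltW.
lra.
Qed.

End FundamentalTheorem.

(** * Square-integrable functions on the line, and the Poisson integral *)

Section SquareIntegrable.
Variable R : realType.
Local Notation mu := (@lebesgue_measure R).
Implicit Types (p q : R -> R[i]) (M N K t x y : R).

Definition cmeas p := measurable_fun setT (fun x => complex.Re (p x)) /\
  measurable_fun setT (fun x => complex.Im (p x)).

Definition sqint p M := cmeas p /\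
  (\int[mu]_x ((nc (p x)) ^+ 2)%:E <= M%:E)%E.

Lemma cmeas_cont p : pcont setT p -> cmeas p.
Proof. by move=> cp; split; [exact: pcont_measurableRe|exact: pcont_measurableIm]. Qed.

Lemma cmeasD p q : cmeas p -> cmeas q -> cmeas (fun x => p x + q x).
Proof.
move=> [p1 p2] [q1 q2]; split.
  under eq_fun do rewrite ReD; exact: measurable_funD.
under eq_fun do rewrite ImD; exact: measurable_funD.
Qed.

Lemma cmeasM p q : cmeas p -> cmeas q -> cmeas (fun x => p x * q x).
Proof.
move=> [p1 p2] [q1 q2]; split.
  under eq_fun do rewrite ReM.
  by apply: measurable_funB; exact: measurable_funM.
under eq_fun do rewrite ImM.
by apply: measurable_funD; exact: measurable_funM.
Qed.

Lemma cmeas_cst (k : R[i]) : cmeas (fun=> k).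
Proof. by split; exact: measurable_cst. Qed.

Lemma cmeasB p q : cmeas p -> cmeas q -> cmeas (fun x => p x - q x).
Proof.
move=> mp mq; have -> : (fun x => p x - q x) = (fun x => p x + (-1) * q x).
  by apply/funext => x; rewrite mulN1r.
by apply: cmeasD => //; apply: cmeasM => //; exact: cmeas_cst.
Qed.

Lemma cmeas_conj p : cmeas p -> cmeas (fun x => (p x)^*).
Proof.
move=> [p1 p2]; split.
  by rewrite (_ : (fun _ => _) = (fun x => complex.Re (p x)))//; apply/funext => x; case: (p x).
rewrite (_ : (fun _ => _) = (fun x => - complex.Im (p x))).
  exact: measurable_funN.
by apply/funext => x; case: (p x).
Qed.

Lemma cmeas_nc2 p : cmeas p -> measurable_fun setT (fun x => nc (p x) ^+ 2).
Proof.
move=> [p1 p2]; under eq_fun do rewrite nc_sq.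
by apply: measurable_funD; exact: measurable_funX.
Qed.

Lemma sqint_integrable p M : sqint p M ->
  mu.-integrable setT (EFin \o (fun x => nc (p x) ^+ 2)) /\
  Rintegral mu setT (fun x => nc (p x) ^+ 2) <= M.
Proof.
move=> [mp pM].
have h : mu.-integrable setT (EFin \o (fun x => nc (p x) ^+ 2)).
  apply/integrableP; split; first by apply/measurable_EFinP; exact: cmeas_nc2.
  under eq_integral do rewrite /= ger0_norm ?exprn_ge0 ?nc_ge0//.
  exact: le_lt_trans pM (ltry _).
split=> //; rewrite -lee_fin /Rintegral fineK//.
exact: (integrable_fin_num measurableT h).
Qed.

Lemma sqintP p M : cmeas p ->
  mu.-integrable setT (EFin \o (fun x => nc (p x) ^+ 2)) ->
  Rintegral mu setT (fun x => nc (p x) ^+ 2) <= M -> sqint p M.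
Proof.
move=> mp h; rewrite -lee_fin /Rintegral fineK//.
exact: (integrable_fin_num measurableT h).
Qed.

Lemma cintegrable_le p (g : R -> R) : cmeas p -> mu.-integrable setT (EFin \o g) ->
  (forall x, nc (p x) <= g x) -> cintegrable setT p.
Proof.
move=> [p1 p2] ig pg; split.
  apply: le_integrable ig => //; first exact/measurable_EFinP.
  move=> x _ /=; rewrite lee_fin; apply: le_trans (nc_Re _) _.
  exact: le_trans (pg x) (ler_norm _).
apply: le_integrable ig => //; first exact/measurable_EFinP.
move=> x _ /=; rewrite lee_fin; apply: le_trans (nc_Im _) _.
exact: le_trans (pg x) (ler_norm _).
Qed.

(** Pointwise |p q| <= t |p|^2 / 2 + |q|^2 / (2 t), and the factor 2 of [cint_le] removes the
    halves. The weight t is left to the caller, which plays the role of Cauchy-Schwarz without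
    square roots. *)
Lemma sqint_mul p q M N : sqint p M -> sqint q N ->
  cintegrable setT (fun x => p x * q x) /\
  forall t, 0 < t -> nc (cint setT (fun x => p x * q x)) <= t * M + N / t.
Proof.
move=> sp sq; have [ip pM] := sqint_integrable sp; have [iq qN] := sqint_integrable sq.
have mT : measurable (setT : set (measurableTypeR R)) by exact: measurableT.
pose g t x := t / 2 * nc (p x) ^+ 2 + (2 * t)^-1 * nc (q x) ^+ 2.
have ig t : mu.-integrable setT (EFin \o g t).
  by apply: integrable_addR => //; apply: integrable_mulR.
have pqg t x : 0 < t -> nc (p x * q x) <= g t x.
  move=> t0; rewrite ncM /g -subr_ge0.
  have -> : t / 2 * nc (p x) ^+ 2 + (2 * t)^-1 * nc (q x) ^+ 2 - nc (p x) * nc (q x) =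
    (2 * t)^-1 * (t * nc (p x) - nc (q x)) ^+ 2 by field; rewrite gt_eqF.
  by rewrite mulr_ge0 ?sqr_ge0// invr_ge0 mulr_ge0// ltW.
have ipq : cintegrable setT (fun x => p x * q x).
  apply: (@cintegrable_le _ (g 1)) => //; first by apply: cmeasM; [case: sp|case: sq].
  by move=> x; exact: pqg.
split=> // t t0; apply: le_trans (cint_le (g := g t) _ _ _ _) _ => //.
  by move=> x _; exact: pqg.
rewrite RintegralD//; try exact: integrable_mulR.
rewrite !RintegralZl//.
have : (2 * t)^-1 * Rintegral mu setT (fun x => nc (q x) ^+ 2) <= (2 * t)^-1 * N.
  by rewrite ler_wpM2l// invr_ge0 mulr_ge0// ltW.
have : t / 2 * Rintegral mu setT (fun x => nc (p x) ^+ 2) <= t / 2 * M.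
  by rewrite ler_wpM2l// divr_ge0// ltW.
rewrite invfM; have -> : 2^-1 * t^-1 * N = (N / t) / 2 by ring.
lra.
Qed.

Lemma sqint_le p q M K : sqint p M -> cmeas q -> 0 <= K ->
  (forall x, nc (q x) <= K * nc (p x)) -> sqint q (K ^+ 2 * M).
Proof.
move=> sp mq K0 qp; have [ip pM] := sqint_integrable sp.
have mT : measurable (setT : set (measurableTypeR R)) by exact: measurableT.
have le2 x : nc (q x) ^+ 2 <= K ^+ 2 * nc (p x) ^+ 2.
  by rewrite -exprMn ler_pXn2r// nnegrE ?nc_ge0// mulr_ge0// nc_ge0.
have iK : mu.-integrable setT (EFin \o (fun x => K ^+ 2 * nc (p x) ^+ 2)).
  exact: integrable_mulR.
have iq : mu.-integrable setT (EFin \o (fun x => nc (q x) ^+ 2)).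
  apply: le_integrable iK => //; first by apply/measurable_EFinP; exact: cmeas_nc2.
  move=> x _ /=; rewrite lee_fin ger0_norm ?exprn_ge0 ?nc_ge0//.
  exact: le_trans (le2 x) (ler_norm _).
apply: sqintP => //; apply: le_trans (le_Rintegral _ iq iK _) _ => //.
by rewrite RintegralZl// ler_wpM2l// exprn_ge0.
Qed.

Lemma sqint_mulb p q M K : sqint p M -> cmeas q -> 0 <= K ->
  (forall x, nc (q x) <= K) -> sqint (fun x => p x * q x) (K ^+ 2 * M).
Proof.
move=> sp mq K0 qp; apply: sqint_le (sp) _ K0 _; first by apply: cmeasM => //; case: sp.
by move=> x; rewrite ncM mulrC ler_wpM2r ?nc_ge0.
Qed.

Lemma sqintD p q M N : sqint p M -> sqint q N ->
  sqint (fun x => p x + q x) (2 * (M + N)).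
Proof.
move=> sp sq; have [ip pM] := sqint_integrable sp; have [iq qN] := sqint_integrable sq.
have mT : measurable (setT : set (measurableTypeR R)) by exact: measurableT.
have mpq : cmeas (fun x => p x + q x) by apply: cmeasD; [case: sp|case: sq].
have le2 x : nc (p x + q x) ^+ 2 <= 2 * (nc (p x) ^+ 2 + nc (q x) ^+ 2).
  have := ncD (p x) (q x); have := nc_ge0 (p x + q x).
  have := nc_ge0 (p x); have := nc_ge0 (q x).
  have := sqr_ge0 (nc (p x) - nc (q x)); nra.
have i2 : mu.-integrable setT (EFin \o (fun x => 2 * (nc (p x) ^+ 2 + nc (q x) ^+ 2))).
  by apply: integrable_mulR => //; apply: integrable_addR.
have iq' : mu.-integrable setT (EFin \o (fun x => nc (p x + q x) ^+ 2)).
  apply: le_integrable i2 => //; first by apply/measurable_EFinP; exact: cmeas_nc2.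
  move=> x _ /=; rewrite lee_fin ger0_norm ?exprn_ge0 ?nc_ge0//.
  exact: le_trans (le2 x) (ler_norm _).
apply: sqintP => //; apply: le_trans (le_Rintegral _ iq' i2 _) _ => //.
rewrite RintegralZl//; last exact: integrable_addR.
by rewrite RintegralD// ler_wpM2l// lerD.
Qed.

Lemma sqint_conj p M : sqint p M -> sqint (fun x => (p x)^*) M.
Proof.
move=> [mp pM]; split; first exact: cmeas_conj.
by under eq_integral do rewrite nc_conj.
Qed.

Lemma sqint_ge0 p M : sqint p M -> 0 <= M.
Proof.
move=> [_ h]; rewrite -lee_fin; apply: le_trans h; apply: integral_ge0 => x _.
by rewrite lee_fin exprn_ge0// nc_ge0.
Qed.

Lemma sqint_weaken p M N : M <= N -> sqint p M -> sqint p N.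
Proof. by move=> MN [mp pM]; split=> //; apply: le_trans pM _; rewrite lee_fin. Qed.

Lemma integral_oneDsqrT : (\int[mu]_x ((oneDsqr x)^-1)%:E = (pi : R)%:E)%E.
Proof.
rewrite ge0_symfun_integralT; first last.
- by move=> x /=; rewrite /oneDsqr sqrrN.
- by move=> x; exact: continuous_oneDsqrV.
- by move=> x; rewrite invr_ge0 /oneDsqr addr_ge0// sqr_ge0.
rewrite -set_itvcy integral0y_oneDsqr -EFinM; congr (_%:E).
by field.
Qed.

(** The substitution u = (x - c) / d reduces this to the arctangent integral. *)
Lemma integral_poisson (c d : R) : 0 < d ->
  (\int[mu]_x (((x - c) ^+ 2 + d ^+ 2)^-1)%:E = (pi / d)%:E)%E.
Proof.
move=> d0; pose F x := (x - c) / d.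
have dF x : is_derive x 1 F d^-1.
  rewrite /F; apply: is_derive_eq; rewrite /GRing.scale /=.
  by ring.
have dFE : F^`() = (fun=> d^-1).
  by apply/funext => x; rewrite derive1E derive_val.
have d00 : d != 0 by rewrite gt_eqF.
have H : forall x, ((oneDsqr (F x))^-1 * d^-1) = d * ((x - c) ^+ 2 + d ^+ 2)^-1.
  move=> x; rewrite /oneDsqr /F.
  have -> : 1 + ((x - c) / d) ^+ 2 = ((x - c) ^+ 2 + d ^+ 2) / d ^+ 2.
    by field.
  by rewrite invf_div mulrAC; congr (_ / _); field.
have Fy : F x @[x --> +oo%R] --> +oo%R.
  apply/cvgryPge => A; near=> x; rewrite /F ler_pdivlMr// lerBrDr; near: x.
  by apply: nbhs_pinfty_ge; rewrite num_real.
have FNy : F x @[x --> -oo%R] --> -oo%R.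
  apply/cvgrNyPle => A; near=> x; rewrite /F ler_pdivrMr// lerBlDr; near: x.
  by apply: nbhs_ninfty_le; rewrite num_real.
have S : (pi%:E = \int[mu]_x (((((fun x : R => (oneDsqr x)^-1) \o F) * (derive1 F)) x)%R%:E))%E.
  rewrite -integral_oneDsqrT; apply: increasing_ge0_integration_by_substitutionT => //.
  - by move=> x y xy; rewrite /F ltr_pM2r ?invr_gt0// ltrD2r.
  - by rewrite dFE => x; exact: cvg_cst.
  - by rewrite dFE; exact: is_cvg_cst.
  - by rewrite dFE; exact: is_cvg_cst.
  - exact: continuous_oneDsqrV.
have mP : measurable_fun setT (fun x : R => (((x - c) ^+ 2 + d ^+ 2)^-1)%:E).
  apply/measurable_EFinP; apply: continuous_measurable_fun => x.
  apply: cvgV; first by rewrite gt_eqF// ltr_wpDl ?sqr_ge0// exprn_gt0.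
  apply: cvgD; last exact: cvg_cst.
  have cB : (y - c) @[y --> x] --> x - c by apply: cvgB; [exact: cvg_id|exact: cvg_cst].
  exact: (cvgM cB cB).
have PE : (fun x : R => ((((fun x : R => (oneDsqr x)^-1) \o F) * (derive1 F)) x)%R%:E) =
    (fun x : R => (d%:E * (((x - c) ^+ 2 + d ^+ 2)^-1)%:E)%E).
  by apply/funext => x; rewrite -EFinM -H dFE.
rewrite PE ge0_integralZl_EFin// ?(ltW d0)// in S; last first.
  by move=> x _; rewrite lee_fin invr_ge0 addr_ge0 ?sqr_ge0.
rewrite mulrC EFinM S muleA -EFinM mulVf// mul1e.
by [].
Unshelve. all: by end_near.
Qed.

(** Dominated convergence for the restrictions of f to [-n, n]. *)
Lemma Rint_lim (f : R -> R) : mu.-integrable setT (EFin \o f) -> forall e : R, 0 < e ->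
  exists n0 : nat, forall n, (n0 <= n)%N ->
    `|Rintegral mu `[- n%:R, n%:R] f - Rintegral mu setT f| < e.
Proof.
move=> fi e e0.
have mT : measurable (setT : set (measurableTypeR R)) by exact: measurableT.
have mf : measurable_fun setT f by apply/measurable_EFinP; exact: measurable_int fi.
pose f_ n x := ((f \_ `[- n%:R, n%:R]) x)%:E.
have [] := @dominated_convergence _ _ _ mu setT mT f_ (EFin \o f) (EFin \o (fun x => `|f x|)).
- move=> n; apply/measurable_EFinP; apply/measurable_restrict => //.
  by rewrite setTI; exact: measurable_funTS.
- exact/measurable_EFinP.
- apply: aeW => x _; apply: cvg_near_cst.
  exists (Num.bound `|x|) => // n /= xn.
  have h : x \in `[- n%:R, n%:R]%classic.
    rewrite inE /= in_itv /= -ler_norml; apply/ltW; apply: lt_le_trans (archi_boundP _) _ => //.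
    by rewrite ler_nat.
  by rewrite /f_ patchE h.
- exact: integrable_norm.
- apply: aeW => x n _ /=; rewrite /f_ patchE lee_fin; case: ifP => // _.
  by rewrite normr0.
move=> _ _.
have ff : (\int[mu]_x (f x)%:E)%E \is a fin_num := integrable_fin_num mT fi.
rewrite -(fineK ff) => /fine_cvg /cvgrPdist_lt /(_ e e0)[n0 _ h].
exists n0 => n n0n; have := h n n0n; rewrite /= distrC Rintegral_mkcond; exact.
Qed.

Lemma cint_lim p : cintegrable setT p -> forall e : R, 0 < e ->
  exists n0 : nat, forall n, (n0 <= n)%N ->
    nc (cint `[- n%:R, n%:R] p - cint setT p) < e.
Proof.
move=> [p1 p2] e e0; have e20 : 0 < e / 2 by rewrite divr_gt0.
have [n1 h1] := Rint_lim p1 e20; have [n2 h2] := Rint_lim p2 e20.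
exists (maxn n1 n2) => n; rewrite geq_max => /andP[/h1 g1 /h2 g2].
apply: le_lt_trans (nc_ReIm _) _; rewrite ReD ImD ReN ImN /= (splitr e).
exact: ltrD.
Qed.

Lemma nc_line x y (l : R[i]) : nc (x +i* y - l) ^+ 2 =
  (x - complex.Re l) ^+ 2 + (y - complex.Im l) ^+ 2.
Proof. by rewrite nc_sq ReD ImD ReN ImN. Qed.

Lemma line_neq x y (l : R[i]) : y != complex.Im l -> x +i* y - l != 0.
Proof. by apply: contra; rewrite subr_eq0 => /eqP <-. Qed.

Lemma cmeas_kernel y (l : R[i]) : y != complex.Im l ->
  cmeas (fun x => (x +i* y - l)^-1).
Proof.
move=> yl; apply: cmeas_cont; apply: (@pcont_horT _ (fun z => (z - l)^-1)) => x.
by apply: ccontV; [apply: ccontB; [exact: ccont_id|exact: ccont_cst]|exact: line_neq].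
Qed.

Lemma sqint_kernel y (l : R[i]) : y != complex.Im l ->
  sqint (fun x => (x +i* y - l)^-1) (pi / `|y - complex.Im l|).
Proof.
move=> yl; split; first exact: cmeas_kernel.
rewrite -(@integral_poisson (complex.Re l)); last by rewrite normr_gt0 subr_eq0.
rewrite le_eqVlt; apply/orP; left; apply/eqP; apply: eq_integral => x _.
by rewrite ncV exprVn nc_line real_normK// num_real.
Qed.

End SquareIntegrable.

(** * Vanishing of the vertical sides of a rectangle of growing width *)

Section VerticalSides.
Variable R : realType.
Local Notation mu := (@lebesgue_measure R).
Implicit Types (a b c d x y t s : R).

Lemma pcont_bounded a b (p : R -> R[i]) : pcont `[a, b] p ->
  exists2 K : R, 0 <= K & forall x, a <= x <= b -> nc (p x) <= K.
Proof.
move=> cp.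
have cpt : compact (`[a, b]%classic : set R) by exact: segment_compact.
have /compact_bounded[M1 [_ h1]] := continuous_compact (pcont_ReE cp) cpt.
have /compact_bounded[M2 [_ h2]] := continuous_compact (pcont_ImE cp) cpt.
exists ((`|M1| + 1) + (`|M2| + 1)).
  by rewrite !addr_ge0.
move=> x xab; apply: le_trans (nc_ReIm _) _.
have xI : `[a, b]%classic x by rewrite /= in_itv.
apply: lerD.
  by apply: (h1 (`|M1| + 1)); [rewrite (le_lt_trans (ler_norm _))// ltrDl|exists x].
by apply: (h2 (`|M2| + 1)); [rewrite (le_lt_trans (ler_norm _))// ltrDl|exists x].
Qed.

Lemma slopes_pcont a b (G g : R -> R[i]) : slopes a b G g -> pcont `[a, b] G.
Proof.
move=> sG x; rewrite /= in_itv /= => xab e e0.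
have [d d0 hd] := sG x xab _ ltr01.
have K0 : 0 < 2 + nc (g x) by rewrite ltr_wpDr// nc_ge0.
exists (Num.min d (e / (2 + nc (g x)))); first by rewrite lt_min d0 divr_gt0.
move=> t; rewrite /= in_itv /= => tab; rewrite lt_min ltr_pdivlMr// => /andP[/(hd t tab) h1 h2].
apply: le_lt_trans h2.
have -> : G t - G x = (G t - G x - (t - x)%:C * g x) + (t - x)%:C * g x by ring.
apply: le_trans (ncD _ _) _; rewrite ncM nc_real.
have := normr_ge0 (t - x); have := nc_ge0 (g x); nra.
Qed.

(** Weighted Cauchy-Schwarz between p and the constant 1. A large B gives the length of the interval
    a small coefficient. *)
Lemma sqint_itv a b (p : R -> R[i]) (M B : R) : a <= b -> sqint p M -> pcont `[a, b] p -> 0 < B ->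
  nc (cint `[a, b] p) <= B * M + (b - a) / B.
Proof.
move=> ab sp cp B0; have [ip pM] := sqint_integrable sp.
have mT : measurable (setT : set (measurableTypeR R)) by exact: measurableT.
have mI : measurable (`[a, b]%classic : set (measurableTypeR R)) by exact: measurable_itv.
pose g x := B / 2 * nc (p x) ^+ 2 + (2 * B)^-1.
have ip' : mu.-integrable `[a, b] (EFin \o (fun x => nc (p x) ^+ 2)).
  exact: integrableS ip.
have ig1 : mu.-integrable `[a, b] (EFin \o (fun x => B / 2 * nc (p x) ^+ 2)).
  exact: integrable_mulR.
apply: le_trans (cint_le (g := g) _ _ _ _) _ => //.
- exact: pcont_integrable.
- by apply: integrable_addR => //; exact: integrable_itv_cst.
- move=> x _; rewrite /g -subr_ge0.
  have -> : B / 2 * nc (p x) ^+ 2 + (2 * B)^-1 - nc (p x) =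
    (2 * B)^-1 * (B * nc (p x) - 1) ^+ 2 by field; rewrite gt_eqF.
  by rewrite mulr_ge0 ?sqr_ge0// invr_ge0 mulr_ge0// ltW.
rewrite RintegralD//; last exact: integrable_itv_cst.
rewrite RintegralZl// Rintegral_cst//= mu_itv//.
have : Rintegral mu `[a, b] (fun x => nc (p x) ^+ 2) <= M.
  apply: le_trans pM; rewrite /Rintegral fine_le//.
  - exact: (integrable_fin_num mI ip').
  - exact: (integrable_fin_num mT ip).
  apply: ge0_subset_integral => //.
  - by apply/measurable_EFinP; apply: cmeas_nc2; case: sp.
  - by move=> x _; rewrite lee_fin exprn_ge0// nc_ge0.
rewrite -(ler_pM2l B0) => h.
have -> : 2 * (B / 2 * Rintegral mu `[a, b] (fun x => nc (p x) ^+ 2) + (2 * B)^-1 * (b - a)) =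
  B * Rintegral mu `[a, b] (fun x => nc (p x) ^+ 2) + (b - a) / B by field; rewrite gt_eqF.
by rewrite lerD2r.
Qed.

Lemma cint_point c (p : R -> R[i]) : cint `[c, c] p = 0.
Proof. by rewrite /cint set_itv1 !Rintegral_set1. Qed.

(** Second-order remainder of the inverse. It is stated over an abstract field with I a letter,
    because [I * I = -1] has to be used by hand exactly once. *)
Lemma inv_slope (F : fieldType) (u v D I : F) : u != 0 -> v != 0 ->
  u - v = I * D -> I * I = -1 ->
  u^-1 - v^-1 - D * (- I * v^-1 ^+ 2) = D ^+ 2 * (-1) * (v^-1 ^+ 2 * u^-1).
Proof.
move=> u0 v0 uv II.
have -> : u^-1 - v^-1 - D * (- I * v^-1 ^+ 2) =
    I * D * (u * v ^+ 2)^-1 * v - I * D * (u * v ^+ 2)^-1 * v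
    + (- (u - v) * v + I * D * u) / (u * v ^+ 2) by field; rewrite u0 v0.
rewrite subrr add0r uv; have -> : u = v + I * D by rewrite -uv addrC subrK.
have -> : - (I * D) * v + I * D * (v + I * D) = (I * I) * D ^+ 2 by ring.
by rewrite II mulN1r mulrN1 mulNr [v^-1 ^+ 2 * _]mulrC exprVn -invfM mulNr.
Qed.

Lemma pcontD_itv a b (p1 p2 : R -> R[i]) : pcont `[a, b] p1 -> pcont `[a, b] p2 ->
  pcont `[a, b] (fun s => p1 s + p2 s).
Proof.
move=> c1 c2 x xI e e0; have e20 : 0 < e / 2 by rewrite divr_gt0.
have [d1 d10 g1] := c1 x xI _ e20; have [d2 d20 g2] := c2 x xI _ e20.
exists (Num.min d1 d2); first by rewrite lt_min d10.
move=> s sI; rewrite lt_min => /andP[/(g1 s sI) k1 /(g2 s sI) k2].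
have -> : p1 s + p2 s - (p1 x + p2 x) = (p1 s - p1 x) + (p2 s - p2 x) by ring.
by apply: le_lt_trans (ncD _ _) _; rewrite (splitr e) ltrD.
Qed.

Lemma pcontM_itv a b (p1 p2 : R -> R[i]) : pcont `[a, b] p1 -> pcont `[a, b] p2 ->
  pcont `[a, b] (fun s => p1 s * p2 s).
Proof.
move=> c1 c2 x xI e e0; have [K1 K10 h1] := pcont_bounded c1; have [K2 K20 h2] := pcont_bounded c2.
have S0 : 0 < 2 * (K1 + K2 + 1) by rewrite mulr_gt0// ltr_wpDl// addr_ge0.
have e20 : 0 < e / (2 * (K1 + K2 + 1)) by rewrite divr_gt0.
have [d1 d10 g1] := c1 x xI _ e20; have [d2 d20 g2] := c2 x xI _ e20.
exists (Num.min d1 d2); first by rewrite lt_min d10.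
move=> s sI; rewrite lt_min => /andP[/(g1 s sI) k1 /(g2 s sI) k2].
have -> : p1 s * p2 s - p1 x * p2 x = (p1 s - p1 x) * p2 s + p1 x * (p2 s - p2 x) by ring.
apply: le_lt_trans (ncD _ _) _; rewrite !ncM.
have m1 : nc (p1 s - p1 x) * nc (p2 s) <= e / (2 * (K1 + K2 + 1)) * K2.
  by apply: ler_pM; rewrite ?nc_ge0// ?(ltW k1)//; apply: h2; move: sI; rewrite /= in_itv.
have m2 : nc (p1 x) * nc (p2 s - p2 x) <= K1 * (e / (2 * (K1 + K2 + 1))).
  by apply: ler_pM; rewrite ?nc_ge0// ?(ltW k2)//; apply: h1; move: xI; rewrite /= in_itv.
apply: le_lt_trans (lerD m1 m2) _.
have -> : e / (2 * (K1 + K2 + 1)) * K2 + K1 * (e / (2 * (K1 + K2 + 1))) =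
  (e * (K1 + K2)) / (2 * (K1 + K2 + 1)) by ring.
by rewrite ltr_pdivrMr// ltr_pM2l//; lra.
Qed.

Lemma pcont_cst D (z : R[i]) : pcont D (fun=> z).
Proof. by move=> x _ e e0; exists 1 => // s _ _; rewrite subrr nc0. Qed.

Section fixed.
Variables (f : R[i] -> R[i]) (M c d : R) (l : R[i]).
Hypotheses (cd : c < d).
Hypothesis df : forall z, c <= complex.Im z -> cdiff f z.
Hypothesis f2 : forall y, c <= y -> sqint (fun x => f (x +i* y)) M.

Let q t s := cint `[c, s] (fun y => f (t +i* y)).

Let cv t : pcont `[c, d] (fun y => f (t +i* y)).
Proof. by apply: pcont_ver => y /andP[cy _]; apply/cdiff_cont/df. Qed.

Let ch a b y : c <= y -> pcont `[a, b] (fun x => f (x +i* y)).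
Proof. by move=> cy; apply: pcont_hor => x _; apply/cdiff_cont/df. Qed.

(* Goursat's theorem moves the vertical segment to the imaginary axis; the
   horizontal segments are controlled by the mean square bound. *)
Lemma vertical_primitive_bound (B : R) : 0 < B ->
  exists2 C0 : R, 0 <= C0 & forall t s, c <= s <= d ->
    nc (q t s) <= C0 + 2 * (B * M + `|t| / B).
Proof.
move=> B0; have [K K0 hK] := pcont_bounded (cv 0).
exists (2 * K * (d - c)); first by rewrite !mulr_ge0// subr_ge0 ltW.
move=> t s /andP[cs sd].
have q0 : nc (q 0 s) <= 2 * K * (d - c).
  apply: (@le_trans _ _ (2 * K * (s - c))); last first.
    by rewrite ler_wpM2l ?mulr_ge0// lerD2r.
  apply: cint_le_itv => //.
    by apply: pcont_sub (cv 0) => y /=; rewrite !in_itv /= => /andP[-> /le_trans]; apply.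
  by move=> y /andP[h1 h2]; apply: hK; rewrite h1 (le_trans h2).
have hor a b y : a <= b -> c <= y -> nc (cint `[a, b] (fun x => f (x +i* y))) <= B * M + (b - a) / B.
  by move=> ab cy; apply: sqint_itv => //; [exact: f2|exact: ch].
have key a b : a <= b ->
    nc (q b s - q a s) <= 2 * (B * M + (b - a) / B).
  move=> ab; have : rect f a b c s = 0.
    by apply: goursat => // z /andP[_ /andP[h _]]; exact: df.
  rewrite /rect -/(q b s) -/(q a s) => /eqP; rewrite addrC addr_eq0 => /eqP E.
  have -> : nc (q b s - q a s) = nc ('i * (q b s - q a s)).
    by rewrite ncM nc_imag normr1 mul1r.
  rewrite E ncN mulr_natl mulr2n; apply: le_trans (ncB _ _) _.
  by apply: lerD; apply: hor.
have -> : q t s = q 0 s + (q t s - q 0 s) by ring.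
apply: le_trans (ncD _ _) _; apply: lerD => //.
have [t0|t0] := leP 0 t.
  by rewrite ger0_norm//; have := key _ _ t0; rewrite subr0.
by rewrite nc_dist ltr0_norm//; have := key _ _ (ltW t0); rewrite sub0r.
Qed.

Let k t s := (t +i* s - l)^-1.

Let nck t s : t != complex.Re l -> nc (k t s) <= `|t - complex.Re l|^-1.
Proof.
move=> tl; rewrite /k ncV lef_pV2 ?posrE ?normr_gt0 ?subr_eq0//; last first.
  rewrite nc_gt0; apply: contra tl; rewrite subr_eq0 => /eqP E.
  by rewrite -E.
by apply: le_trans (nc_Re _); rewrite ReD ReN.
Qed.

Let tsl t s : t != complex.Re l -> t +i* s - l != 0.
Proof. by apply: contra; rewrite subr_eq0 => /eqP <-. Qed.

Lemma slopes_kernel t : t != complex.Re l -> slopes c d (k t) (fun s => - 'i * (k t s) ^+ 2).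
Proof.
move=> tl x xcd e e0; set K := `|t - complex.Re l|^-1.
have K0 : 0 <= K by rewrite invr_ge0.
exists (e / (K ^+ 3 + 1)); first by rewrite divr_gt0// ltr_wpDl// exprn_ge0.
move=> s scd; rewrite ltr_pdivlMr ?ltr_wpDl ?exprn_ge0// => h.
have -> : k t s - k t x - (s - x)%:C * (- 'i * k t x ^+ 2) =
    (s - x)%:C ^+ 2 * (- 1) * (k t x ^+ 2 * k t s).
  apply: inv_slope; rewrite ?tsl//.
    by apply: eqC; rewrite !(ReM, ImM, ReD, ImD, ReN, ImN) /=; ring.
  by apply: eqC; rewrite !(ReM, ImM, ReN, ImN) /=; ring.
rewrite ncM [nc (_ * -1)]ncM ncX ncN nc1 mulr1 [nc (_ * k t s)]ncM ncX nc_real.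
apply: (@le_trans _ _ (`|s - x| ^+ 2 * K ^+ 3)).
  rewrite ler_wpM2l ?exprn_ge0// [K ^+ 3]exprSr ler_pM ?exprn_ge0 ?nc_ge0//; last exact: nck.
  by rewrite ler_pXn2r ?nnegrE ?nc_ge0//; exact: nck.
have -> : `|s - x| ^+ 2 * K ^+ 3 = (`|s - x| * K ^+ 3) * `|s - x| by ring.
rewrite ler_wpM2r//; apply: le_trans (ltW h).
by rewrite ler_wpM2l// lerDl.
Qed.

(** The derivative is moved from the primitive [q] of f, which may grow linearly in t, to the
    kernel, whose derivative decays like t^-2. *)
Lemma vertical_by_parts t : t != complex.Re l ->
  cint `[c, d] (fun s => f (t +i* s) * k t s) =
  q t d * k t d + cint `[c, d] (fun s => q t s * ('i * k t s ^+ 2)).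
Proof.
move=> tl.
have sq := slopes_cint (cv t); have sk := slopes_kernel tl.
have cq := slopes_pcont sq; have ck := slopes_pcont sk.
have ck2 : pcont `[c, d] (fun s => k t s ^+ 2) by exact: (pcontM_itv ck ck).
have ckk : pcont `[c, d] (fun s => - 'i * k t s ^+ 2) by exact: (pcontM_itv (@pcont_cst _ _) ck2).
have ikk : pcont `[c, d] (fun s => 'i * k t s ^+ 2) by exact: (pcontM_itv (@pcont_cst _ _) ck2).
have cfk := pcontM_itv (cv t) ck.
have cqk := pcontM_itv cq ckk.
have [K1 K10 h1] := pcont_bounded cq; have [K2 K20 h2] := pcont_bounded (cv t).
have [K3 K30 h3] := pcont_bounded ck; have [K4 K40 h4] := pcont_bounded ckk.
have bd x : c <= x <= d -> nc (q t x) <= K1 + K2 + K3 + K4 /\ nc (f (t +i* x)) <= K1 + K2 + K3 + K4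
    /\ nc (k t x) <= K1 + K2 + K3 + K4 /\ nc (- 'i * k t x ^+ 2) <= K1 + K2 + K3 + K4.
  move=> xcd; split; [|split; [|split]].
  - by apply: le_trans (h1 x xcd) _; rewrite -!addrA lerDl !addr_ge0.
  - by apply: le_trans (h2 x xcd) _; rewrite -!addrA addrCA lerDl !addr_ge0.
  - by apply: le_trans (h3 x xcd) _; rewrite addrAC lerDr !addr_ge0.
  - by apply: le_trans (h4 x xcd) _; rewrite lerDr !addr_ge0.
have := cint_ftc cd (pcontD_itv cfk cqk) (slopes_mul sq sk bd).
rewrite cint_point mul0r subr0 cintD//; try exact: pcont_integrable.
have -> : cint `[c, d] (fun s => cint `[c, s] (fun y => f (t +i* y)) * (- 'i * k t s ^+ 2)) =
    - cint `[c, d] (fun s => q t s * ('i * k t s ^+ 2)).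
  rewrite (@eq_cint _ _ _ (fun s => (-1) * (q t s * ('i * k t s ^+ 2)))); last first.
    by move=> s _; rewrite /q; ring.
  by rewrite cintZ ?mulN1r//; exact: (pcont_integrable (pcontM_itv cq ikk)).
by move=> /eqP; rewrite subr_eq => /eqP.
Qed.

(** A mean square bound on horizontal lines gives no pointwise decay of f along a vertical segment.
    Its primitive, however, is at most a constant plus 2 |t| / B; after integration by parts every
    term carries a factor 2 / |t|, leaving O (1 / |t|) and O (1 / B). *)
Lemma vertical_small (e : R) : 0 < e -> exists2 T : R, 0 < T & forall t, T <= `|t| ->
  nc (cint `[c, d] (fun s => f (t +i* s) * (t +i* s - l)^-1)) <= e.
Proof.
move=> e0; have M0 : 0 <= M := sqint_ge0 (f2 (lexx c)).
pose w : R := 1 + 2 * (d - c); have w0 : 0 < w by rewrite addr_gt0// mulr_gt0// subr_gt0.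
(* Makes the part that does not decay in t, namely 4 w / B, equal to e / 2. *)
pose B : R := 8 * w / e; have B0 : 0 < B by rewrite divr_gt0// mulr_gt0.
have [C0 C00 hC] := vertical_primitive_bound B0.
pose D := C0 + 2 * (B * M); have D0 : 0 <= D.
  by rewrite addr_ge0// mulr_ge0// mulr_ge0// ltW.
have wDe : 0 <= 4 * w * D / e.
  by rewrite mulr_ge0 ?invr_ge0 ?(ltW e0)// mulr_ge0// mulr_ge0 ?(ltW w0).
(* The summands ensure |t| >= 2, |t - Re l| >= |t| / 2 and 2 w D / |t| <= e / 2. *)
exists (2 + 2 * `|complex.Re l| + 4 * w * D / e).
  by rewrite -addrA ltr_pwDl// addr_ge0// mulr_ge0.
move=> t tT.
have l0 := normr_ge0 (complex.Re l).
have t2 : 2 <= `|t| by lra.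
have t0 : 0 < `|t| by lra.
have tl : t != complex.Re l.
  by apply/eqP => E; move: tT; rewrite E; lra.
have kl : `|t - complex.Re l|^-1 <= 2 / `|t|.
  rewrite -[2 / _]invrK lef_pV2 ?posrE ?invr_gt0 ?divr_gt0// ?normr_gt0 ?subr_eq0// invf_div.
  by have := lerB_dist t (complex.Re l); lra.
rewrite -/(k t _) vertical_by_parts//.
set Q := C0 + 2 * (B * M + `|t| / B); set kk := 2 / `|t|.
have Q0 : 0 <= Q.
  have B0' := ltW B0.
  apply: addr_ge0 => //; apply: mulr_ge0 => //.
  by apply: addr_ge0; [exact: mulr_ge0|exact: divr_ge0].
have kk0 : 0 <= kk by rewrite divr_ge0.
have kk1 : kk <= 1 by rewrite ler_pdivrMr ?mul1r.
have dd : c <= d <= d by rewrite lexx ltW.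
have h1 : nc (q t d * k t d) <= Q * kk.
  by rewrite ncM ler_pM ?nc_ge0//; [exact: hC|exact: le_trans (nck _ tl) kl].
have sk := slopes_pcont (slopes_kernel tl).
have h2 : nc (cint `[c, d] (fun s => q t s * ('i * k t s ^+ 2))) <= 2 * (Q * kk) * (d - c).
  apply: cint_le_itv (ltW cd) _ _.
    apply: pcontM_itv (slopes_pcont (slopes_cint (cv t))) _.
    exact: (pcontM_itv (@pcont_cst _ _) (pcontM_itv sk sk)).
  move=> s scd; rewrite ncM ler_pM ?nc_ge0//; first exact: hC.
  rewrite ncM nc_imag normr1 mul1r ncX expr2.
  apply: (@le_trans _ _ (kk * 1)); last by rewrite mulr1.
  have h := le_trans (nck s tl) kl.
  by rewrite ler_pM ?nc_ge0//; exact: le_trans h kk1.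
apply: le_trans (ncD _ _) _; apply: le_trans (lerD h1 h2) _.
have -> : Q * kk + 2 * (Q * kk) * (d - c) = 2 * w * D / `|t| + 4 * w / B.
  by rewrite /Q /kk /w /D; field; rewrite !gt_eqF.
have -> : 4 * w / B = e / 2 by rewrite /B; field; rewrite !gt_eqF.
have : 2 * w * D / `|t| <= e / 2.
  rewrite ler_pdivrMr//.
  have : 4 * w * D / e <= `|t| by lra.
  by rewrite ler_pdivrMr//; lra.
lra.
Qed.

End fixed.
End VerticalSides.

(** * Cauchy's formula on a horizontal line *)

Section CauchyLine.
Variable R : realType.
Local Notation mu := (@lebesgue_measure R).
Implicit Types (f : R[i] -> R[i]) (M y Y : R) (l : R[i]).

Definition hardy_above f y M := (forall z, y <= complex.Im z -> cdiff f z) /\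
  (forall y', y <= y' -> sqint (fun x => f (x +i* y')) M).

Lemma nc_small (z : R[i]) : (forall e : R, 0 < e -> nc z <= e) -> z = 0.
Proof.
move=> h; apply/eqP; rewrite -nc_eq0; apply/eqP/le_anti; rewrite nc_ge0 andbT.
by apply/ler_addgt0Pl => e /h; rewrite addr0.
Qed.

Lemma cintegrable_line f y M l : hardy_above f y M -> y != complex.Im l ->
  cintegrable setT (fun x => f (x +i* y) * (x +i* y - l)^-1).
Proof. by move=> [_ f2] yl; have [] := sqint_mul (f2 y (lexx _)) (sqint_kernel yl). Qed.

Lemma hardy_above_le f y y' M : y <= y' -> hardy_above f y M -> hardy_above f y' M.
Proof.
move=> yy' [df f2]; split=> [z zy|y'' h]; first by apply: df; exact: le_trans zy.
by apply: f2; exact: le_trans h.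
Qed.

Lemma rect_lim f y Y M l : hardy_above f y M -> y < complex.Im l < Y ->
  forall e : R, 0 < e -> exists n0 : nat, forall n, (n0 <= n)%N ->
  nc (rect (fun z => f z * (z - l)^-1) (- n%:R) n%:R y Y -
     (cint setT (fun x => f (x +i* y) * (x +i* y - l)^-1) -
      cint setT (fun x => f (x +i* Y) * (x +i* Y - l)^-1))) <= e.
Proof.
move=> hf /andP[yl lY] e e0; have e40 : 0 < e / 4 by rewrite divr_gt0.
have yY : y < Y by exact: lt_trans lY.
have i1 := cintegrable_line hf (negbT (lt_eqF yl)).
have hfY := hardy_above_le (ltW yY) hf.
have i2 : cintegrable setT (fun x => f (x +i* Y) * (x +i* Y - l)^-1).
  by apply: cintegrable_line hfY _; rewrite gt_eqF.
have [n1 h1] := cint_lim i1 e40; have [n2 h2] := cint_lim i2 e40.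
case: hf => df f2.
have [T T0 h3] := vertical_small l yY df f2 e40.
exists (maxn (maxn n1 n2) (Num.bound T)) => n; rewrite !geq_max => /andP[/andP[/h1 g1 /h2 g2] nT].
have Tn : T <= n%:R.
  by apply/ltW; apply: lt_le_trans (archi_boundP (ltW T0)) _; rewrite ler_nat.
rewrite /rect.
have g3 := h3 n%:R; have g4 := h3 (- n%:R).
rewrite normrN ger0_norm// in g3 g4; move: (g3 Tn) (g4 Tn) g1 g2 => {}g3 {}g4.
set a1 := cint _ _ in g3 *; set a2 := cint _ _ in g4 *.
set a3 := cint _ _; set a4 := cint _ _ => g1.
set a5 := cint _ _; set a6 := cint _ _ => g2.
have -> : a3 - a5 + 'i * (a1 - a2) - (a4 - a6) = (a3 - a4) - (a5 - a6) + 'i * (a1 - a2) by ring.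
apply: le_trans (ncD _ _) _; rewrite ncM nc_imag normr1 mul1r.
have := ncB (a3 - a4) (a5 - a6); have := ncB a1 a2.
clearbody a1 a2 a3 a4 a5 a6; clear -g1 g2 g3 g4; lra.
Qed.

(** On the line at height Y' the square norm of the kernel is pi / (Y' - Im l), while that of f
    stays bounded. *)
Lemma line_small f y M l : hardy_above f y M -> y < complex.Im l ->
  forall e : R, 0 < e -> exists2 Y, complex.Im l < Y & forall Y', Y <= Y' ->
  nc (cint setT (fun x => f (x +i* Y') * (x +i* Y' - l)^-1)) <= e.
Proof.
move=> hf yl e e0; have M0 : 0 <= M := sqint_ge0 (hf.2 y (lexx _)).
have M10 : 0 < M + 1 by rewrite ltr_wpDl.
pose t := e / (2 * (M + 1)); have t0 : 0 < t by rewrite divr_gt0// mulr_gt0.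
have p0 : 0 < pi :> R := pi_gt0 R.
have te0 := mulr_gt0 t0 e0.
have d0 : 0 < 2 * pi / (t * e) by apply: divr_gt0 => //; exact: mulr_gt0.
exists (complex.Im l + 2 * pi / (t * e)); first by rewrite ltrDl.
move=> Y hY.
have lY : complex.Im l < Y by lra.
have [_ /(_ t t0)] := sqint_mul ((hardy_above_le (ltW (lt_trans yl lY)) hf).2 Y (lexx _))
  (sqint_kernel (negbT (gt_eqF lY))).
move/le_trans; apply.
have h1 : t * M <= e / 2.
  apply: (@le_trans _ _ (t * (M + 1))); first by rewrite ler_wpM2l ?(ltW t0)// lerDl.
  by rewrite /t le_eqVlt; apply/orP; left; apply/eqP; field; rewrite gt_eqF.
have h2 : pi / `|Y - complex.Im l| / t <= e / 2.
  rewrite ger0_norm ?subr_ge0 ?(ltW lY)// -mulrA -invfM.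
  rewrite ler_pdivrMr; last by rewrite mulr_gt0// subr_gt0.
  have : 2 * pi / (t * e) <= Y - complex.Im l by lra.
  by rewrite ler_pdivrMr//; lra.
lra.
Qed.

Lemma cint_real (r : R -> R) : cint setT (fun x => (r x)%:C) = (Rintegral mu setT r)%:C.
Proof.
have mT : measurable (setT : set (measurableTypeR R)) by exact: measurableT.
by rewrite /cint /= Rintegral_cst// mul0r.
Qed.

(** By [cauchy_rect] f may be replaced by [g] on every rectangle around l; both sides converge to
    line integrals, since the vertical sides and the top vanish in the limit. For [g] the line
    integral is a Poisson integral. *)
Lemma cauchy_line f y M l : hardy_above f y M -> y < complex.Im l ->
  cint setT (fun x => f (x +i* y) * (x +i* y - l)^-1) = (2 * pi)%:C * 'i * f l.
Proof.
move=> hf yl; have mT : measurable (setT : set (measurableTypeR R)) by exact: measurableT.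
pose d := complex.Im l - y; have d0 : 0 < d by rewrite subr_gt0.
(* The reflection of [l] in the line: on that line (z - m) (z - l) is real. *)
pose m := complex.Re l +i* (y - d).
pose g z := f l * (l - m) * (z - m)^-1.
have hg : exists N, hardy_above g y N.
  exists ((nc (f l * (l - m))) ^+ 2 * (pi / d)); split=> [z zy|y' yy'].
    apply: cdiffM; first exact: cdiff_cst.
    apply: cdiffV; first by apply: cdiffB; [exact: cdiff_id|exact: cdiff_cst].
    rewrite subr_eq0; apply/eqP => E; move: zy; rewrite E /= leNgt => /negP; apply.
    by rewrite gtrDl oppr_lt0.
  have yd : y' != complex.Im m by rewrite gt_eqF//= (lt_le_trans _ yy')// gtrDl oppr_lt0.
  apply: sqint_le (nc_ge0 _) _.
  - apply: sqint_weaken (sqint_kernel yd).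
    rewrite /= ler_wpM2l ?pi_ge0// lef_pV2 ?posrE ?normr_gt0 ?subr_eq0//.
    by apply: le_trans (ler_norm _); rewrite opprB; lra.
  - by apply: cmeasM (cmeas_cst _) _; exact: cmeas_kernel.
  - by move=> x; rewrite /g ncM.
have {hg}[N hg] := hg.
have key : cint setT (fun x => f (x +i* y) * (x +i* y - l)^-1) =
    cint setT (fun x => g (x +i* y) * (x +i* y - l)^-1).
  apply/eqP; rewrite -subr_eq0; apply/eqP/nc_small => e e0.
  have e40 : 0 < e / 4 by rewrite divr_gt0.
  have [Y1 lY1 h1] := line_small hf yl e40; have [Y2 lY2 h2] := line_small hg yl e40.
  pose Y := Num.max Y1 Y2.
  have k1 := h1 Y; have k2 := h2 Y; rewrite !le_max !lexx ?orbT in k1 k2.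
  have lY : y < complex.Im l < Y by rewrite yl lt_max lY1.
  have [n1 g1] := rect_lim hf lY e40; have [n2 g2] := rect_lim hg lY e40.
  pose n := maxn (maxn n1 n2) (Num.bound (`|complex.Re l|)).
  have {}g1 := g1 n; have {}g2 := g2 n.
  rewrite /n !leq_max !leqnn ?orbT -/n in g1 g2.
  have ln : `|complex.Re l| < n%:R.
    by apply: lt_le_trans (archi_boundP _) _ => //; rewrite ler_nat leq_max leqnn orbT.
  have E : rect (fun z => f z * (z - l)^-1) (- n%:R) n%:R y Y =
      rect (fun z => g z * (z - l)^-1) (- n%:R) n%:R y Y.
    rewrite (@cauchy_rect _ _ _ _ _ _ _ m)//.
    - have -> // : (fun z => f l * (l - m) * ((z - m)^-1 * (z - l)^-1)) =
        (fun z => g z * (z - l)^-1) by apply/funext => z; rewrite /g -!mulrA.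
    - by rewrite -ltr_norml.
    - by move=> z /andP[_ /andP[h _]]; apply: hf.1.
    - by rewrite /= gtrDl oppr_lt0.
  move: (k1 isT) (k2 isT) (g1 isT) (g2 isT); rewrite E.
  set a1 := cint _ _; set a2 := cint _ _; set r := rect _ _ _ _ _.
  set a3 := cint _ _; set a4 := cint _ _ => q1 q2 q3 q4.
  have -> : a3 - a4 = (r - (a4 - a2)) - (r - (a3 - a1)) + (a1 - a2) by ring.
  apply: le_trans (ncD _ _) _.
  have := ncB (r - (a4 - a2)) (r - (a3 - a1)); have := ncB a1 a2.
  clearbody a1 a2 a3 a4 r; clear -q1 q2 q3 q4; lra.
rewrite key (@eq_cint _ _ _ (fun x =>
  f l * (l - m) * (((x - complex.Re l) ^+ 2 + d ^+ 2)^-1)%:C)); last first.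
  move=> x _; rewrite /g -mulrA -invfM; congr (_ * _).
  rewrite rmorphV ?unitfE; last by rewrite gt_eqF// ltr_wpDl ?sqr_ge0// exprn_gt0.
  congr (_^-1); apply: eqC; rewrite !(ReM, ImM, ReD, ImD, ReN, ImN) /= /d; ring.
rewrite cintZ//; last first.
  split => /=; last exact: integrable0.
  have [h _] := sqint_integrable (sqint_kernel (negbT (lt_eqF yl))).
  apply: integrable_eq h => // x _.
  by rewrite ncV exprVn nc_line /d -[y - _]opprB sqrrN.
rewrite cint_real /Rintegral integral_poisson//=.
have -> : l - m = (2 * d)%:C * 'i.
  by rewrite /m /d; case: (l) => p q; apply: eqC; rewrite !(ReM, ImM, ReD, ImD, ReN, ImN) /=; ring.
have -> : (pi / d)%:C = pi%:C / d%:C :> R[i] by rewrite rmorphM fmorphV.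
have -> : (2 * d)%:C = 2 * d%:C :> R[i] by rewrite rmorphM /= rmorph_nat.
have -> : (2 * pi)%:C = 2 * pi%:C :> R[i] by rewrite rmorphM /= rmorph_nat.
have d0C : d%:C != 0 :> R[i] by apply/eqP => -[] /eqP; rewrite gt_eqF.
by field.
Qed.

End CauchyLine.

(** * The complex exponential and its derivative *)

Section ComplexExponential.
Variable R : realType.
Implicit Types (x y t : R) (z w h : R[i]).

Definition cexp z : R[i] :=
  (expR (complex.Re z))%:C * (cos (complex.Im z) +i* sin (complex.Im z)).

Lemma cexpD z w : cexp (z + w) = cexp z * cexp w.
Proof.
rewrite /cexp ReD ImD expRD cosD sinD.
by apply: eqC; rewrite !(ReM, ImM) /=; ring.
Qed.

Lemma cexp0 : cexp 0 = 1.
Proof. by rewrite /cexp /= expR0 cos0 sin0; apply: eqC; rewrite ?ReM ?ImM /=; ring. Qed.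

Lemma nc_cexp z : nc (cexp z) = expR (complex.Re z).
Proof.
rewrite /cexp ncM nc_real ger0_norm ?expR_ge0//.
by rewrite [nc (_ +i* _)]/= cos2Dsin2 sqrtr1 mulr1.
Qed.

Lemma rdiff0 (f : R -> R) (k : R) : is_derive (0 : R) (1 : R) f k -> forall e : R, 0 < e ->
  exists2 d : R, 0 < d & forall t, `|t| < d -> `|f t - f 0 - k * t| <= e * `|t|.
Proof.
move=> [df kE] e e0; move: df; rewrite /derivable => df.
have : h^-1 *: (f (h *: 1 + 0) - f 0) @[h --> 0^'] --> k by rewrite -kE; exact: df.
move=> /cvgrPdist_le /(_ e e0)[d /= d0 hd].
exists d => // t td; have [->|t0] := eqVneq t 0.
  by rewrite !subrr mulr0 subrr normr0 mulr0.
have := hd t; rewrite /= sub0r normrN => /(_ td t0).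
rewrite /GRing.scale /= mulr1 addr0.
have t00 : 0 < `|t| by rewrite normr_gt0.
rewrite -(ler_pM2r t00) -normrM distrC mulrBl.
by have -> : t^-1 * (f t - f 0) * t = f t - f 0 by field.
Qed.

(** The one place where the derivatives of the real exponential, cosine and sine enter; [cexpD]
    carries the result from 0 to every point. *)
Lemma cexp_slope0 (e : R) : 0 < e -> exists2 d : R, 0 < d &
  forall h, nc h < d -> nc (cexp h - 1 - h) <= e * nc h.
Proof.
(* The remainder breaks into five terms, worth at most seven units [e / 8 * N] in all. *)
move=> e0; pose e1 := Num.min 1 (e / 8).
have e10 : 0 < e1 by rewrite lt_min ltr01 divr_gt0.
have e11 : e1 <= 1 by rewrite ge_min lexx.
have e18 : e1 <= e / 8 by rewrite ge_min lexx orbT.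
have [d1 d10 h1] := rdiff0 (is_derive_expR 0) e10.
have [d2 d20 h2] := rdiff0 (is_derive_cos 0) e10.
have [d3 d30 h3] := rdiff0 (is_derive_sin 0) e10.
exists (Num.min (Num.min d1 d2) (Num.min d3 (Num.min (1 / 4) (e / 8)))).
  by rewrite !lt_min d10 d20 d30 !divr_gt0.
move=> [x y]; set h := x +i* y; rewrite !lt_min => /andP[/andP[hd1 hd2] /and3P[hd3 hd5 hd4]].
have xh : `|x| <= nc h := nc_Re h; have yh : `|y| <= nc h := nc_Im h.
have := h1 x (le_lt_trans xh hd1); have := h2 y (le_lt_trans yh hd2).
have := h3 y (le_lt_trans yh hd3).
rewrite expR0 cos0 sin0 oppr0 mul0r !subr0 ?addr0 !mul1r => g3 g2 g1.
have nh := nc_ge0 h; set N := nc h in xh yh nh hd4 hd5 *.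
apply: le_trans (nc_ReIm _) _.
have -> : complex.Re (cexp h - 1 - h) = (expR x - 1 - x) + expR x * (cos y - 1).
  by rewrite /cexp /h !(ReD, ReN, ReM) /=; ring.
have -> : complex.Im (cexp h - 1 - h) = expR x * (sin y - y) + (expR x - 1 - x) * y + x * y.
  by rewrite /cexp /h !(ImD, ImN, ImM) /=; ring.
have y0 := normr_ge0 y; have x0 := normr_ge0 x.
have eb1 : `|expR x - 1 - x| <= e / 8 * N.
  by apply: le_trans g1 _; apply: ler_pM => //; exact: ltW.
have ex2 : expR x <= 2.
  have : expR x - 1 - x <= e1 * `|x| by apply: le_trans g1; exact: ler_norm.
  have : e1 * `|x| <= `|x| by rewrite ler_piMl.
  have := ler_norm x; lra.
have bound u : `|u| <= e1 * `|y| -> `|expR x * u| <= 2 * (e / 8 * N).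
  move=> hu; rewrite normrM ger0_norm ?expR_ge0//.
  apply: ler_pM; rewrite ?expR_ge0//; apply: le_trans hu _.
  by apply: ler_pM => //; exact: ltW.
have k1 := bound _ g2; have k2 := bound _ g3.
have k3 : `|(expR x - 1 - x) * y| <= e / 8 * N.
  rewrite normrM; apply: le_trans (_ : e / 8 * N * 1 <= _); last by rewrite mulr1.
  apply: ler_pM => //; apply: le_trans yh (le_trans (ltW hd5) _).
  by rewrite ler_pdivrMr// mul1r ler1n.
have k4 : `|x * y| <= e / 8 * N.
  by rewrite normrM; apply: ler_pM => //; exact: le_trans xh (ltW hd4).
have l1 := ler_normD (expR x - 1 - x) (expR x * (cos y - 1)).
have l2 := ler_normD (expR x * (sin y - y) + (expR x - 1 - x) * y) (x * y).
have l3 := ler_normD (expR x * (sin y - y)) ((expR x - 1 - x) * y).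
have eN : 0 <= e * N by apply: mulr_ge0 => //; exact: ltW.
have EE : e * N = 8 * (e / 8 * N) by field.
rewrite EE; move: (e / 8 * N) EE eb1 k1 k2 k3 k4 l1 l2 l3 eN => E -> eb1 k1 k2 k3 k4 l1 l2 l3 eN.
apply: le_trans (lerD l1 (le_trans l2 (lerD l3 (lexx _)))) _.
clear -eb1 k1 k2 k3 k4 eN; lra.
Qed.

Lemma cdiff_cexp z : cdiff cexp z.
Proof.
pose phi h := if h == 0 then 1 else (cexp h - 1) / h.
have phiE h : cexp h - 1 = phi h * h.
  rewrite /phi; case: eqVneq => [->|h0]; first by rewrite cexp0 subrr mulr0.
  by rewrite divfK.
have cphi : ccont phi 0.
  move=> e e0; have e20 : 0 < e / 2 by rewrite divr_gt0.
  have [d d0 hd] := cexp_slope0 e20; exists d => // h; rewrite subr0 => hh.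
  rewrite {2}/phi eqxx /phi; case: eqVneq => [_|h0]; first by rewrite subrr nc0.
  have hN : 0 < nc h by rewrite nc_gt0.
  rewrite -(ltr_pM2r hN) -ncM mulrBl divfK// mul1r.
  apply: le_lt_trans (hd h hh) _; rewrite ltr_pM2r//; lra.
exists (fun w => cexp z * phi (w - z)).
  apply: ccontM; first exact: ccont_cst.
  apply: (@ccont_comp _ (fun w => w - z) phi); last by rewrite subrr.
  by apply: ccontB; [exact: ccont_id|exact: ccont_cst].
exists 1 => // w _; rewrite -mulrA -phiE mulrBr mulr1 -cexpD.
by rewrite [z + _]addrC subrK.
Qed.

End ComplexExponential.

(** * Mean value property and maximum modulus principle *)

Section MaximumModulus.
Variable R : realType.
Local Notation mu := (@lebesgue_measure R).
Implicit Types (f g : R[i] -> R[i]) (l z w : R[i]) (s r t : R).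

Let circ l s t : R[i] := l + cexp (s +i* t).

Let nc_circ l s t : nc (circ l s t - l) = expR s.
Proof. by rewrite /circ addrC addKr nc_cexp. Qed.

Lemma imul_sub_eq0 (a b : R[i]) : 'i * (a - b) = 0 -> a = b.
Proof.
move=> h; apply/eqP; rewrite -subr_eq0 -nc_eq0.
by have /eqP := congr1 (@Normc.normc R) h; rewrite ncM nc0 nc_imag normr1 mul1r.
Qed.

Lemma cexp_periodic s : cexp (s +i* (pi *+ 2)) = cexp (s +i* 0) :> R[i].
Proof. by rewrite /cexp /= cos2pi sin2pi cos0 sin0. Qed.

(* Goursat's theorem for w |-> f (l + exp w) on a rectangle of height 2 pi. *)
Lemma mean_value f l s : (forall z, nc (z - l) <= expR s -> cdiff f z) ->
  cint `[0, pi *+ 2] (fun t => f (circ l s t)) = (pi *+ 2)%:C * f l.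
Proof.
move=> df; have p0 : 0 <= pi *+ 2 :> R by rewrite mulrn_wge0// pi_ge0.
have dg w : complex.Re w <= s -> cdiff (fun w => f (l + cexp w)) w.
  move=> ws; apply: (@cdiff_comp _ (fun w => l + cexp w) f).
    by apply: cdiffD; [exact: cdiff_cst|exact: cdiff_cexp].
  by apply: df; rewrite addrC addKr nc_cexp ler_expR.
have cg r : r <= s -> pcont `[0, pi *+ 2] (fun t => f (circ l r t)).
  move=> rs; apply: (@pcont_ver _ (fun w => f (l + cexp w))) => t _.
  by apply/cdiff_cont/dg.
have E r : r <= s -> cint `[0, pi *+ 2] (fun t => f (circ l r t)) =
    cint `[0, pi *+ 2] (fun t => f (circ l s t)).
  move=> rs; have : rect (fun w => f (l + cexp w)) r s 0 (pi *+ 2) = 0.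
    by apply: goursat => // z /andP[/andP[_ h] _]; exact: dg.
  have hor : cint `[r, s] (fun x => f (l + cexp (x +i* (pi *+ 2)))) =
      cint `[r, s] (fun x => f (l + cexp (x +i* 0))).
    by apply: eq_cint => x _; rewrite cexp_periodic.
  by rewrite /rect hor subrr add0r => /imul_sub_eq0 ->.
apply/eqP; rewrite -subr_eq0; apply/eqP/nc_small => e e0.
have cf : ccont f l by apply/cdiff_cont/df; rewrite subrr nc0 expR_ge0.
have P0 : 0 < 2 * (pi *+ 2) + 1 :> R by rewrite ltr_wpDl// mulr_ge0.
have [|d d0 hd] := cf (e / (2 * (pi *+ 2) + 1)); first by rewrite divr_gt0.
pose r := Num.min s (ln (d / 2)).
have d20 : 0 < d / 2 by rewrite divr_gt0.
have rd : expR r < d.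
  apply: (@le_lt_trans _ _ (d / 2)); last by rewrite ltr_pdivrMr// mulr_natr mulr2n ltrDl.
  by rewrite -[leRHS](lnK (_ : d / 2 \in Num.pos))// ler_expR ge_min lexx orbT.
have rs : r <= s by rewrite ge_min lexx.
rewrite -(E r rs) -[X in (X%:C)]subr0 -cint_itv_cst// -cintB//; last 2 first.
- by apply: pcont_integrable; exact: cg.
- by apply: pcont_integrable; exact: pcont_cst.
apply: le_trans (cint_le_itv (c := e / (2 * (pi *+ 2) + 1)) p0 _ _) _.
- by apply: pcontD_itv; [exact: cg|exact: pcont_cst].
- by move=> t _; apply/ltW/hd; rewrite nc_circ.
rewrite subr0; set q := pi *+ 2 in P0 p0 *.
have -> : 2 * (e / (2 * q + 1)) * q = e * (2 * q) / (2 * q + 1) by ring.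
by rewrite ler_pdivrMr// ler_wpM2l ?(ltW e0)// lerDl.
Qed.

(** Closed and bounded, for predicates on the complex numbers: on sets given by inequalities both
    conditions are checked by inequalities. *)
Definition ccompact (K : R[i] -> Prop) :=
  (forall z, (forall e : R, 0 < e -> exists2 w, K w & nc (w - z) < e) -> K z) /\ exists B : R, forall z, K z -> nc z <= B.

Lemma ccompact_max (K : R[i] -> Prop) (u : R[i] -> R) z1 : ccompact K -> K z1 ->
  (forall z, K z -> forall e : R, 0 < e -> exists2 d : R, (0 < d)%R &
    forall w, K w -> nc (w - z) < d -> (`|u z - u w| < e)%R) ->
  exists2 z0, K z0 & forall z, K z -> u z <= u z0.
Proof.
move=> [Kcl [B KB]] Kz1 cu.
pose A : set (R * R) := [set p | K (p.1 +i* p.2)].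
have dist (p q : R * R) (d : R) : `|p.1 - q.1| < d / 2 -> `|p.2 - q.2| < d / 2 ->
    nc (p.1 +i* p.2 - q.1 +i* q.2) < d.
  move=> h1 h2; apply: le_lt_trans (nc_ReIm _) _.
  by rewrite !(ReD, ImD, ReN, ImN) /= (splitr d) ltrD.
have Acpt : compact A.
  have H := compact_setX (@segment_compact R (- B) B) (@segment_compact R (- B) B).
  apply: (subclosed_compact _ H).
    move=> [x y] hxy; apply: Kcl => e e0.
    have e20 : 0 < e / 2 by rewrite divr_gt0.
    have [|[x' y'] [/= Kw [h1 h2]]] := hxy (ball (x, y) (e / 2)).
      exact: nbhsx_ballx.
    exists (x' +i* y') => //; rewrite nc_dist; exact: (dist (x, y) (x', y')).
  move=> [x y] /= /KB h; split; rewrite /= in_itv /= -ler_norml.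
    exact: le_trans (nc_Re (x +i* y)) h.
  exact: le_trans (nc_Im (x +i* y)) h.
have [||p pA hp] := @compact_EVT_max _ R (fun p => u (p.1 +i* p.2)) A _ Acpt.
- by exists (complex.Re z1, complex.Im z1) => /=; case: z1 Kz1.
- apply/subspace_continuousP => -[x y] Axy; apply/cvgrPdist_lt => e e0.
  have [d d0 hd] := cu _ Axy _ e0.
  have d20 : 0 < d / 2 by rewrite divr_gt0.
  have : nbhs (x, y) (ball (x, y) (d / 2)) by exact: nbhsx_ballx.
  apply: filterS => -[x' y'] [/= h1 h2] K'; apply: hd => //.
  by rewrite nc_dist; exact: (dist (x, y) (x', y')).
exists (p.1 +i* p.2); first by move: pA; rewrite inE.
by move=> [x y] Kz; apply: (hp (x, y)); rewrite inE.
Qed.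

(** The alternative at each point, a bound or a disc inside K, replaces the topological boundary; K
    can then be a truncated sector, a box or an annulus. *)
Lemma max_modulus (K : R[i] -> Prop) f (M : R) : ccompact K -> 0 <= M ->
  (forall z, K z -> cdiff f z) ->
  (forall z, K z -> nc (f z) <= M \/
     exists2 r : R, 0 < r & forall w, nc (w - z) <= r -> K w) ->
  forall z, K z -> nc (f z) <= M.
Proof.
move=> cK M0 df bd z Kz; have [_ [B KB]] := cK.
have B0 : 0 <= B := le_trans (nc_ge0 z) (KB z Kz).
rewrite -(ler_pXn2r (n := 2)) ?nnegrE ?nc_ge0//.
apply/ler_addgt0Pr => e' e'0.
pose e := e' / (B ^+ 2 + 1); have B20 : 0 < B ^+ 2 + 1 by rewrite ltr_wpDl// sqr_ge0.
have e0 : 0 < e by rewrite divr_gt0.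
(* The term [e |z|^2] makes the squared modulus strictly subharmonic. *)
pose u w := nc (f w) ^+ 2 + e * nc w ^+ 2.
have uE w : (u w)%:C = f w * (f w)^* + e%:C * (w * w^*).
  by rewrite !conjMz /u; apply: eqC; rewrite !(ReD, ImD, ReM, ImM) /=; ring.
have conj_cont h w : ccont h w -> ccont (fun w => (h w)^*) w.
  by move=> ch e1 /ch[d d0 hd]; exists d => // w' /hd; rewrite -conjB nc_conj.
have [|z0 Kz0 hz0] := ccompact_max (u := u) cK Kz.
  move=> w Kw e1 e10.
  have cU : ccont (fun w => f w * (f w)^* + e%:C * (w * w^*)) w.
    have cf := cdiff_cont (df w Kw); have cid := @ccont_id R w.
    apply: ccontD; apply: ccontM => //; [exact: conj_cont|exact: ccont_cst|].
    by apply: ccontM => //; exact: conj_cont cid.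
  have [d d0 hd] := cU _ e10; exists d => // w' _ /hd; rewrite -!uE nc_dist.
  by apply: le_lt_trans; rewrite -nc_real rmorphB.
have {}hz : nc (f z) ^+ 2 <= nc (f z0) ^+ 2 + e * nc z0 ^+ 2.
  by apply: le_trans (hz0 z Kz); rewrite lerDl mulr_ge0 ?sqr_ge0// ltW.
case: (bd z0 Kz0) => [fM|[r r0 hr]].
  apply: le_trans hz _; apply: lerD.
    by rewrite ler_pXn2r ?nnegrE ?nc_ge0.
  apply: (@le_trans _ _ (e * (B ^+ 2 + 1))); last by rewrite /e divfK// gt_eqF.
  rewrite ler_wpM2l ?(ltW e0)//; apply: (@le_trans _ _ (B ^+ 2)); last by rewrite lerDl.
  by rewrite ler_pXn2r ?nnegrE ?nc_ge0// KB.
exfalso; pose s := ln r; have er : expR s = r by rewrite lnK.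
(* Holomorphic function whose real part is the linear part of [u w - u z0]. Its mean over a circle
   about [z0] is 0, whereas maximality of [u] at [z0] forces the real part below - e r^2 on the
   circle. *)
pose g w := 2 * (f z0)^* * (f w - f z0) + (2 * e)%:C * z0^* * (w - z0).
have dg w : nc (w - z0) <= expR s -> cdiff g w.
  rewrite er => /hr /df dw; apply: cdiffD; apply: cdiffM; try exact: cdiff_cst.
    by apply: cdiffB => //; exact: cdiff_cst.
  by apply: cdiffB; [exact: cdiff_id|exact: cdiff_cst].
have := mean_value dg.
have -> : g z0 = 0 by rewrite /g !subrr !mulr0 addr0.
rewrite mulr0 => /(congr1 (@complex.Re R)) /= E.
have gneg t : complex.Re (g (circ z0 s t)) <= - (e * r ^+ 2).
  set w := circ z0 s t; have wr : nc (w - z0) = r by rewrite nc_circ.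
  have Kw : K w by apply: hr; rewrite wr.
  have := hz0 w Kw; rewrite /u.
  have sqE (a b : R[i]) : nc a ^+ 2 = nc b ^+ 2 + complex.Re (2 * b^* * (a - b)) + nc (a - b) ^+ 2.
    by case: a => a1 a2; case: b => b1 b2; rewrite !nc_sq !(ReM, ImM, ReD, ImD, ReN, ImN) /=; ring.
  rewrite (sqE (f w) (f z0)) (sqE w z0) wr /g ReD.
  have -> : complex.Re ((2 * e)%:C * z0^* * (w - z0)) = e * complex.Re (2 * z0^* * (w - z0)).
    by case: (z0^*) => a1 a2; case: (w - z0) => b1 b2; rewrite !(ReM, ImM) /=; ring.
  have := sqr_ge0 (nc (f w - f z0)); lra.
have p0 : 0 < pi *+ 2 :> R by rewrite pmulrn_lgt0// pi_gt0.
have mI : measurable (`[0, pi *+ 2]%classic : set (measurableTypeR R)) by exact: measurable_itv.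
have cgc : pcont `[0, pi *+ 2] (fun t => g (circ z0 s t)).
  apply: (@pcont_ver _ (fun w => g (z0 + cexp w))) => t _; apply: ccont_comp.
    by apply: ccontD; [exact: ccont_cst|exact/cdiff_cont/cdiff_cexp].
  by apply/cdiff_cont/dg; rewrite nc_circ.
have := le_Rintegral mI (pcont_integrable cgc).1
  (integrable_itv_cst 0 (pi *+ 2) (- (e * r ^+ 2))) (fun t _ => gneg t).
rewrite E Rintegral_cst//= mu_itv ?(ltW p0)// subr0 leNgt.
rewrite mulNr oppr_lt0; apply/negP; rewrite negbK.
by apply: mulr_gt0 => //; apply: mulr_gt0 => //; exact: exprn_gt0.
Qed.

End MaximumModulus.

(** * Rules for complex conjugation *)

Section Conjugation.
Variable R : realType.
Implicit Types x y : R[i].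

(* Below a ring operation the notation [x^*] denotes the conjugation of
   numClosedField's, which is only convertible to that of complex numbers. *)
Lemma NumconjE x : Num.conj x = conjc x. Proof. by []. Qed.
Lemma conjcM x y : conjc (x * y) = conjc x * conjc y.
Proof. exact: (rmorphM (@conjc R)). Qed.
Lemma conjcD x y : conjc (x + y) = conjc x + conjc y.
Proof. exact: (rmorphD (@conjc R)). Qed.
Lemma conjcB x y : conjc (x - y) = conjc x - conjc y.
Proof. exact: (rmorphB (@conjc R)). Qed.
Lemma conjcR (r : R) : conjc r%:C = r%:C.
Proof. by rewrite /= oppr0. Qed.

End Conjugation.

(** * A Phragmen-Lindelof theorem for functions of superexponential decay on a half-line *)

Section PhragmenLindelof.
Variable R : realType.
Implicit Types (h g E : R[i] -> R[i]) (u w z : R[i]) (N S C D e r x : R).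

(** Uniform approximability by differentiable functions. It stands in for holomorphy of a limit, and
    the maximum principle passes to it with an arbitrarily small loss. *)
Definition approx_on (K : R[i] -> Prop) h := forall e : R, 0 < e ->
  exists2 g, (forall z, K z -> cdiff g z) & forall z, K z -> nc (g z - h z) <= e.

Lemma ccompact_bounded (K : R[i] -> Prop) E : ccompact K -> (forall z, K z -> ccont E z) ->
  exists2 S, 0 <= S & forall z, K z -> nc (E z) <= S.
Proof.
move=> cK cE; case: (pselect (exists z, K z)) => [[z1 Kz1]|nK]; last first.
  by exists 0 => // z Kz; exfalso; apply: nK; exists z.
have [|z0 Kz0 h] := ccompact_max (u := fun z => nc (E z)) cK Kz1.
  move=> z Kz e /(cE z Kz)[d d0 hd]; exists d => // w _ /hd; apply: le_lt_trans.
  by rewrite ler_norml nc_dist; have := ncBD (E z) (E w); have := ncBD (E w) (E z);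
    rewrite [nc (E w - E z)]nc_dist; lra.
by exists (nc (E z0)) => //; exact: nc_ge0.
Qed.

Lemma approx_mul (K : R[i] -> Prop) h E : ccompact K -> approx_on K h ->
  (forall z, K z -> cdiff E z) -> approx_on K (fun z => h z * E z).
Proof.
move=> cK ah dE e e0; have [S S0 hS] := ccompact_bounded cK (fun z Kz => cdiff_cont (dE z Kz)).
have S10 : 0 < S + 1 by rewrite ltr_wpDl.
have [g dg hg] := ah _ (divr_gt0 e0 S10).
exists (fun z => g z * E z) => z Kz; first by apply: cdiffM; [exact: dg|exact: dE].
rewrite -mulrBl ncM; apply: le_trans (ler_pM (nc_ge0 _) (nc_ge0 _) (hg z Kz) (hS z Kz)) _.
by rewrite mulrAC ler_pdivrMr// ler_wpM2l ?(ltW e0)// lerDl.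
Qed.

Lemma max_modulus_approx (K : R[i] -> Prop) h M : ccompact K -> 0 <= M -> approx_on K h ->
  (forall z, K z -> nc (h z) <= M \/
     exists2 r : R, 0 < r & forall w, nc (w - z) <= r -> K w) ->
  forall z, K z -> nc (h z) <= M.
Proof.
move=> cK M0 ah bd z Kz; apply/ler_addgt0Pr => e e0.
have e20 : 0 < e / 2 by rewrite divr_gt0.
have [g dg hg] := ah _ e20.
have near w : K w -> nc (g w) <= nc (h w) + e / 2 /\ nc (h w) <= nc (g w) + e / 2.
  move=> Kw; have := hg w Kw; have := ncBD (g w) (h w); have := ncBD (h w) (g w).
  by rewrite [nc (h w - _)]nc_dist => *; split; lra.
have : nc (g z) <= M + e / 2.
  apply: (max_modulus cK _ dg) Kz => [|w Kw]; first by rewrite addr_ge0// ltW.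
  case: (bd w Kw) => [hM|]; [left|by right].
  by apply: le_trans (near w Kw).1 _; rewrite lerD2r.
have := (near z Kz).2; lra.
Qed.

Lemma le_expR_eps (X D q : R) : 0 <= X -> (forall e : R, 0 < e -> X <= D * expR (e * q)) ->
  0 <= D -> X <= D.
Proof.
move=> X0 h D0; apply/ler_addgt0Pr => e e0.
have P0 : 0 < `|q| * X + 1 by rewrite ltr_wpDl// mulr_ge0.
have d0 := divr_gt0 e0 P0; set d := e / _ in d0.
have h1 : X * expR (- (d * q)) <= D.
  by rewrite expRN ler_pdivrMr ?expR_gt0// h.
have h2 : X * (1 - d * q) <= X * expR (- (d * q)).
  by rewrite ler_wpM2l// expR_ge1Dx.
have h3 : X * (d * q) <= e.
  apply: (@le_trans _ _ (d * (`|q| * X + 1))); last by rewrite /d divfK// gt_eqF.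
  rewrite mulrCA ler_wpM2l ?(ltW d0)// [X * q]mulrC.
  have : q * X <= `|q| * X by rewrite ler_wpM2r// ler_norm.
  lra.
lra.
Qed.

Section half_plane.
Variables (S : R).
Hypothesis S0 : 0 < S.

Definition pl_data h := [/\ approx_on (fun u => 1 <= complex.Re u) h,
  forall u, 1 <= complex.Re u -> nc (h u) <= S &
  forall N, 0 < N -> exists2 C, 0 <= C & forall x, 1 <= x -> nc (h x%:C) * expR (N * x) <= C].

(** Cubing opens the sector of angle pi / 4 to 3 pi / 4, which is less than pi, and the factor 1 - 2
    i rotates the result into the right half-plane. The value is a^3 on the axis and 2 a^3 on the
    diagonal. *)
Let cubic (w : R[i]) := complex.Re ((1 -i* 2) * w ^+ 3).

Lemma cubicE (a b : R) : cubic (a +i* b) = a ^+ 3 - 3 * a * b ^+ 2 + 6 * a ^+ 2 * b - 2 * b ^+ 3.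
Proof. by rewrite /cubic !exprS expr0 mulr1 !(ReM, ImM) /=; ring. Qed.

Lemma Re_sqr1 (a b : R) : complex.Re (1 + (a +i* b) ^+ 2) = 1 + a ^+ 2 - b ^+ 2.
Proof. by rewrite expr2 !(ReD, ReM, ImM) /=; ring. Qed.

Lemma box_near (x y x' y' r : R) : `|x' - x| <= x - 1 -> `|x' - x| <= r - x ->
  `|y' - y| <= r - `|y| -> (1 <= x' <= r) && (- r <= y' <= r).
Proof.
rewrite !ler_norml => /andP[h1 _] /andP[_ h2] /andP[h3 h4].
have := ler_norm y; have := ler_norm (- y); rewrite normrN => h5 h6.
by apply/andP; split; apply/andP; split; lra.
Qed.

Lemma sector_near (x y x' y' r : R) : `|y' - y| <= y -> `|y' - y| <= (x - y) / 2 ->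
  `|x' - x| <= (x - y) / 2 -> `|x' - x| <= r - x -> (0 <= y' <= x') && (x' <= r).
Proof.
rewrite !ler_norml => /andP[h1 _] /andP[_ h2] /andP[h3 _] /andP[_ h4].
by apply/andP; split; [apply/andP; split|]; lra.
Qed.

Lemma le_min3 (a b c r : R) : r <= Num.min a (Num.min b c) -> [/\ r <= a, r <= b & r <= c].
Proof. by rewrite !le_min => /and3P. Qed.

(* Quadrant, in the coordinate w with u = 1 + w^2: the sector
   0 <= Im w <= Re w, where Re ((1 - 2i) w^3) >= 0 grows like |w|^3. *)
Lemma pl_quadrant h N : pl_data h -> 0 < N -> exists2 D, 0 <= D &
  forall u, 1 <= complex.Re u -> 0 <= complex.Im u -> nc (h u) * expR (N * complex.Re u) <= D.
Proof.
move=> [ah hS hC] N0; have [C C0 {}hC] := hC N N0.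
(* [C] bounds the product on the real axis, [S * expR N] on the diagonal and on the far side of the
   truncated sector. *)
pose D := Num.max C (S * expR N).
have D0 : 0 <= D by rewrite le_max C0.
exists D => // u u1 u2.
have [w [wu w1 w2]] : exists w, [/\ u = 1 + w ^+ 2, 0 <= complex.Im w & complex.Im w <= complex.Re w].
  exists (sqrtc (u - 1)); rewrite sqr_sqrtc addrC subrK; split => //.
    case: u u1 u2 => a b /= a1 b0; rewrite oppr0 addr0.
    rewrite mulr_ge0 ?sqrtr_ge0//; case: ifP => // _; by rewrite sgr_ge0.
  case: u u1 u2 => a b /= a1 b0; rewrite oppr0 addr0.
  have -> : (if b == 0 then 1 else Num.sg b) * Num.sqrt ((Num.sqrt ((a - 1) ^+ 2 + b ^+ 2) - (a - 1)) / 2)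
     = Num.sqrt ((Num.sqrt ((a - 1) ^+ 2 + b ^+ 2) - (a - 1)) / 2).
    case: eqVneq => [_|b1]; first by rewrite mul1r.
    by rewrite gtr0_sg ?mul1r// lt_def b1.
  by rewrite ler_wsqrtr// ler_wpM2r// lerD2l; lra.
rewrite wu; apply: (le_expR_eps (q := cubic w)) => [|e e0|//].
  by rewrite mulr_ge0 ?nc_ge0 ?expR_ge0.
pose E v := cexp (N%:C * (1 + v ^+ 2)) * cexp (- (e%:C * ((1 -i* 2) * v ^+ 3))).
have dE v : cdiff E v.
  have dX n : cdiff (fun v => v ^+ n) v by apply: cdiffX; exact: cdiff_id.
  apply: cdiffM; apply: cdiff_comp (cdiff_cexp _).
    by apply: cdiffM; [exact: cdiff_cst|apply: cdiffD => //; exact: cdiff_cst].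
  by apply/cdiffN/cdiffM; [exact: cdiff_cst|apply: cdiffM => //; exact: cdiff_cst].
have ncE v : nc (E v) = expR (N * complex.Re (1 + v ^+ 2)) * expR (- (e * cubic v)).
  rewrite /E ncM !nc_cexp /cubic; congr (expR _ * expR _).
    by rewrite ReM; move: (1 + v ^+ 2) => X /=; ring.
  by move: ((1 -i* 2) * v ^+ 3) => X; rewrite ReN ReM /=; ring.
(* The summand N / e lets e a^3 outweigh N a^2 on the far side a = r. *)
pose r := complex.Re w + N / e.
pose K v := (0 <= complex.Im v <= complex.Re v) && (complex.Re v <= r).
have Ne0 : 0 <= N / e by apply: divr_ge0; exact: ltW.
have r0 : 0 <= r by apply: addr_ge0 => //; exact: le_trans w2.
have cK : ccompact K.
  split.
    move=> z hz; rewrite /K; apply/andP; split; first (apply/andP; split).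
    - rewrite leNgt; apply/negP => zn; have zn0 : 0 < - complex.Im z by rewrite oppr_gt0.
      have [v /andP[/andP[v1 v2] v3] vz] := hz _ zn0.
      have := le_lt_trans (nc_Im _) vz; rewrite ImD ImN ltr_norml; lra.
    - rewrite leNgt; apply/negP => zn.
      have zn0 : 0 < (complex.Im z - complex.Re z) / 2 by rewrite divr_gt0// subr_gt0.
      have [v /andP[/andP[v1 v2] v3] vz] := hz _ zn0.
      have := le_lt_trans (nc_Im _) vz; have := le_lt_trans (nc_Re _) vz.
      rewrite ImD ImN ReD ReN !ltr_norml; lra.
    - rewrite leNgt; apply/negP => zn; have zn0 : 0 < complex.Re z - r by rewrite subr_gt0.
      have [v /andP[/andP[v1 v2] v3] vz] := hz _ zn0.
      have := le_lt_trans (nc_Re _) vz; rewrite ReD ReN ltr_norml; lra.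
  exists (r + r) => v /andP[/andP[v1 v2] v3]; apply: le_trans (nc_ReIm _) _.
  by apply: lerD; rewrite ger0_norm; lra.
have KRe v : K v -> 1 <= complex.Re (1 + v ^+ 2).
  case: v => a b; rewrite Re_sqr1 => /andP[/andP[/= b0 ba] _].
  have : b ^+ 2 <= a ^+ 2 by rewrite ler_pXn2r ?nnegrE//; lra.
  lra.
have aK : approx_on K (fun v => h (1 + v ^+ 2) * E v).
  apply: approx_mul => // e1 e10; have [g dg hg] := ah _ e10.
  exists (fun v => g (1 + v ^+ 2)) => v /KRe kv; last exact: hg.
  apply: (@cdiff_comp _ (fun v => 1 + v ^+ 2) g); last exact: dg.
  by apply: cdiffD; [exact: cdiff_cst|apply: cdiffX; exact: cdiff_id].
have Kw : K w.
  by rewrite /K w1 w2 /= /r lerDl.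
have := max_modulus_approx cK D0 aK _ Kw.
rewrite ncM ncE mulrA expRN ler_pdivrMr ?expR_gt0//; apply => -[a b] Kv.
have hSv : nc (h (1 + (a +i* b) ^+ 2)) <= S by apply/hS/KRe.
have /andP[/andP[b0 ba] ar] := Kv; rewrite /= in b0 ba ar.
case: (eqVneq b 0) => [bE|b1].
  left; apply: (@le_trans _ _ C); last by rewrite le_max lexx.
  rewrite ncM ncE bE cubicE Re_sqr1 mulrA.
  have -> : 1 + (a +i* 0) ^+ 2 = (1 + a ^+ 2)%:C.
    by apply: eqC; rewrite expr2 !(ReD, ImD, ReM, ImM) /=; ring.
  rewrite -[leRHS]mulr1; apply: ler_pM.
  - by rewrite mulr_ge0 ?nc_ge0 ?expR_ge0.
  - exact: expR_ge0.
  - by rewrite expr0n subr0; apply: hC; rewrite lerDl sqr_ge0.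
  - rewrite -[leRHS]expR0 ler_expR oppr_le0 mulr_ge0 ?(ltW e0)// !expr0n /= !mulr0 subr0 !addr0 subr0.
    by rewrite exprn_ge0//; lra.
case: (eqVneq a b) => [abE|ab].
  left; apply: (@le_trans _ _ (S * expR N)); last by rewrite le_max lexx orbT.
  rewrite -abE in hSv *; rewrite ncM ncE cubicE Re_sqr1 addrK mulr1 -expRD.
  apply: ler_pM; rewrite ?nc_ge0 ?expR_ge0//.
  rewrite ler_expR gerDl oppr_le0 mulr_ge0 ?(ltW e0)//.
  have -> : a ^+ 3 - 3 * a * a ^+ 2 + 6 * a ^+ 2 * a - 2 * a ^+ 3 = 2 * a ^+ 3 by ring.
  by rewrite mulr_ge0// exprn_ge0//; lra.
case: (eqVneq a r) => [arE|ar1].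
  left; apply: (@le_trans _ _ (S * expR N)); last by rewrite le_max lexx orbT.
  rewrite ncM ncE cubicE Re_sqr1 -expRD.
  apply: ler_pM; rewrite ?nc_ge0 ?expR_ge0//.
  rewrite ler_expR.
  have a0 : 0 <= a by lra.
  have c1 : a ^+ 3 <= a ^+ 3 - 3 * a * b ^+ 2 + 6 * a ^+ 2 * b - 2 * b ^+ 3.
    have -> : a ^+ 3 - 3 * a * b ^+ 2 + 6 * a ^+ 2 * b - 2 * b ^+ 3 =
      a ^+ 3 + b * (3 * a * (a - b) + a ^+ 2 + 2 * (a - b) * (a + b)) by ring.
    have ab0 : 0 <= a - b by rewrite subr_ge0.
    by rewrite lerDl mulr_ge0// !addr_ge0 ?sqr_ge0// !mulr_ge0// addr_ge0.
  have c2 : N * a ^+ 2 <= e * a ^+ 3.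
    have -> : e * a ^+ 3 = e * a * a ^+ 2 by ring.
    rewrite ler_wpM2r ?sqr_ge0//.
    have : N / e <= a by rewrite arE /r lerDr (le_trans w1).
    by rewrite ler_pdivrMr// mulrC.
  have c3 : e * a ^+ 3 <= e * (a ^+ 3 - 3 * a * b ^+ 2 + 6 * a ^+ 2 * b - 2 * b ^+ 3).
    by rewrite ler_wpM2l// ltW.
  have c4 : 0 <= N * b ^+ 2 by rewrite mulr_ge0 ?sqr_ge0// ltW.
  rewrite mulrBr mulrDr mulr1; lra.
have b00 : 0 < b by rewrite lt_neqAle eq_sym b1 b0.
have ab0 : 0 < a - b by rewrite subr_gt0 lt_neqAle eq_sym ab ba.
have ar0 : 0 < r - a by rewrite subr_gt0 lt_neqAle ar1 ar.
right; exists (Num.min b (Num.min ((a - b) / 2) (r - a))).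
  by rewrite !lt_min b00 ar0 divr_gt0.
move=> [a' b'] /le_min3[k1 k2 k3].
have g1 := nc_Re (a' +i* b' - a +i* b); have g2 := nc_Im (a' +i* b' - a +i* b).
move: g1 g2; rewrite !(ReD, ImD, ReN, ImN) /= => g1 g2.
exact: sector_near (le_trans g2 k1) (le_trans g2 k2) (le_trans g1 k2) (le_trans g1 k3).
Qed.

Lemma cdiff_conj g z : cdiff g (conjc z) -> cdiff (fun w => conjc (g (conjc w))) z.
Proof.
move=> [phi cphi [d d0 hd]]; exists (fun w => conjc (phi (conjc w))).
  move=> e /cphi[d' d'0 hd']; exists d' => // w wz.
  by rewrite -conjcB nc_conj; apply: hd'; rewrite -conjcB nc_conj.
exists d => // w wz.
have E : g (conjc w) - g (conjc z) = phi (conjc w) * (w^* - z^*).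
  by apply: hd; rewrite -conjcB nc_conj.
by rewrite -conjcB E conjcM conjcB !conjcK.
Qed.

(** Reflection carries the quadrant estimate to the lower quadrant. *)
Lemma pl_data_conj h : pl_data h -> pl_data (fun u => conjc (h (conjc u))).
Proof.
have cu u : complex.Re (conjc u) = complex.Re u by case: u.
move=> [ah hS hC]; split.
- move=> e /ah[g dg hg]; exists (fun w => conjc (g (conjc w))).
    by move=> z z1; apply: cdiff_conj; apply: dg; rewrite cu.
  by move=> z z1; rewrite -conjcB nc_conj; apply: hg; rewrite cu.
- by move=> u u1; rewrite nc_conj; apply: hS; rewrite cu.
- move=> N /hC[C C0 h1]; exists C => // x /h1; rewrite nc_conj.
  by rewrite conjcR.
Qed.

(** The constants of [pl_quadrant] depend on N in an uncontrolled way, but they show that h u exp (N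
    u) is bounded on the half-plane. A bounded function is governed by its values on Re u = 1, here
    at most S exp N: divide by 1 + e u, apply the maximum principle to a large box, and let e tend
    to 0. *)
Lemma pl_half_plane h N : pl_data h -> 0 < N ->
  forall u, 1 <= complex.Re u -> nc (h u) * expR (N * complex.Re u) <= S * expR N.
Proof.
move=> ph N0 u u1.
have [D1 D10 h1] := pl_quadrant ph N0.
have [D2 D20 h2] := pl_quadrant (pl_data_conj ph) N0.
pose D := D1 + D2; have D0 : 0 <= D by exact: addr_ge0.
have hD v : 1 <= complex.Re v -> nc (h v) * expR (N * complex.Re v) <= D.
  move=> v1; have [v2|v2] := leP 0 (complex.Im v).
    by apply: le_trans (h1 v v1 v2) _; rewrite lerDl.
  have := h2 (conjc v); rewrite conjcK nc_conj.
  have -> : complex.Re (conjc v) = complex.Re v by case: v {v1 v2}.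
  have -> : complex.Im (conjc v) = - complex.Im v by case: v {v1 v2}.
  move=> /(_ v1); rewrite oppr_ge0 => /(_ (ltW v2)) /le_trans; apply.
  by rewrite lerDr.
have [ah hS _] := ph; pose T := S * expR N; have T0 : 0 < T by rewrite mulr_gt0// expR_gt0.
apply/ler_addgt0Pr => e' e'0.
have P0 : 0 < T * (nc u + 1) by rewrite mulr_gt0// ltr_wpDl// nc_ge0.
(* Chosen so that T |1 + e u| <= T + e'. *)
pose e := e' / (T * (nc u + 1)); have e0 : 0 < e by rewrite divr_gt0.
pose E v := cexp (N%:C * v) * (1 + e%:C * v)^-1.
have Re1 v : complex.Re (1 + e%:C * v) = 1 + e * complex.Re v.
  by case: v => a b; rewrite ReD ReM /=; ring.
have Im1 v : complex.Im (1 + e%:C * v) = e * complex.Im v.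
  by case: v => a b; rewrite ImD ImM /=; ring.
have den1 v : 1 <= complex.Re v -> 1 <= nc (1 + e%:C * v).
  move=> v1; apply: le_trans (nc_Re _); apply: le_trans (ler_norm _).
  by rewrite Re1 lerDl mulr_ge0 ?(ltW e0)//; lra.
have den0 v : 1 <= complex.Re v -> 1 + e%:C * v != 0.
  by move=> /den1 h0; rewrite -nc_gt0; apply: lt_le_trans h0.
have dlin v : cdiff (fun v => 1 + e%:C * v) v.
  by apply: cdiffD; [exact: cdiff_cst|apply: cdiffM; [exact: cdiff_cst|exact: cdiff_id]].
have dE v : 1 <= complex.Re v -> cdiff E v.
  move=> v1; apply: cdiffM; last by apply: cdiffV => //; exact: den0.
  apply: cdiff_comp (cdiff_cexp _).
  by apply: cdiffM; [exact: cdiff_cst|exact: cdiff_id].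
have ncE v : nc (E v) = expR (N * complex.Re v) / nc (1 + e%:C * v).
  rewrite /E ncM nc_cexp ncV; congr (expR _ / _).
  by case: v => a b; rewrite ReM /=; ring.
(* The summand D / (e T) makes D / |1 + e v| <= T on the far sides of the box. *)
pose r := nc u + D / (e * T) + 1.
have DeT : 0 <= D / (e * T) by apply: divr_ge0 => //; apply: mulr_ge0; exact: ltW.
have u0 := nc_ge0 u.
pose K v := (1 <= complex.Re v <= r) && (- r <= complex.Im v <= r).
have cK : ccompact K.
  split.
    move=> z hz; rewrite /K; apply/andP; split; apply/andP; split.
    - rewrite leNgt; apply/negP => zn; have zn0 : 0 < 1 - complex.Re z by rewrite subr_gt0.
      have [v /andP[/andP[v1 v2] v3] vz] := hz _ zn0.
      have := le_lt_trans (nc_Re _) vz; rewrite ReD ReN ltr_norml; lra.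
    - rewrite leNgt; apply/negP => zn; have zn0 : 0 < complex.Re z - r by rewrite subr_gt0.
      have [v /andP[/andP[v1 v2] v3] vz] := hz _ zn0.
      have := le_lt_trans (nc_Re _) vz; rewrite ReD ReN ltr_norml; lra.
    - rewrite leNgt; apply/negP => zn; have zn0 : 0 < - r - complex.Im z by rewrite subr_gt0.
      have [v /andP[_ /andP[v1 v2]] vz] := hz _ zn0.
      have := le_lt_trans (nc_Im _) vz; rewrite ImD ImN ltr_norml; lra.
    - rewrite leNgt; apply/negP => zn; have zn0 : 0 < complex.Im z - r by rewrite subr_gt0.
      have [v /andP[_ /andP[v1 v2]] vz] := hz _ zn0.
      have := le_lt_trans (nc_Im _) vz; rewrite ImD ImN ltr_norml; lra.
  exists (r + r) => v /andP[/andP[v1 v2] /andP[v3 v4]]; apply: le_trans (nc_ReIm _) _.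
  by apply: lerD; rewrite ler_norml; lra.
have aK : approx_on K (fun v => h v * E v).
  apply: approx_mul => //; last by move=> z /andP[/andP[z1 _] _]; exact: dE.
  move=> e1 /ah[g dg hg]; exists g => z /andP[/andP[z1 _] _]; [exact: dg|exact: hg].
have Ku : K u.
  have ur : nc u <= r by rewrite /r -addrA lerDl addr_ge0.
  rewrite /K u1 -ler_norml (le_trans (nc_Im u) ur) andbT.
  exact: le_trans (ler_norm _) (le_trans (nc_Re u) ur).
have : nc (h u * E u) <= T.
  apply: (max_modulus_approx cK (ltW T0) aK) Ku => v Kv.
  have /andP[/andP[v1 v2] /andP[v3 v4]] := Kv.
  have far : r <= complex.Re v \/ r <= `|complex.Im v| -> nc (h v * E v) <= T.
    move=> fv; rewrite ncM ncE mulrA ler_pdivrMr; last by apply: lt_le_trans (den1 v v1).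
    apply: le_trans (hD v v1) _; rewrite mulrC -ler_pdivrMr//.
    have : e * r <= nc (1 + e%:C * v).
      case: fv => fv.
        apply: le_trans (nc_Re _); apply: le_trans (ler_norm _); rewrite Re1.
        have : e * r <= e * complex.Re v by rewrite ler_wpM2l// ltW.
        lra.
      by apply: le_trans (nc_Im _); rewrite Im1 normrM gtr0_norm// ler_wpM2l// ltW.
    apply: le_trans; have : D / T = e * (D / (e * T)) by field; rewrite !gt_eqF.
    by move=> ->; rewrite ler_wpM2l ?(ltW e0)// /r; lra.
  case: (eqVneq (complex.Re v) 1) => [vE|vn1].
    left; rewrite ncM ncE mulrA ler_pdivrMr; last by apply: lt_le_trans (den1 v v1).
    rewrite vE mulr1 -[leLHS]mulr1; apply: ler_pM => //; last exact: den1.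
      by rewrite mulr_ge0 ?nc_ge0 ?expR_ge0.
    by rewrite ler_wpM2r ?expR_ge0//; exact: hS.
  have [f1|f1] := leP r (complex.Re v); first by left; apply: far; left.
  have [f2|f2] := leP r `|complex.Im v|; first by left; apply: far; right.
  have v11 : 0 < complex.Re v - 1 by rewrite subr_gt0 lt_neqAle eq_sym vn1 v1.
  right; exists (Num.min (complex.Re v - 1) (Num.min (r - complex.Re v) (r - `|complex.Im v|))).
    by rewrite !lt_min v11 !subr_gt0 f1.
  move=> w /le_min3[k1 k2 k3].
  have g1 := nc_Re (w - v); have g2 := nc_Im (w - v).
  move: g1 g2; rewrite !(ReD, ImD, ReN, ImN) => g1 g2.
  exact: box_near (le_trans g1 k1) (le_trans g1 k2) (le_trans g2 k3).
rewrite ncM ncE mulrA ler_pdivrMr; last by apply: lt_le_trans (den1 u u1).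
move=> /le_trans; apply.
have : nc (1 + e%:C * u) <= 1 + e * nc u.
  by apply: le_trans (ncD _ _) _; rewrite nc1 ncM nc_real gtr0_norm.
rewrite -(ler_pM2l T0) => /le_trans; apply; rewrite mulrDr mulr1 lerD2l.
have -> : e' = e * (T * (nc u + 1)) by rewrite /e divfK// gt_eqF.
by rewrite mulrCA ler_wpM2l ?(ltW e0)// ler_wpM2l ?(ltW T0)// lerDl.
Qed.

(** The bound S exp (- N (Re u - 1)) holds for every N, with S independent of N. *)
Lemma pl_zero h : pl_data h -> forall u, 1 < complex.Re u -> h u = 0.
Proof.
move=> ph u u1; apply: nc_small => e e0.
have x0 : 0 < complex.Re u - 1 by rewrite subr_gt0.
pose N := S / (e * (complex.Re u - 1)).
have N0 : 0 < N by apply: divr_gt0 => //; exact: mulr_gt0.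
have := pl_half_plane ph N0 (ltW u1).
rewrite -ler_pdivlMr ?expR_gt0// -expRN -mulrA -expRD => /le_trans; apply.
have -> : N + - (N * complex.Re u) = - (N * (complex.Re u - 1)) by ring.
rewrite expRN ler_pdivrMr ?expR_gt0//.
have : 1 + N * (complex.Re u - 1) <= expR (N * (complex.Re u - 1)) by exact: expR_ge1Dx.
rewrite -(ler_pM2l e0) => /(le_trans _); apply.
have -> : e * (1 + N * (complex.Re u - 1)) = e + S.
  by rewrite /N; field; rewrite !gt_eqF.
by rewrite lerDr ltW.
Qed.

End half_plane.
End PhragmenLindelof.

(** * The Blaschke factors of B1 *)

Section Blaschke.
Variable R : realType.
Implicit Types (x y : R) (z l : R[i]).

Definition lam (n : nat) : R[i] := (n.+1)%:R +i* 1.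
Definition bl (n : nat) : R[i] -> R[i] := bfactor (lam n).
Definition BN (N : nat) z : R[i] := \prod_(n < N) bl n z.

(** [d] is both the Cauchy modulus and the error of the limit, so that rates of convergence
    survive. *)
Lemma complex_cauchy (u : nat -> R[i]) (d : nat -> R) :
  (forall e : R, 0 < e -> exists N, d N < e) ->
  (forall N M, (N <= M)%N -> nc (u M - u N) <= d N) ->
  exists l, forall N, nc (u N - l) <= d N.
Proof.
move=> d0 ud.
have real_cauchy (v : nat -> R) : (forall N M, (N <= M)%N -> `|v M - v N| <= d N) ->
    exists l : R, v @ \oo --> l.
  move=> vd; apply/cvg_ex; apply: cauchy_cvg; apply: cauchy_exP => e e0.
  have [N dN] := d0 e e0; exists (v N); exists N => // M /= NM.
  by rewrite /ball /= distrC; apply: le_lt_trans (vd _ _ NM) dN.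
have [|a ha] := real_cauchy (fun n => complex.Re (u n)).
  by move=> N M NM; apply: le_trans (ud N M NM); rewrite -ReN -ReD nc_Re.
have [|b hb] := real_cauchy (fun n => complex.Im (u n)).
  by move=> N M NM; apply: le_trans (ud N M NM); rewrite -ImN -ImD nc_Im.
exists (a +i* b) => N; apply/ler_addgt0Pr => e e0.
have e20 : 0 < e / 2 by rewrite divr_gt0.
move/cvgrPdist_lt : ha => /(_ _ e20)[n1 _ h1]; move/cvgrPdist_lt : hb => /(_ _ e20)[n2 _ h2].
pose M := maxn N (maxn n1 n2).
have {}h1 := h1 M; have {}h2 := h2 M.
rewrite /= !leq_max !leqnn ?orbT /= in h1 h2.
have -> : u N - a +i* b = - (u M - u N) + (u M - a +i* b) by ring.
apply: le_trans (ncD _ _) _; rewrite ncN; apply: lerD; first by apply: ud; rewrite leq_maxl.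
apply: le_trans (nc_ReIm _) _; rewrite !(ReD, ImD, ReN, ImN) /= distrC [X in _ + X]distrC (splitr e).
by apply: lerD; apply: ltW; [apply: h1|apply: h2].
Qed.

Lemma limnC (u : nat -> R[i]) l : (forall e : R, 0 < e -> exists N, forall n, (N <= n)%N ->
  nc (u n - l) < e) -> limn (u : nat -> R[i]^o) = l.
Proof.
move=> h; apply: cvg_lim; first exact: norm_hausdorff.
apply/cvgrPdist_lt => e /gt0C[e0 ->]; have [N hN] := h _ e0.
by exists N => // n /= /hN; rewrite ncE ltcR nc_dist.
Qed.

Section factor.
Variable n : nat.
Let m : R := (n.+1)%:R.
Let s : R := Num.sqrt (m ^+ 2 + 4).

Let m0 : 0 < m. Proof. by rewrite ltr0n. Qed.
Let s2 : s ^+ 2 = m ^+ 2 + 4. Proof. by rewrite sqr_sqrtr// addr_ge0 ?sqr_ge0. Qed.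
Let s0 : 0 < s. Proof. by rewrite sqrtr_gt0 ltr_wpDl ?sqr_ge0. Qed.

(** Closed form of the unimodular constant in [bfactor (lam n)]; [s] is the modulus of i - conj (lam
    n). *)
Definition blc : R[i] := (m / s) -i* (2 / s).

Lemma blE z : bl n z = blc * ((z - lam n) / (z - conjc (lam n))).
Proof.
rewrite /bl /bfactor; case: eqP => [[] /eqP|_].
  by rewrite pnatr_eq0.
rewrite !NumconjE; congr (_ * _).
have iE : 'i - lam n = (- m)%:C by apply: eqC; rewrite !(ReD, ImD, ReN, ImN) /= /m; ring.
have jE : 'i - conjc (lam n) = (- m) +i* 2.
  by apply: eqC; rewrite !(ReD, ImD, ReN, ImN) /= /m; ring.
have ncj : nc ((- m) +i* 2) = s by rewrite /= sqrrN /s; congr (Num.sqrt (_ + _)); ring.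
have j0 : (- m) +i* 2 != 0 :> R[i] by rewrite -nc_gt0 ncj.
rewrite iE jE ncM ncV ncj nc_real normrN gtr0_norm//.
have -> : (- m)%:C / ((- m) +i* 2) = (m ^+ 2 / s ^+ 2) +i* (2 * m / s ^+ 2).
  apply: (mulIf j0); rewrite divfK//.
  by apply: eqC; rewrite !(ReM, ImM) /= s2; field; rewrite gt_eqF// ltr_wpDl ?sqr_ge0.
have ms0 : (m / s)%:C != 0 :> R[i] by apply/eqP => -[] /eqP; rewrite mulf_eq0 invr_eq0 !gt_eqF.
apply: (mulIf ms0); rewrite divfK//.
by apply: eqC; rewrite !(ReM, ImM) /=; field; rewrite gt_eqF.
Qed.

Lemma nc_blc : nc blc = 1.
Proof.
apply/eqP; rewrite -(eqrXn2 (n := 2)) ?nc_ge0// expr1n nc_sq /= sqrrN !expr_div_n -mulrDl.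
have -> : m ^+ 2 + 2 ^+ 2 = s ^+ 2 by rewrite s2; ring.
by rewrite divff// gt_eqF// exprn_gt0.
Qed.

Lemma lam_den z : 0 <= complex.Im z -> 1 <= nc (z - conjc (lam n)).
Proof.
move=> z0; apply: le_trans (nc_Im _); apply: le_trans (ler_norm _).
by rewrite ImD ImN /= opprK lerDr.
Qed.

Lemma bl_le1 z : 0 <= complex.Im z -> nc (bl n z) <= 1.
Proof.
move=> z0; have d1 := lam_den z0.
rewrite blE ncM nc_blc mul1r ncM ncV ler_pdivrMr ?mul1r; last exact: lt_le_trans d1.
rewrite -(ler_pXn2r (n := 2)) ?nnegrE ?nc_ge0// !nc_sq !(ReD, ImD, ReN, ImN) /=.
by rewrite lerD2l opprK; move: z0; case: z {d1} => a b /= b0; rewrite -subr_ge0;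
  have -> : (b + 1) ^+ 2 - (b - 1) ^+ 2 = 4 * b; [ring|rewrite mulr_ge0].
Qed.

(** The constant [blc] makes the bound quadratic in 1 / m; the bare quotient differs from 1 by O (1
    / m), which is not summable. In [E] the terms of order m cancel, since s - m <= 2 / m, and [qz]
    turns 1 / |q| into (1 + |z|) / m. *)
Lemma bl_near1 z : 0 <= complex.Im z -> nc (1 - bl n z) <= 4 * (1 + nc z) ^+ 2 / m ^+ 2.
Proof.
move=> z0; have d1 := lam_den z0; set q := z - conjc (lam n) in d1.
have q0 : q != 0 by rewrite -nc_gt0; exact: lt_le_trans d1.
have qz : m <= (1 + nc z) * nc q.
  have : m - nc z <= nc q.
    have := nc_Re q; rewrite /q ReD ReN /= -/m; have := nc_Re z; rewrite !ler_norml; lra.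
  have := nc_ge0 z; nra.
have nz := nc_ge0 z.
have ds : 0 <= s - m <= 2 / m.
  have sm : m <= s.
    by rewrite -(ler_pXn2r (n := 2)) ?nnegrE ?(ltW m0) ?(ltW s0)// s2 lerDl.
  rewrite subr_ge0 sm /= lerBlDr -(ler_pXn2r (n := 2)) ?nnegrE ?(ltW s0)//; last first.
    by rewrite addr_ge0 ?divr_ge0// ltW.
  have -> : (2 / m + m) ^+ 2 = 4 / m ^+ 2 + 4 + m ^+ 2 by field; rewrite gt_eqF.
  by rewrite s2 addrC lerD2r lerDr divr_ge0// exprn_ge0// ltW.
have E : 1 - bl n z = ('i * (2 * z) + 2 + (s - m)%:C * q) / (s%:C * q).
  have s0C : s%:C != 0 :> R[i] by apply/eqP => -[] /eqP; rewrite gt_eqF.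
  apply: (mulIf (mulf_neq0 s0C q0)); rewrite divfK ?mulf_neq0// mulrBl mul1r.
  have -> : bl n z * (s%:C * q) = (m -i* 2) * (z - lam n).
    rewrite blE -/q.
    have -> : blc * ((z - lam n) / q) * (s%:C * q) = (blc * s%:C) * (z - lam n) by field.
    by congr (_ * _); apply: eqC; rewrite !(ReM, ImM) /=; field; rewrite gt_eqF.
  by rewrite /q; case: z {d1 q q0 qz nz z0} => a b; apply: eqC;
    rewrite !(ReM, ImM, ReD, ImD, ReN, ImN) /= -/m; ring.
rewrite E ncM ncV ncM nc_real gtr0_norm// ler_pdivrMr ?mulr_gt0//; last by rewrite nc_gt0.
apply: le_trans (ncD _ _) _; rewrite ncM nc_real ger0_norm; last by case/andP: ds.
have t1 : nc ('i * (2 * z) + 2) <= 2 * (1 + nc z).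
  apply: le_trans (ncD _ _) _; rewrite !ncM nc_imag normr1 mul1r.
  have -> : nc (2 : R[i]) = 2 by rewrite -[2 : R[i]](rmorph_nat (real_complex R)) nc_real ger0_norm.
  by rewrite mulrDr mulr1 addrC.
have nq : 0 < nc q by exact: lt_le_trans d1.
have [_ ds2] := andP ds.
have t2 : (s - m) * nc q <= 2 / m * nc q by rewrite ler_wpM2r// ltW.
apply: le_trans (lerD t1 t2) _.
have sm : m <= s by have := andP ds; rewrite subr_ge0 => -[].
have t3 : 4 * (1 + nc z) ^+ 2 / m ^+ 2 * (m * nc q) <= 4 * (1 + nc z) ^+ 2 / m ^+ 2 * (s * nc q).
  rewrite ler_wpM2l ?ler_pM2r// divr_ge0 ?exprn_ge0 ?(ltW m0)//.
  by rewrite mulr_ge0// exprn_ge0// addr_ge0.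
apply: le_trans t3.
have -> : 4 * (1 + nc z) ^+ 2 / m ^+ 2 * (m * nc q) = (4 * (1 + nc z) ^+ 2 * nc q) / m.
  by field; rewrite gt_eqF.
rewrite ler_pdivlMr// mulrDl.
have -> : 2 / m * nc q * m = 2 * nc q by field; rewrite gt_eqF.
have t4 : 2 * (1 + nc z) * m <= 2 * (1 + nc z) * ((1 + nc z) * nc q).
  by rewrite ler_wpM2l// mulr_ge0// addr_ge0.
have t5 : 2 * nc q <= 2 * (1 + nc z) ^+ 2 * nc q.
  rewrite ler_pM2r// -[leLHS]mulr1 ler_wpM2l// expr2; nra.
nra.
Qed.

End factor.
End Blaschke.

(** * Convergence of the Blaschke product, pointwise and in mean square *)

Section BlaschkeProduct.
Variable R : realType.
Implicit Types (x y : R) (z l : R[i]).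
Local Notation BN := (@BN R).
Local Notation bl := (@bl R).
Local Notation lam := (@lam R).

Lemma lam_sub_neq n z : - 1 < complex.Im z -> z - conjc (lam n) != 0.
Proof.
move=> z1; rewrite subr_eq0; apply/eqP => E.
by move: z1; rewrite E /= ltxx.
Qed.

Lemma cdiff_bl n z : z - conjc (lam n) != 0 -> cdiff (bl n) z.
Proof.
move=> z1; apply: (@cdiff_ext _ (fun z => blc R n * ((z - lam n) * (z - conjc (lam n))^-1))).
  by move=> w; rewrite blE.
apply: cdiffM; first exact: cdiff_cst.
apply: cdiffM; first by apply: cdiffB; [exact: cdiff_id|exact: cdiff_cst].
by apply: cdiffV => //; apply: cdiffB; [exact: cdiff_id|exact: cdiff_cst].
Qed.

Lemma BNS N z : BN N.+1 z = BN N z * bl N z.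
Proof. by rewrite /BN big_ord_recr. Qed.

Lemma cdiff_BN N z : (forall n, (n < N)%N -> z - conjc (lam n) != 0) -> cdiff (BN N) z.
Proof. by move=> h; apply: cdiff_prod => i _; apply: cdiff_bl; exact: h. Qed.

Lemma BN_le1 N z : 0 <= complex.Im z -> nc (BN N z) <= 1.
Proof.
move=> z0; elim: N => [|N IH]; first by rewrite /BN big_ord0 nc1.
by rewrite BNS ncM mulr_ile1 ?nc_ge0// bl_le1.
Qed.

Lemma BN_lam N n : (n < N)%N -> BN N (lam n) = 0.
Proof.
move=> nN; rewrite /BN (bigD1 (Ordinal nN)) //= blE subrr mul0r mulr0.
by rewrite mul0r.
Qed.

(** Each new factor changes the product by at most C / (k + 1)^2 <= C (1 / k - 1 / (k + 1)), which
    telescopes. *)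
Lemma BN_cauchy N M z : 0 <= complex.Im z -> (N <= M)%N ->
  nc (BN M.+1 z - BN N.+1 z) <= 4 * (1 + nc z) ^+ 2 / N.+1%:R.
Proof.
move=> z0 /subnKC <-; set C := 4 * _; have C0 : 0 <= C.
  by rewrite mulr_ge0// exprn_ge0// addr_ge0// nc_ge0.
suff : nc (BN (N + (M - N)).+1 z - BN N.+1 z) <= C * (N.+1%:R^-1 - (N + (M - N)).+1%:R^-1).
  move/le_trans; apply; rewrite ler_wpM2l// gerDl oppr_le0 invr_ge0 ler0n.
  done.
elim: (M - N)%N => [|k IH]; first by rewrite addn0 !subrr nc0 mulr0.
rewrite addnS BNS; set P := BN (N + k).+1 z in IH *; set b := bl _ z.
have -> : P * b - BN N.+1 z = (P - BN N.+1 z) - P * (1 - b) by ring.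
apply: le_trans (ncB _ _) _.
have h1 : nc (P * (1 - b)) <= C / (N + k).+2%:R ^+ 2.
  rewrite ncM; apply: le_trans (ler_pM (nc_ge0 _) (nc_ge0 _) (BN_le1 _ z0) (bl_near1 _ z0)) _.
  by rewrite mul1r.
have h2 : ((N + k).+2%:R ^+ 2)^-1 <= (N + k).+1%:R^-1 - (N + k).+2%:R^-1 :> R.
  set t : R := (N + k).+1%:R; have t0 : 0 < t by rewrite ltr0n.
  have -> : (N + k).+2%:R = t + 1 :> R by rewrite -addn1 natrD.
  have -> : t^-1 - (t + 1)^-1 = (t * (t + 1))^-1 by field; rewrite !gt_eqF// ltr_wpDl// ltW.
  rewrite lef_pV2 ?posrE ?mulr_gt0 ?exprn_gt0// ?ltr_wpDl// ?(ltW t0)//; nra.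
apply: le_trans (lerD IH h1) _.
rewrite -mulrDr ler_wpM2l// -addrA lerD2l.
by rewrite addrC -lerBrDr opprK addrC; exact: h2.
Qed.

Lemma B1_approx N z : 0 <= complex.Im z ->
  nc (B1 z - BN N.+1 z) <= 4 * (1 + nc z) ^+ 2 / N.+1%:R.
Proof.
move=> z0; set C := 4 * _; have C0 : 0 <= C.
  by rewrite mulr_ge0// exprn_ge0// addr_ge0// nc_ge0.
have d0 (e : R) : 0 < e -> exists n : nat, C / n.+1%:R < e.
  move=> e0; exists (Num.bound (C / e)); rewrite ltr_pdivrMr ?ltr0n//.
  have : C / e < (Num.bound (C / e))%:R by apply: archi_boundP; rewrite divr_ge0// ltW.
  rewrite ltr_pdivrMr// mulrC => h; apply: lt_trans h _.
  by rewrite ltr_pM2l// ltr_nat.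
have [l hl] := complex_cauchy d0 (fun N M => @BN_cauchy N M z z0).
have <- : l = B1 z.
  apply/esym; rewrite /B1 /blaschke; apply: limnC => e e0; have [n hn] := d0 e e0.
  exists n.+1 => -[//|k] nk; apply: le_lt_trans (hl k) (le_lt_trans _ hn).
  by rewrite ler_wpM2l// lef_pV2 ?posrE ?ltr0n// ler_nat.
by rewrite nc_dist; exact: hl.
Qed.

Lemma B1_le1 z : 0 <= complex.Im z -> nc (B1 z) <= 1.
Proof.
move=> z0; apply/ler_addgt0Pr => e e0.
set C := 4 * (1 + nc z) ^+ 2; have C0 : 0 <= C.
  by rewrite mulr_ge0// exprn_ge0// addr_ge0// nc_ge0.
have h := B1_approx (Num.bound (C / e)) z0; rewrite -/C in h.
have h2 : C / (Num.bound (C / e)).+1%:R <= e.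
  rewrite ler_pdivrMr ?ltr0n//.
  have : C / e < (Num.bound (C / e))%:R by apply: archi_boundP; rewrite divr_ge0// ltW.
  rewrite ltr_pdivrMr// mulrC => h'; apply/ltW; apply: lt_trans h' _.
  by rewrite ltr_pM2l// ltr_nat.
have -> : B1 z = BN (Num.bound (C / e)).+1 z + (B1 z - BN (Num.bound (C / e)).+1 z) by ring.
apply: le_trans (ncD _ _) _; apply: lerD; first exact: BN_le1.
exact: le_trans h h2.
Qed.

Lemma pcont_BN N y : 0 <= y -> pcont setT (fun x => BN N (x +i* y)).
Proof.
move=> y0; apply: pcont_horT => x; apply/cdiff_cont/cdiff_BN => n _; apply: lam_sub_neq => /=.
by apply: lt_le_trans y0; rewrite ltrN10.
Qed.

Lemma cmeas_B1 y : 0 <= y -> cmeas (fun x => B1 (x +i* y)).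
Proof.
move=> y0; have mB N := cmeas_cont (pcont_BN N.+1 y0).
have small x (e : R) : 0 < e -> exists n, forall k, (n <= k)%N ->
    nc (B1 (x +i* y) - BN k.+1 (x +i* y)) < e.
  move=> e0; set C := 4 * (1 + nc (x +i* y)) ^+ 2; have C0 : 0 <= C.
    by rewrite mulr_ge0// exprn_ge0// addr_ge0// nc_ge0.
  exists (Num.bound (C / e)) => k nk; apply: le_lt_trans (@B1_approx k (x +i* y) y0) _.
  rewrite -/C ltr_pdivrMr ?ltr0n//.
  have : C / e < (Num.bound (C / e))%:R by apply: archi_boundP; rewrite divr_ge0// ltW.
  rewrite ltr_pdivrMr// mulrC => h; apply: lt_le_trans h _.
  by rewrite ler_pM2l// ler_nat ltnW.
split.
  apply: (@measurable_fun_cvg _ _ _ _ (fun N x => complex.Re (BN N.+1 (x +i* y)))).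
    by move=> N; case: (mB N).
  move=> x _; apply/cvgrPdist_lt => e e0; have [n hn] := small x e e0.
  exists n => // k nk; apply: le_lt_trans (hn k nk); rewrite -ReN -ReD; exact: nc_Re.
apply: (@measurable_fun_cvg _ _ _ _ (fun N x => complex.Im (BN N.+1 (x +i* y)))).
  by move=> N; case: (mB N).
move=> x _; apply/cvgrPdist_lt => e e0; have [n hn] := small x e e0.
exists n => // k nk; apply: le_lt_trans (hn k nk); rewrite -ImN -ImD; exact: nc_Im.
Qed.

(** The error D of the partial product is at most 2, and at most 16 (1 + x^2) / (N + 1), which is
    useless for large x. Interpolating the two gives D^2 (N + 2 + x^2) <= 36 (1 + x^2), so the
    squared integrand is dominated by a Poisson kernel of width c with c^2 = N + 2 and of integral O
    (1 / c), uniformly in y. *)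
Lemma sqint_B1_tail l (eta : R) : 0 < complex.Im l -> 0 < eta -> exists N0, forall N, (N0 <= N)%N ->
  forall y, 0 < y <= 1 ->
  sqint (fun x => (B1 (x +i* y) - BN N.+1 (x +i* y)) * (x +i* y - conjc l)^-1) eta.
Proof.
case: l => p q /= q0 eta0.
(* Constant in 1 + x^2 <= C ((x - p)^2 + q^2), which moves the pole from i to l. *)
pose C := 2 + (1 + 2 * p ^+ 2) / q ^+ 2.
have h2 : 0 <= (1 + 2 * p ^+ 2) / q ^+ 2.
  by apply: divr_ge0; [apply: addr_ge0 => //; apply: mulr_ge0 => //; exact: sqr_ge0|exact: sqr_ge0].
have C0 : 0 < C by rewrite /C ltr_wpDr.
have PC x : 1 + x ^+ 2 <= C * ((x - p) ^+ 2 + q ^+ 2).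
  have h : 1 + 2 * p ^+ 2 = (1 + 2 * p ^+ 2) / q ^+ 2 * q ^+ 2.
    by rewrite divfK// gt_eqF// exprn_gt0.
  have h3 : 0 <= (1 + 2 * p ^+ 2) / q ^+ 2 * (x - p) ^+ 2 by rewrite mulr_ge0// sqr_ge0.
  rewrite /C mulrDl [_ / _ * (_ + _)]mulrDr -h.
  have := sqr_ge0 (x - 2 * p); have := sqr_ge0 q; nra.
(* Makes 36 C pi / c at most [eta]. *)
pose N0 := Num.bound ((36 * C * pi / eta) ^+ 2).
exists N0 => N NN0 y /andP[y0 y1].
pose c := Num.sqrt (N.+1%:R + 1 : R).
have c2 : c ^+ 2 = N.+1%:R + 1 by rewrite sqr_sqrtr// addr_ge0.
have c0 : 0 < c by rewrite sqrtr_gt0 ltr_wpDl.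
have K0 : 0 <= Num.sqrt (36 * C) := sqrtr_ge0 _.
have K2 : Num.sqrt (36 * C) ^+ 2 = 36 * C by rewrite sqr_sqrtr// mulr_ge0// ltW.
have yc : (0 : R) != complex.Im (0 +i* c) by rewrite /= eq_sym gt_eqF.
have yq : y != complex.Im (conjc (p +i* q)).
  by rewrite /= gt_eqF//; apply: lt_trans y0; rewrite oppr_lt0.
apply: sqint_weaken (sqint_le (sqint_kernel yc) _ K0 _); first last.
- move=> x; rewrite -(ler_pXn2r (n := 2)) ?nnegrE ?nc_ge0 ?mulr_ge0 ?nc_ge0//.
  rewrite exprMn K2 ncM exprMn !ncV !exprVn !nc_line /= opprK subr0 sub0r sqrrN c2.
  set D := nc _; set z := x +i* y.
  have D0 : 0 <= D := nc_ge0 _.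
  have z0 : 0 <= complex.Im z := ltW y0.
  have D2 : D <= 2 by apply: le_trans (ncB _ _) _; have := B1_le1 z0; have := BN_le1 N.+1 z0; lra.
  have xs : 0 <= x ^+ 2 := sqr_ge0 x.
  have DN : D * N.+1%:R <= 16 * (1 + x ^+ 2).
    rewrite -ler_pdivlMr ?ltr0n//; apply: le_trans (B1_approx N z0) _.
    rewrite ler_pM2r ?invr_gt0 ?ltr0n//.
    have nz2 : nc z ^+ 2 <= x ^+ 2 + 1.
      by rewrite nc_sq /= lerD2l; have := ltW y0; nra.
    have := sqr_ge0 (1 - nc z); nra.
  have key : D ^+ 2 * (N.+1%:R + (1 + x ^+ 2)) <= 36 * (1 + x ^+ 2).
    have : D ^+ 2 <= 4 by nra.
    have : D * (D * N.+1%:R) <= 2 * (16 * (1 + x ^+ 2)).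
      by apply: ler_pM => //; rewrite mulr_ge0.
    rewrite expr2; nra.
  have qy : q ^+ 2 <= (y + q) ^+ 2 by have := ltW y0; nra.
  have P0 : 0 < (x - p) ^+ 2 + q ^+ 2 by rewrite ltr_wpDl ?sqr_ge0// exprn_gt0.
  have P1 : 0 < (x - p) ^+ 2 + (y + q) ^+ 2 by rewrite (lt_le_trans P0)// lerD2l.
  have P2 : 0 < x ^+ 2 + (N.+1%:R + 1) by rewrite ltr_wpDl// ltr_wpDl.
  rewrite ler_pdivrMr// mulrAC ler_pdivlMr//.
  have -> : x ^+ 2 + (N.+1%:R + 1) = N.+1%:R + (1 + x ^+ 2) by ring.
  apply: le_trans key _; rewrite -mulrA ler_wpM2l//.
  by apply: le_trans (PC x) _; rewrite ler_wpM2l ?(ltW C0)// lerD2l.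
- apply: cmeasM; last exact: cmeas_kernel.
  by apply: cmeasB; [exact: cmeas_B1 (ltW y0)|exact: cmeas_cont (pcont_BN _ (ltW y0))].
rewrite K2 /= sub0r normrN gtr0_norm// mulrA ler_pdivrMr//.
rewrite [eta * c]mulrC -ler_pdivrMr// -(ler_pXn2r (n := 2)) ?nnegrE ?(ltW c0)//; last first.
  apply: divr_ge0; last exact: ltW.
  by apply: mulr_ge0; [apply: mulr_ge0 => //; exact: ltW|exact: pi_ge0].
rewrite c2; have h : (36 * C * pi / eta) ^+ 2 < N0%:R by apply: archi_boundP; exact: sqr_ge0.
apply/ltW; apply: lt_trans h _; rewrite -natr1 in c2 *.
have : N0%:R <= N%:R :> R by rewrite ler_nat.
lra.
Qed.

End BlaschkeProduct.

(** * Limits as the height y tends to 0 from above *)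

Section LimitAtZero.
Variable R : realType.
Implicit Types (u v : R -> R[i]) (a b c : R[i]).

Definition lim0 u a := forall e : R, 0 < e -> exists2 d : R, 0 < d &
  forall y, 0 < y < d -> nc (u y - a) < e.

Lemma lim0_cst a : lim0 (fun=> a) a.
Proof. by move=> e e0; exists 1 => // y _; rewrite subrr nc0. Qed.

Lemma lim0_ext u v a : (forall y, 0 < y -> u y = v y) -> lim0 u a -> lim0 v a.
Proof.
move=> uv h e /h[d d0 hd]; exists d => // y /andP[y0 yd].
by rewrite -uv//; apply: hd; rewrite y0.
Qed.

Lemma lim0D u v a b : lim0 u a -> lim0 v b -> lim0 (fun y => u y + v y) (a + b).
Proof.
move=> h1 h2 e e0; have e20 : 0 < e / 2 by rewrite divr_gt0.
have [d1 d10 g1] := h1 _ e20; have [d2 d20 g2] := h2 _ e20.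
exists (Num.min d1 d2); first by rewrite lt_min d10.
move=> y; rewrite lt_min => /andP[y0 /andP[yd1 yd2]].
have -> : u y + v y - (a + b) = (u y - a) + (v y - b) by ring.
by apply: le_lt_trans (ncD _ _) _; rewrite (splitr e) ltrD// ?g1 ?g2 ?y0.
Qed.

Lemma lim0Z c u a : lim0 u a -> lim0 (fun y => c * u y) (c * a).
Proof.
move=> h e e0; have c0 : 0 < nc c + 1 by rewrite ltr_wpDl// nc_ge0.
have [d d0 hd] := h _ (divr_gt0 e0 c0); exists d => // y /hd.
rewrite ltr_pdivlMr// -mulrBr ncM => h1; apply: le_lt_trans h1.
by rewrite mulrC ler_wpM2l ?nc_ge0// lerDl.
Qed.

Lemma lim0B u v a b : lim0 u a -> lim0 v b -> lim0 (fun y => u y - v y) (a - b).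
Proof.
move=> h1 /(lim0Z (-1)) h2; rewrite -mulN1r.
by apply: lim0_ext (lim0D h1 h2) => y _; rewrite mulN1r.
Qed.

Lemma lim0_sum (I : Type) (s : seq I) (u : I -> R -> R[i]) (a : I -> R[i]) :
  (forall i, lim0 (u i) (a i)) -> lim0 (fun y => \sum_(i <- s) u i y) (\sum_(i <- s) a i).
Proof.
move=> h; elim: s => [|i s IH].
  by rewrite big_nil; apply: lim0_ext (lim0_cst 0) => y _; rewrite big_nil.
by rewrite big_cons; apply: lim0_ext (lim0D (h i) IH) => y _; rewrite big_cons.
Qed.

Lemma lim0_le u a (m : R) : lim0 u a -> (exists2 d : R, 0 < d & forall y, 0 < y < d -> nc (u y) <= m) ->
  nc a <= m.
Proof.
move=> h [d d0 hm]; apply/ler_addgt0Pr => e e0; have [d' d'0 hd'] := h e e0.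
pose y := Num.min d d' / 2.
have m0 : 0 < Num.min d d' by rewrite lt_min d0.
have yy : 0 < y < Num.min d d'.
  by rewrite /y divr_gt0//= ltr_pdivrMr// mulr_natr mulr2n ltrDl.
move: yy; rewrite lt_min => /andP[y0 /andP[y1 y2]].
have -> : a = u y - (u y - a) by ring.
apply: le_trans (ncB _ _) _; apply: lerD; first by apply: hm; rewrite y0.
by apply/ltW/hd'; rewrite y0.
Qed.

Lemma lim0_uniq u a b : lim0 u a -> lim0 u b -> a = b.
Proof.
move=> h1 h2; apply/eqP; rewrite -subr_eq0; apply/eqP/nc_small => e e0.
apply: (lim0_le (lim0B h1 h2)); exists 1 => // y _.
by rewrite subrr nc0 ltW.
Qed.

Lemma lim0P u a : (u : R -> R[i]^o) y @[y --> (0:R)^'+] --> (a : R[i]^o) <-> lim0 u a.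
Proof.
split=> [/cvgrPdist_lt h e e0|h].
  have e0C : 0 < e%:C :> R[i] by rewrite ltcR.
  have [d /= d0 hd] := h _ e0C; exists d => // y /andP[y0 yd].
  have := hd y; rewrite /= sub0r normrN gtr0_norm// => /(_ yd y0).
  by rewrite ncE ltcR nc_dist.
apply/cvgrPdist_lt => e /gt0C[e0 ->]; have [d d0 hd] := h _ e0.
exists d => // y /= yd y0; rewrite ncE ltcR nc_dist; apply: hd.
by rewrite y0 /=; move: yd; rewrite sub0r normrN gtr0_norm.
Qed.

Lemma lim0_cont (f : R[i] -> R[i]) (p : R -> R[i]) z K : (forall y, 0 < y -> nc (p y - z) <= K * y) ->
  ccont f z -> lim0 (fun y => f (p y)) (f z).
Proof.
move=> hp cf e /cf[d d0 hd]; have K0 : 0 < `|K| + 1 by rewrite ltr_wpDl.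
exists (d / (`|K| + 1)); first by rewrite divr_gt0.
move=> y /andP[y0]; rewrite ltr_pdivlMr// => yd; apply: hd; apply: le_lt_trans (hp y y0) _.
apply: le_lt_trans yd; rewrite mulrC ler_wpM2l ?(ltW y0)//.
by apply: le_trans (ler_norm K) _; rewrite lerDl.
Qed.

End LimitAtZero.

(** * Pairings in the Hardy space, the Takenaka-Malmquist system and Bessel's inequality *)

Section HardyPairing.
Variable R : realType.
Local Notation mu := (@lebesgue_measure R).
Implicit Types (f g : R[i] -> R[i]) (y M : R) (l z : R[i]).
Local Notation lam := (@lam R).
Local Notation BN := (@BN R).

Definition hardy f M := (forall z, 0 < complex.Im z -> cdiff f z) /\
  (forall y, 0 < y -> sqint (fun x => f (x +i* y)) M).

Lemma hardy_cmeas f : (forall z, 0 < complex.Im z -> cdiff f z) -> forall y, 0 < y ->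
  cmeas (fun x => f (x +i* y)).
Proof. by move=> df y y0; apply: cmeas_cont; apply: pcont_horT => x; apply/cdiff_cont/df. Qed.

Lemma hardy_above_hardy f M y : 0 < y -> hardy f M -> hardy_above f y M.
Proof.
move=> y0 [df f2]; split=> [z zy|y' yy']; first by apply: df; exact: lt_le_trans zy.
by apply: f2; exact: lt_le_trans yy'.
Qed.

Lemma H2_hardy f : H2 f -> exists M, hardy f M.
Proof.
move=> [hf [M hM]]; exists M.
have df z : 0 < complex.Im z -> cdiff f z by move=> z0; exact/derivable_cdiff/hf.
by split=> // y y0; split; [exact: hardy_cmeas|exact: hM].
Qed.

Lemma hardy_H2 f M : hardy f M -> H2 f.
Proof.
move=> [df f2]; split; first by move=> z z0; exact/cdiff_derivable/df.
by exists M => y y0; have [] := f2 y y0.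
Qed.

Definition ip f g y := cint setT (fun x => f (x +i* y) * conjc (g (x +i* y))).

(** Reproducing kernel of H^2 at l, up to a constant factor. *)
Definition kern l z := (z - conjc l)^-1.

Lemma kern_den l z : - complex.Im l < complex.Im z -> z - conjc l != 0.
Proof.
by move=> h; rewrite subr_eq0; apply: contraTneq h => ->; case: l => a b /=; rewrite ltxx.
Qed.

Lemma cdiff_kern l z : - complex.Im l < complex.Im z -> cdiff (kern l) z.
Proof.
move=> h; apply: cdiffV; last exact: kern_den.
by apply: cdiffB; [exact: cdiff_id|exact: cdiff_cst].
Qed.

Lemma hardy_kern l : 0 < complex.Im l -> hardy (kern l) (pi / complex.Im l).
Proof.
case: l => p q /= q0; split=> [z z0|y y0].
  by apply: cdiff_kern => /=; apply: lt_trans z0; rewrite oppr_lt0.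
have yq : y != complex.Im (conjc (p +i* q)).
  by rewrite /= gt_eqF//; apply: lt_trans y0; rewrite oppr_lt0.
apply: sqint_weaken (sqint_kernel yq).
have yq0 : 0 < y + q by rewrite addr_gt0.
by rewrite /= opprK gtr0_norm// ler_wpM2l ?pi_ge0// lef_pV2 ?posrE// lerDr ltW.
Qed.

Lemma hardyM f g M : hardy f M -> (forall z, 0 < complex.Im z -> cdiff g z) ->
  (forall z, 0 < complex.Im z -> nc (g z) <= 1) -> hardy (fun z => f z * g z) M.
Proof.
move=> [df f2] dg g1; split=> [z z0|y y0]; first by apply: cdiffM; [exact: df|exact: dg].
rewrite -[M]mul1r -[X in X * _](expr1n _ 2); apply: sqint_mulb => //.
- exact: f2.
- exact: hardy_cmeas.
- by move=> x; exact: g1.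
Qed.

Lemma ip_integrable f g M N y : hardy f M -> hardy g N -> 0 < y ->
  cintegrable setT (fun x => f (x +i* y) * conjc (g (x +i* y))).
Proof.
by move=> [_ hf] [_ hg] y0; have [] := sqint_mul (hf y y0) (sqint_conj (hg y y0)).
Qed.

(** On the line Im z = y the conjugate of z is z - 2 i y, so the conjugated kernel is the Cauchy
    kernel with pole l + 2 i y. The value of f at l itself appears only as y tends to 0. *)
Lemma ip_kern f M l y : hardy f M -> 0 < complex.Im l -> 0 < y ->
  ip f (kern l) y = (2 * pi)%:C * 'i * f (l + (0 +i* (2 * y))).
Proof.
move=> hf l0 y0; rewrite -(@cauchy_line _ f y M); last 2 first.
- exact: hardy_above_hardy.
- by rewrite ImD /=; lra.
apply: eq_cint => x _; congr (_ * _); rewrite /kern conjc_inv; congr (_^-1).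
by case: l {l0} => p q; apply: eqC; rewrite /= ?oppr0; ring.
Qed.

Lemma ip_kern_lim f M l : hardy f M -> 0 < complex.Im l ->
  lim0 (ip f (kern l)) ((2 * pi)%:C * 'i * f l).
Proof.
move=> hf l0; apply: (@lim0_ext _ (fun y => (2 * pi)%:C * 'i * f (l + (0 +i* (2 * y))))).
  by move=> y y0; rewrite (ip_kern hf).
apply: lim0Z; apply: (@lim0_cont _ f _ l 2) => [y y0|]; last by apply/cdiff_cont/hf.1.
by rewrite addrC addKr nc_imag gtr0_norm// mulr_gt0.
Qed.

Lemma ip_sum f M (I : Type) (s : seq I) (g : I -> R[i] -> R[i]) (N : I -> R) (a : I -> R[i]) y :
  hardy f M -> (forall i, hardy (g i) (N i)) -> 0 < y ->
  ip f (fun z => \sum_(i <- s) a i * g i z) y = \sum_(i <- s) conjc (a i) * ip f (g i) y.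
Proof.
move=> hf hg y0; have mT : measurable (setT : set (measurableTypeR R)) by exact: measurableT.
have ii i := ip_integrable hf (hg i) y0.
have [_ E] := cint_sum s mT (fun i => cintegrableZ (conjc (a i)) mT (ii i)).
under [RHS]eq_bigr do rewrite -(cintZ _ mT (ii _)).
rewrite -E; apply: eq_cint => x _; rewrite (big_morph _ (@conjcD R) (@conjc0 R)) mulr_sumr.
by apply: eq_bigr => i _; rewrite conjcM mulrCA.
Qed.

Lemma cint_conj D (p : R -> R[i]) : measurable (D : set (measurableTypeR R)) -> cintegrable D p ->
  cint D (fun x => conjc (p x)) = conjc (cint D p).
Proof.
move=> mD [p1 p2]; apply: eqC => /=.
  by apply: eq_Rintegral => x _; case: (p x).
rewrite -mulN1r -RintegralZl//; apply: eq_Rintegral => x _.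
by rewrite mulN1r; case: (p x).
Qed.

Lemma ip_conj f g M N y : hardy f M -> hardy g N -> 0 < y -> ip g f y = conjc (ip f g y).
Proof.
move=> hf hg y0; have mT : measurable (setT : set (measurableTypeR R)) by exact: measurableT.
rewrite /ip -cint_conj//; last exact: (ip_integrable hf hg).
by apply: eq_cint => x _; rewrite conjcM conjcK mulrC.
Qed.

(** The identity is required off the poles only: there the inverse has the default value 0 and
    partial fractions fail. *)
Definition in_span (s : seq nat) f := exists a : nat -> R[i],
  forall z, (forall n, z - conjc (lam n) != 0) -> f z = \sum_(n <- s) a n * kern (lam n) z.

Lemma lam_inj : injective (fun n => conjc (lam n)).
Proof. by move=> m n [/eqP]; rewrite eqr_nat eqSS => /eqP. Qed.

Lemma in_span_ext s f g : (forall z, (forall n, z - conjc (lam n) != 0) -> f z = g z) ->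
  in_span s f -> in_span s g.
Proof. by move=> fg [a ha]; exists a => z hz; rewrite -fg ?ha. Qed.

(** Partial fractions; since j is new, all poles stay simple. *)
Lemma in_span_kern s f j : j \notin s -> in_span s f ->
  in_span (j :: s) (fun z => f z * kern (lam j) z).
Proof.
move=> js [a ha]; pose d i := conjc (lam i) - conjc (lam j).
exists (fun i => if i == j then - \sum_(i <- s) a i / d i else a i / d i) => z hz.
rewrite ha// big_cons eqxx mulr_suml mulNr mulr_suml -sumrN -big_split /=.
rewrite !big_seq; apply: eq_bigr => i si.
have ij : i != j by apply: contraNneq js => <-.
have d0 : d i != 0 by rewrite subr_eq0; apply: contra ij => /eqP /lam_inj ->.
rewrite (negbTE ij) /kern.
have -> : a i / d i = a i / ((z - conjc (lam j)) - (z - conjc (lam i))).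
  by congr (_ / _); rewrite /d; ring.
have : z - conjc (lam j) - (z - conjc (lam i)) != 0.
  by apply: contra d0; rewrite /d => /eqP E; apply/eqP; rewrite -E; ring.
move: (z - conjc (lam j)) (z - conjc (lam i)) (hz j) (hz i) => u v u0 v0 uv.
by field; rewrite uv u0 v0.
Qed.

Lemma in_spanD s f g : in_span s f -> in_span s g -> in_span s (fun z => f z + g z).
Proof.
move=> [a ha] [b hb]; exists (fun n => a n + b n) => z hz.
by rewrite ha// hb// -big_split; apply: eq_bigr => i _; rewrite mulrDl.
Qed.

Lemma in_spanZ s f c : in_span s f -> in_span s (fun z => c * f z).
Proof.
move=> [a ha]; exists (fun n => c * a n) => z hz.
by rewrite ha// mulr_sumr; apply: eq_bigr => i _; rewrite mulrA.
Qed.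

Lemma in_span_cons s f j : j \notin s -> in_span s f -> in_span (j :: s) f.
Proof.
move=> js [a ha]; exists (fun i => if i == j then 0 else a i) => z hz.
rewrite ha// big_cons eqxx mul0r add0r !big_seq; apply: eq_bigr => i si.
by case: eqP => // ij; rewrite -ij si in js.
Qed.

(** Takenaka-Malmquist function without normalisation: its square norm on the real line is pi. *)
Definition tm n z := BN n z * kern (lam n) z.

(** Through this decomposition a pairing with [tm n] becomes a combination of point evaluations at
    the zeros with index at most n; its limit as y tends to 0 then exists. *)
Lemma in_span_tm n : exists2 s, (forall i, i \in s -> (i <= n)%N) & in_span s (tm n).
Proof.
have key N : (N <= n)%N -> exists2 s, (forall i, i \in s -> (i < N)%N || (i == n)) &
    in_span s (fun z => BN N z * kern (lam n) z).
  elim: N => [_|N IH Nn].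
    exists [:: n] => [i|]; first by rewrite inE => ->; rewrite orbT.
    by exists (fun=> 1) => z _; rewrite big_seq1 /BN big_ord0.
  have [s hs hsp] := IH (ltnW Nn).
  have Ns : N \notin s by apply/negP => /hs; rewrite ltnn /= => /eqP E; rewrite E ltnn in Nn.
  exists (N :: s).
    move=> i; rewrite inE => /orP[/eqP ->|/hs /orP[h|->]]; rewrite ?leqnn ?orbT//.
    by rewrite ltnS (ltnW h).
  (* Up to [blc], a Blaschke factor is 1 plus a multiple of the kernel at its own zero. *)
  have := in_spanZ (blc R N) (in_spanD (in_span_cons Ns hsp)
    (in_spanZ (conjc (lam N) - lam N) (in_span_kern Ns hsp))).
  apply: in_span_ext => z hz; rewrite BNS blE /kern; have := hz N; have := hz n.
  move=> h1 h2; have -> : conjc (lam N) - lam N = (z - lam N) - (z - conjc (lam N)) by ring.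
  move: (z - lam N) (z - conjc (lam N)) (z - conjc (lam n)) h2 h1 => u v w v0 w0.
  by field; rewrite v0 w0.
have [s hs h] := key n (leqnn n); exists s => // i /hs /orP[/ltnW//|/eqP ->//].
Qed.

Lemma hardy_tm n : hardy (tm n) pi.
Proof.
have hk : hardy (kern (lam n)) pi by have := @hardy_kern (lam n) ltr01; rewrite divr1.
have h : hardy (fun z => kern (lam n) z * BN n z) pi.
  apply: hardyM hk _ _ => z z0; last exact: BN_le1 (ltW z0).
  by apply: cdiff_BN => m _; apply: lam_sub_neq; apply: lt_trans z0; rewrite ltrN10.
by have -> : tm n = (fun z => kern (lam n) z * BN n z) by apply/funext => z; exact: mulrC.
Qed.

Lemma ip_tm f M n : hardy f M -> exists s a, (forall i, i \in s -> (i <= n)%N) /\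
  forall y, 0 < y -> ip f (tm n) y = \sum_(i <- s) conjc (a i) * ip f (kern (lam i)) y.
Proof.
move=> hf; have [s hs [a ha]] := in_span_tm n; exists s, a; split=> // y y0.
rewrite -(@ip_sum f M _ s (fun i => kern (lam i)) (fun=> pi) a)//; last first.
  by move=> i; have := @hardy_kern (lam i) ltr01; rewrite divr1.
apply: eq_cint => x _; congr (_ * conjc _); apply: ha => m.
by apply: lam_sub_neq => /=; apply: lt_trans y0; rewrite ltrN10.
Qed.

Lemma ip_tm_lim f M n : hardy f M -> exists c, lim0 (ip f (tm n)) c.
Proof.
move=> hf; have [s [a [hs E]]] := ip_tm n hf.
exists (\sum_(i <- s) conjc (a i) * ((2 * pi)%:C * 'i * f (lam i))).
apply: lim0_ext (lim0_sum _ (fun i => lim0Z _ (ip_kern_lim hf (_ : 0 < complex.Im (lam i))))).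
  by move=> y y0; rewrite E.
by move=> i; exact: ltr01.
Qed.

(** For k < j, pairing with [tm k] evaluates [tm j] at zeros of index at most k, where [BN j]
    vanishes. The other order follows by conjugation. *)
Lemma ip_tm_orth m n : m != n -> lim0 (ip (tm m) (tm n)) 0.
Proof.
have key k j : (k < j)%N -> lim0 (ip (tm j) (tm k)) 0.
  move=> kj; have [s [a [hs E]]] := ip_tm k (hardy_tm j).
  have -> : 0 = \sum_(i <- s) conjc (a i) * ((2 * pi)%:C * 'i * tm j (lam i)) :> R[i].
    rewrite big_seq big1// => i /hs ik; rewrite /tm BN_lam ?mul0r ?mulr0//.
    exact: leq_ltn_trans kj.
  apply: (@lim0_ext _ (fun y => \sum_(i <- s) conjc (a i) * ip (tm j) (kern (lam i)) y)).
    by move=> y y0; rewrite E.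
  apply: lim0_sum => i; apply: lim0Z.
  by apply: (ip_kern_lim (hardy_tm j)); exact: ltr01.
move=> mn; case: (ltngtP m n) mn => // mn _; last exact: key.
apply: (@lim0_ext _ (fun y => conjc (ip (tm n) (tm m) y))).
  by move=> y y0; rewrite -(ip_conj (hardy_tm n) (hardy_tm m) y0).
by move=> e /(key _ _ mn)[d d0 hd]; exists d => // y /hd; rewrite !subr0 nc_conj.
Qed.

Lemma ip_self f M y : hardy f M -> 0 < y -> nc (ip f f y) <= M.
Proof.
move=> [df f2] y0; have [h hM] := sqint_integrable (f2 y y0).
rewrite /ip (@eq_cint _ _ _ (fun x => (nc (f (x +i* y)) ^+ 2)%:C)); last first.
  by move=> x _; rewrite -conjMz.
by rewrite cint_real nc_real ger0_norm//; apply: Rintegral_ge0 => x _; rewrite exprn_ge0// nc_ge0.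
Qed.

Lemma hardy_sum (s : seq nat) (a : nat -> R[i]) : exists N, hardy (fun z => \sum_(n <- s) a n * tm n z) N.
Proof.
elim: s => [|n s [N [dN sN]]].
  exists 0; split=> [z _|y y0].
    by apply: (cdiff_ext _ (cdiff_cst 0 z)) => w; rewrite big_nil.
  have [_ /(_ y y0) h] := hardy_tm 0.
  apply: sqint_weaken (sqint_le (K := 0) h _ (lexx _) _).
  - by rewrite expr0n mul0r.
  - by apply: cmeas_cont; move=> x _ e e0; exists 1 => // t _ _; rewrite !big_nil subrr nc0.
  - by move=> x; rewrite big_nil nc0 mul0r.
have [dn sn] := hardy_tm n.
exists (2 * (nc (a n) ^+ 2 * pi + N)); split=> [z z0|y y0].
  apply: (@cdiff_ext _ (fun z => a n * tm n z + \sum_(n <- s) a n * tm n z)).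
    by move=> w; rewrite big_cons.
  by apply: cdiffD; [apply: cdiffM; [exact: cdiff_cst|exact: dn]|exact: dN].
under eq_fun do rewrite big_cons; apply: sqintD; last exact: sN.
apply: sqint_le (sn y y0) _ (nc_ge0 _) _; last by move=> x; rewrite ncM.
by apply: cmeasM; [exact: cmeas_cst|exact: hardy_cmeas].
Qed.

(* Bessel's inequality, with a constant that is not sharp: the system [tm] is
   orthogonal only in the limit y -> 0. *)
Lemma bessel f M (c : nat -> R[i]) N : hardy f M -> (forall n, lim0 (ip f (tm n)) (c n)) ->
  \sum_(0 <= n < N) nc (c n) ^+ 2 <= 4 * pi * M.
Proof.
move=> hf hc; have p0 : 0 < pi :> R := pi_gt0 R.
pose s := index_iota 0 N; pose G z := \sum_(n <- s) c n * tm n z.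
have [NG hG] := hardy_sum s c; rewrite -/G in hG.
set A := \sum_(0 <= n < N) _; have A0 : 0 <= A by apply: sumr_ge0 => n _; exact: sqr_ge0.
(* Pairing f with its own partial expansion [G] yields the sum to be bounded. *)
have l1 : lim0 (ip f G) A%:C.
  rewrite /A rmorph_sum /=.
  have := lim0_sum s (fun n => lim0Z (conjc (c n)) (hc n)).
  rewrite [X in lim0 _ X](_ : _ = \sum_(0 <= n < N) (nc (c n) ^+ 2)%:C); last first.
    by apply: eq_bigr => n _; rewrite -conjMz mulrC.
  by apply: lim0_ext => y y0; rewrite -(ip_sum _ _ hf (fun i => hardy_tm i)).
pose E n m y := c n * (conjc (c m) * ip (tm n) (tm m) y).
have EE y : 0 < y -> ip G G y = \sum_(n < N) \sum_(m < N) E n m y.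
  move=> y0; rewrite (ip_sum _ _ hG (fun i => hardy_tm i))//.
  rewrite exchange_big /= /s big_mkord; apply: eq_bigr => m _.
  rewrite (ip_conj (hardy_tm m) hG y0) (ip_sum _ _ (hardy_tm m) (fun i => hardy_tm i))//.
  rewrite (big_morph _ (@conjcD R) (@conjc0 R)) mulr_sumr /s big_mkord; apply: eq_bigr => n _.
  by rewrite conjcM conjcK /E -(ip_conj (hardy_tm m) (hardy_tm n) y0); ring.
(* Off-diagonal terms vanish only in the limit; on each line they are an error added to pi A in the
   square norm of [G]. *)
pose off (n m : 'I_N) y := if m == n then 0 else E n m y.
have loff : lim0 (fun y => \sum_(n < N) \sum_(m < N) off n m y) 0.
  rewrite [X in lim0 _ X](_ : 0 = \sum_(n < N) \sum_(m < N) (0 : R[i])); last first.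
    by rewrite big1// => n _; rewrite big1.
  apply: lim0_sum => n; apply: lim0_sum => m; rewrite /off; case: eqP => [_|/eqP mn].
    exact: lim0_cst.
  rewrite -[X in lim0 _ X](mulr0 (c n)); apply: lim0Z.
  rewrite -[X in lim0 _ X](mulr0 (conjc (c m))); apply: lim0Z.
  by apply: ip_tm_orth; rewrite eq_sym.
have GG y : 0 < y -> nc (ip G G y) <= pi * A + nc (\sum_(n < N) \sum_(m < N) off n m y).
  move=> y0; rewrite EE//.
  have -> : \sum_(n < N) \sum_(m < N) E n m y = \sum_(n < N) E n n y +
      \sum_(n < N) \sum_(m < N) off n m y.
    rewrite -big_split; apply: eq_bigr => n _ /=.
    by rewrite (bigD1 n) //= [in RHS](bigD1 n) //= {1}/off eqxx add0r; congr (_ + _);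
      apply: eq_bigr => m /negbTE mn; rewrite /off mn.
  apply: le_trans (ncD _ _) _; rewrite lerD2r; apply: le_trans (nc_sum _ _ _) _.
  rewrite /A big_mkord mulr_sumr; apply: ler_sum => n _.
  rewrite /E !ncM nc_conj mulrA -expr2 mulrC ler_wpM2r ?sqr_ge0//.
  exact: ip_self (hardy_tm n) y0.
apply/ler_addgt0Pr => e e0; have pe0 : 0 < pi * e by exact: mulr_gt0.
have [d d0 hd] := loff _ pe0.
(* The weight 2 pi lets the square norm of [G] contribute A / 2, which is absorbed on the left;
   hence the constant 4 pi. *)
have key : nc A%:C <= 2 * pi * M + (pi * A + pi * e) / (2 * pi).
  apply: (lim0_le l1); exists d => // y /[dup] yd /andP[y0 _].
  have sG : sqint (fun x => G (x +i* y)) (pi * A + pi * e).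
    have sG0 := hG.2 y y0; have [iG _] := sqint_integrable sG0.
    apply: sqintP => //; first by case: sG0.
    have : nc (ip G G y) <= pi * A + pi * e.
      by apply: le_trans (GG y y0) _; rewrite lerD2l; have /ltW := hd y yd; rewrite subr0.
    rewrite /ip (@eq_cint _ _ _ (fun x => (nc (G (x +i* y)) ^+ 2)%:C)); last first.
      by move=> x _; rewrite -conjMz.
    by rewrite cint_real nc_real; apply: le_trans; exact: ler_norm.
  have [_] := sqint_mul (hf.2 y y0) (sqint_conj sG); apply.
  exact: mulr_gt0.
move: key; rewrite nc_real ger0_norm//.
have -> : (pi * A + pi * e) / (2 * pi) = A / 2 + e / 2.
  have p20 : 2 * pi != 0 :> R by rewrite gt_eqF// mulr_gt0.
  by apply: (mulIf p20); rewrite divfK//; field.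
lra.
Qed.

End HardyPairing.

(** * Expansion of functions of the model space in the Takenaka-Malmquist system *)

Section Expansion.
Variable R : realType.
Implicit Types (f g : R[i] -> R[i]) (x y M : R) (l z : R[i]).
Local Notation lam := (@lam R).
Local Notation BN := (@BN R).
Local Notation tm := (@tm R).

(** Christoffel-Darboux formula: the sum represents the part of the kernel that lies in the model
    space of the partial product. The induction step is the case of one factor, in which
    [lam N - conjc (lam N)] equals 2 i. *)
Lemma kern_expand N l z : - 1 < complex.Im l -> - 1 < complex.Im z -> z - conjc l != 0 ->
  kern l z = conjc (BN N l) * (BN N z * kern l z) -
    2 * 'i * \sum_(n < N) conjc (tm n l) * tm n z.
Proof.
move=> l1 z1 zl; elim: N => [|N IH].
  by rewrite /BN !big_ord0 conjc1 !mul1r mulr0 subr0.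
suff step : conjc (BN N l) * (BN N z * kern l z) =
    conjc (BN N.+1 l) * (BN N.+1 z * kern l z) - 2 * 'i * (conjc (tm N l) * tm N z).
  by rewrite {1}IH big_ord_recr /= step; ring.
rewrite !BNS /tm !conjcM /kern !conjc_inv !conjcB !conjcK !blE !conjcM conjc_inv !conjcB conjcK.
have cc : blc R N * conjc (blc R N) = 1 by rewrite conjMz nc_blc expr1n.
have h1 := lam_sub_neq N z1.
have h2 : conjc l - lam N != 0.
  by rewrite -nc_eq0 -nc_conj conjcB conjcK nc_eq0 lam_sub_neq.
have lamE : lam N - conjc (lam N) = 2 * 'i.
  by apply: eqC; rewrite !(ReD, ImD, ReN, ImN, ReM, ImM) /=; ring.
apply: (mulfI zl).
move: (lam N) (conjc (lam N)) (conjc l) (blc R N) (conjc (blc R N)) (BN N z) (conjc (BN N l)) h1 h2 zl cc lamE.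
move=> a a' l' c c' b b' h1 h2 zl cc <-.
have c0 : c != 0 by apply: contra_eqN cc => /eqP ->; rewrite mul0r eq_sym oner_eq0.
have -> : c' = c^-1 by apply: (mulfI c0); rewrite cc mulfV.
by field; rewrite c0 zl h1 h2.
Qed.

(** Pairing f with [kern_expand] leaves one term, with the partial product times the kernel.
    Replacing the partial product by B1 makes it vanish in the limit, by definition of the model
    space. The replacement error is small uniformly in y, so N can be fixed before y tends to 0. *)
Lemma expansion f M (c : nat -> R[i]) l : hardy f M -> model_space (@B1 R) f ->
  (forall n, lim0 (ip f (tm n)) (c n)) -> 0 < complex.Im l ->
  forall e : R, 0 < e -> exists N0, forall N, (N0 <= N)%N ->
  nc ((2 * pi)%:C * 'i * f l - 2 * 'i * \sum_(n < N.+1) tm n l * c n) <= e.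
Proof.
move=> hf [_ ms] hc l0 e e0.
have M0 : 0 <= M := sqint_ge0 (hf.2 1 ltr01).
have M1 : 0 < 2 * (M + 1) by rewrite mulr_gt0// ltr_wpDl.
(* The weight t and [eta] make both t M and eta / t at most e / 4. *)
pose t := e / 2 / (2 * (M + 1)).
have t0 : 0 < t by rewrite !divr_gt0.
pose eta := t * (e / 4); have eta0 : 0 < eta by rewrite mulr_gt0// divr_gt0.
have [N0 hN0] := sqint_B1_tail l0 eta0.
exists N0 => N NN0; have {}hN0 := hN0 N NN0.
have hk := hardy_kern l0.
have l1 : - 1 < complex.Im l by apply: lt_trans l0; rewrite ltrN10.
pose g z := BN N.+1 z * kern l z.
have hg : hardy g (pi / complex.Im l).
  have -> : g = (fun z => kern l z * BN N.+1 z) by apply/funext => z; exact: mulrC.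
  apply: hardyM hk _ _ => z z0; last exact: BN_le1 (ltW z0).
  by apply: cdiff_BN => m _; apply: lam_sub_neq; apply: lt_trans z0; rewrite ltrN10.
have hB : lim0 (ip f (fun z => B1 z * kern l z)) 0.
  by apply/lim0P; exact: ms (hardy_H2 hk).
have mT : measurable (setT : set (measurableTypeR R)) by exact: measurableT.
have [d d0 hd] := hB (e / 2) (divr_gt0 e0 (ltr0n _ 2)).
have gsmall : exists2 d, 0 < d & forall y, 0 < y < d -> nc (ip f g y) <= e.
  exists (Num.min d 1); first by rewrite lt_min d0 ltr01.
  move=> y /andP[y0]; rewrite lt_min => /andP[yd /ltW y1].
  have y01 : 0 < y <= 1 by rewrite y0.
  have sD := sqint_conj (hN0 y y01).
  have [iD bD] := sqint_mul (hf.2 y y0) sD.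
  have ig := ip_integrable hf hg y0.
  have E : ip f (fun z => B1 z * kern l z) y = ip f g y + cint setT
      (fun x => f (x +i* y) * conjc ((B1 (x +i* y) - BN N.+1 (x +i* y)) * (x +i* y - conjc l)^-1)).
    rewrite -cintD//; apply: eq_cint => x _.
    by rewrite -mulrDr -conjcD /g -mulrDl addrC subrK.
  have -> : ip f g y = ip f (fun z => B1 z * kern l z) y - cint setT
      (fun x => f (x +i* y) * conjc ((B1 (x +i* y) - BN N.+1 (x +i* y)) * (x +i* y - conjc l)^-1)).
    by rewrite E addrK.
  apply: le_trans (ncB _ _) _.
  have q1 : nc (ip f (fun z => B1 z * kern l z) y) <= e / 2.
    by have := hd y; rewrite subr0 y0 yd => /(_ isT)/ltW.
  have q2 := bD t t0; have q3 : eta / t = e / 4 by rewrite /eta mulrAC mulfV ?mul1r// gt_eqF.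
  have q4 : t * M <= e / 4.
    have -> : e / 4 = t * (M + 1) by rewrite /t; field; rewrite gt_eqF// ltr_wpDl.
    by rewrite ler_wpM2l ?(ltW t0)// lerDl.
  rewrite q3 in q2; lra.
pose s := index_iota 0 N.+1.
have [NG hG] := hardy_sum s (fun n => conjc (tm n l)).
have key y : 0 < y -> ip f (kern l) y = BN N.+1 l * ip f g y +
    2 * 'i * \sum_(n < N.+1) tm n l * ip f (tm n) y.
  move=> y0.
  have -> : \sum_(n < N.+1) tm n l * ip f (tm n) y =
      ip f (fun z => \sum_(n <- s) conjc (tm n l) * tm n z) y.
    rewrite (ip_sum _ _ hf (fun i => hardy_tm R i))// /s big_mkord.
    by apply: eq_bigr => n _; rewrite conjcK.
  have i1 := ip_integrable hf hg y0; have i2 := ip_integrable hf hG y0.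
  rewrite /ip -(cintZ _ mT i1) -(cintZ _ mT i2) -cintD//; try exact: cintegrableZ.
  apply: eq_cint => x _; rewrite (@kern_expand N.+1 l (x +i* y))//; first last.
  - by apply: kern_den => /=; apply: lt_trans y0; rewrite oppr_lt0.
  - by rewrite /=; apply: lt_trans y0; rewrite ltrN10.
  rewrite conjcB !conjcM !conjcK /g /s big_mkord.
  have -> : conjc 2 = 2 :> R[i] by rewrite [2](natrD _ 1 1) conjcD conjc1.
  have -> : conjc 'i = - 'i :> R[i] by apply: eqC; rewrite /= ?oppr0.
  by ring.
have lsum : lim0 (fun y => 2 * 'i * \sum_(n < N.+1) tm n l * ip f (tm n) y)
    (2 * 'i * \sum_(n < N.+1) tm n l * c n).
  by apply: lim0Z; apply: lim0_sum => n; apply: lim0Z.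
have ltot := lim0B (ip_kern_lim hf l0) lsum.
apply: (lim0_le ltot); have [d1 d10 h1] := gsmall; exists d1 => // y yd.
have /andP[y0 _] := yd; rewrite key// addrK ncM.
rewrite -[e]mul1r; apply: ler_pM; rewrite ?nc_ge0//; last exact: h1.
exact: BN_le1 (ltW l0).
Qed.

End Expansion.

(** * Boundedness of the Takenaka-Malmquist system on the extended region *)

Section Omega.
Variable R : realType.
Implicit Types (x y Y s : R) (l z : R[i]).
Local Notation lam := (@lam R).
Local Notation BN := (@BN R).
Local Notation tm := (@tm R).

Definition in_omega l := [|| 0 <= complex.Im l, complex.Im l <= - 2 | complex.Re l <= 0].

(* A discrete substitute for the integral of the Poisson kernel: s / (|s| + Y)
   is bounded by 1 and increases by a multiple of Y / (s^2 + Y^2) at each step. *)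
Lemma poisson_step s Y : 1 <= Y ->
  Y / (s ^+ 2 + Y ^+ 2) <= 8 * ((s + 1) / (`|s + 1| + Y) - s / (`|s| + Y)).
Proof.
move=> Y1; have Y0 : 0 < Y by lra.
have P0 (t : R) : 0 < t ^+ 2 + Y ^+ 2 by rewrite ltr_wpDl ?sqr_ge0// exprn_gt0.
have key t : 0 <= t -> Y / (t ^+ 2 + Y ^+ 2) <= 8 * ((t + 1) / (t + 1 + Y) - t / (t + Y)) /\
    Y / ((t + 1) ^+ 2 + Y ^+ 2) <= 8 * ((t + 1) / (t + 1 + Y) - t / (t + Y)).
  move=> t0; have a0 : 0 < t + Y by lra.
  have b0 : 0 < t + 1 + Y by lra.
  have -> : (t + 1) / (t + 1 + Y) - t / (t + Y) = Y / ((t + Y) * (t + 1 + Y)).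
    by field; rewrite !gt_eqF.
  rewrite mulrA; split; rewrite ler_pdivrMr// mulrAC ler_pdivlMr ?mulr_gt0//.
    rewrite [8 * Y]mulrC -!mulrA ler_pM2l//; nra.
  rewrite [8 * Y]mulrC -!mulrA ler_pM2l//; nra.
have [s0|s0] := leP 0 s.
  by rewrite !ger0_norm//; [exact: (key s s0).1|lra].
have [s1|s1] := leP (- 1) s; last first.
  have t0 : 0 <= - s - 1 by lra.
  have [_] := key _ t0; rewrite subrK sqrrN !ltr0_norm//; last by lra.
  move/le_trans; apply; rewrite ler_wpM2l//.
  have -> : - s / (- s + Y) = - (s / (- s + Y)) by rewrite mulNr.
  have -> : (- s - 1) = - (s + 1) by ring.
  by rewrite mulNr opprK addrC.
rewrite ger0_norm; last by lra.
rewrite ltr0_norm//.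
have a0 : 0 < s + 1 + Y by lra.
have b0 : 0 < - s + Y by lra.
have h1 : (s + 1) / (1 + Y) <= (s + 1) / (s + 1 + Y).
  by rewrite ler_wpM2l ?lef_pV2 ?posrE//; lra.
have h2 : - s / (1 + Y) <= - s / (- s + Y).
  by rewrite ler_wpM2l ?lef_pV2 ?posrE//; lra.
have h3 : (s + 1) / (1 + Y) + - s / (1 + Y) = (1 + Y)^-1.
  by rewrite -mulrDl addrAC subrr add0r mul1r.
have h4 : Y / (s ^+ 2 + Y ^+ 2) <= 8 * (1 + Y)^-1.
  rewrite ler_pdivrMr// mulrAC ler_pdivlMr; last by lra.
  have := sqr_ge0 s; nra.
rewrite mulNr in h2.
apply: le_trans h4 _; rewrite ler_wpM2l// -h3 mulNr; lra.
Qed.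

(** The steps telescope to a difference of two values of [g] in [-1, 1], whence 16 = 8 * 2. *)
Lemma poisson_sum x Y N : 1 <= Y ->
  \sum_(n < N) Y / ((n.+1%:R - x) ^+ 2 + Y ^+ 2) <= 16.
Proof.
move=> Y1; pose g (t : R) := t / (`|t| + Y).
have g1 t : `|g t| <= 1.
  have d0 : 0 < `|t| + Y by rewrite ltr_wpDl//; lra.
  by rewrite /g normrM normfV [`| _ + _|]gtr0_norm// ler_pdivrMr// mul1r lerDl; lra.
suff h : \sum_(n < N) Y / ((n.+1%:R - x) ^+ 2 + Y ^+ 2) <= 8 * (g (N.+1%:R - x) - g (1 - x)).
  apply: le_trans h _; have := g1 (N.+1%:R - x); have := g1 (1 - x).
  rewrite !ler_norml => /andP[? ?] /andP[? ?]; lra.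
elim: N => [|N IH]; first by rewrite big_ord0 subrr mulr0.
rewrite big_ord_recr /=; apply: le_trans (lerD IH (poisson_step _ Y1)) _.
have -> : N.+1%:R - x + 1 = N.+2%:R - x by rewrite -[N.+2]addn1 natrD; ring.
by rewrite -/(g _) -/(g _); lra.
Qed.

(** One scale Y that compares the distances to all poles, and the excess of all |b_n|^2 over 1, with
    Poisson kernels of height Y. The three pieces of the region differ only in the choice of Y. *)
Definition omega_scale l Y := 1 <= Y /\ forall n,
  ((n.+1%:R - complex.Re l) ^+ 2 + Y ^+ 2) / 2 <= nc (l - conjc (lam n)) ^+ 2 /\
  nc (bl n l) ^+ 2 <= 1 + 16 * (Y / ((n.+1%:R - complex.Re l) ^+ 2 + Y ^+ 2)).

Lemma omega_scale_exists l : in_omega l -> exists Y, omega_scale l Y.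
Proof.
case: l => x y; rewrite /in_omega /= => h.
have den n : nc (x +i* y - conjc (lam n)) ^+ 2 = (n.+1%:R - x) ^+ 2 + (y + 1) ^+ 2.
  by rewrite nc_sq !(ReD, ImD, ReN, ImN) /=; ring.
have num n : nc (x +i* y - lam n) ^+ 2 = (n.+1%:R - x) ^+ 2 + (y - 1) ^+ 2.
  by rewrite nc_sq !(ReD, ImD, ReN, ImN) /=; ring.
have bE n : nc (bl n (x +i* y)) ^+ 2 = ((n.+1%:R - x) ^+ 2 + (y - 1) ^+ 2) / ((n.+1%:R - x) ^+ 2 + (y + 1) ^+ 2).
  by rewrite blE ncM nc_blc mul1r ncM ncV exprMn exprVn den num.
have sq n : 0 <= (n.+1%:R - x) ^+ 2 := sqr_ge0 _.
have q0 n Y : 1 <= Y -> 0 <= Y / ((n.+1%:R - x) ^+ 2 + Y ^+ 2).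
  by move=> Y1; rewrite divr_ge0 ?addr_ge0 ?sqr_ge0//; lra.
have [y0|y0] := leP 0 y.
  exists (y + 1); split=> [|n]; first by lra.
  rewrite den /=; split.
    by have := sq n; have := sqr_ge0 (y + 1); lra.
  apply: le_trans (_ : 1 <= _); last by rewrite lerDl mulr_ge0// q0//; lra.
  by rewrite exprn_ile1 ?nc_ge0// bl_le1.
have [y2|y2] := leP y (- 2).
  exists (- y - 1); split=> [|n]; first by lra.
  have yE : (- y - 1) ^+ 2 = (y + 1) ^+ 2 by ring.
  rewrite bE den /= yE.
  have P0 : 0 < (n.+1%:R - x) ^+ 2 + (y + 1) ^+ 2.
    by rewrite ltr_wpDl ?sq// -yE exprn_gt0//; lra.
  split; first by lra.
  rewrite ler_pdivrMr// mulrDl mul1r -mulrA divfK ?gt_eqF//.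
  have -> : (y - 1) ^+ 2 = (y + 1) ^+ 2 - 4 * y by ring.
  lra.
have x0 : x <= 0 by move: h; rewrite !leNgt y0 y2.
(* Here Re l <= 0 and - 2 < Im l < 0: the horizontal distance to each pole is at least 1, although
   the vertical one may be 0. *)
exists 1; split=> // n; rewrite bE den /=.
have n1 : 1 <= n.+1%:R :> R by rewrite ler1n.
have P1 : 1 <= (n.+1%:R - x) ^+ 2 by rewrite -(expr1n _ 2) ler_pXn2r ?nnegrE//; lra.
have P2 := sqr_ge0 (y + 1).
have P0 : 0 < (n.+1%:R - x) ^+ 2 + (y + 1) ^+ 2 by lra.
split; first by rewrite expr1n; lra.
have h2 : (2 * ((n.+1%:R - x) ^+ 2 + (y + 1) ^+ 2))^-1 <= 1 / ((n.+1%:R - x) ^+ 2 + 1 ^+ 2).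
  by rewrite mul1r expr1n lef_pV2 ?posrE; lra.
have -> : ((n.+1%:R - x) ^+ 2 + (y - 1) ^+ 2) / ((n.+1%:R - x) ^+ 2 + (y + 1) ^+ 2) =
   1 + (- 8 * y) * (2 * ((n.+1%:R - x) ^+ 2 + (y + 1) ^+ 2))^-1.
  have -> : (y - 1) ^+ 2 = (y + 1) ^+ 2 - 4 * y by ring.
  rewrite addrA mulrBl mulfV ?gt_eqF// invfM; lra.
rewrite lerD2l; apply: le_trans (_ : 16 * (2 * ((n.+1%:R - x) ^+ 2 + (y + 1) ^+ 2))^-1 <= _).
  by rewrite ler_wpM2r// ?invr_ge0; lra.
by apply: ler_wpM2l; [lra|exact: h2].
Qed.

(** 256 is the coefficient 16 of [omega_scale] times the bound 16 of [poisson_sum], and 32 is 16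
    again times the 2 lost in the distances. *)
Definition COmega : R := 32 * expR 256.

Lemma COmega_ge0 : 0 <= COmega.
Proof. by apply: mulr_ge0; [exact: ler0n|exact: expR_ge0]. Qed.

Lemma BN_omega l Y N : omega_scale l Y -> nc (BN N l) ^+ 2 <= expR 256.
Proof.
move=> [Y1 hY].
have h : nc (BN N l) ^+ 2 <= expR (16 * \sum_(n < N) Y / ((n.+1%:R - complex.Re l) ^+ 2 + Y ^+ 2)).
  elim: N => [|N IH]; first by rewrite /BN big_ord0 nc1 expr1n big_ord0 mulr0 expR0.
  rewrite BNS ncM exprMn big_ord_recr /= mulrDr expRD; apply: ler_pM; rewrite ?exprn_ge0 ?nc_ge0//.
  by apply: le_trans (hY N).2 _; exact: expR_ge1Dx.
apply: le_trans h _; rewrite ler_expR.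
by have := poisson_sum (complex.Re l) N Y1; lra.
Qed.

Lemma tm_omega l N : in_omega l -> \sum_(n < N) nc (tm n l) ^+ 2 <= COmega.
Proof.
move=> /omega_scale_exists[Y hY]; have [Y1 h] := hY.
apply: (@le_trans _ _ (\sum_(n < N) 2 * expR 256 * (Y / ((n.+1%:R - complex.Re l) ^+ 2 + Y ^+ 2)))).
  apply: ler_sum => n _; rewrite /tm /kern ncM ncV exprMn exprVn.
  have P0 : 0 < (n.+1%:R - complex.Re l) ^+ 2 + Y ^+ 2.
    by rewrite ltr_wpDl ?sqr_ge0// exprn_gt0//; lra.
  have [h1 _] := h n.
  have -> : 2 * expR 256 * (Y / ((n.+1%:R - complex.Re l) ^+ 2 + Y ^+ 2)) =
    expR 256 * (Y * (2 / ((n.+1%:R - complex.Re l) ^+ 2 + Y ^+ 2))) by ring.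
  apply: ler_pM; rewrite ?invr_ge0 ?exprn_ge0 ?nc_ge0//; first exact: BN_omega hY.
  apply: le_trans (_ : 2 / ((n.+1%:R - complex.Re l) ^+ 2 + Y ^+ 2) <= _); last first.
    by rewrite ler_peMl// divr_ge0// ltW.
  rewrite -[2 / _]invrK invf_div lef_pV2 ?posrE ?divr_gt0//.
  by apply: lt_le_trans h1; rewrite divr_gt0.
rewrite -mulr_sumr /COmega.
have := poisson_sum (complex.Re l) N Y1; have := expR_gt0 (256 : R); nra.
Qed.

End Omega.

(** * Tails of convergent series, and continuity of uniform limits *)

Section TailSequence.
Variable R : realType.

(** Square roots of the tails, enlarged by 1 / (N + 1) before taking the root to make them positive,
    since they serve as weights t and 1 / t. *)
Lemma tail_sequence (a : nat -> R) (A : R) : (forall n, 0 <= a n) ->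
  (forall N, \sum_(0 <= n < N) a n <= A) ->
  exists t : nat -> R, [/\ forall N, 0 < t N,
    forall e : R, 0 < e -> exists N, forall M, (N <= M)%N -> t M < e &
    forall N M, (N <= M)%N -> \sum_(N <= n < M) a n <= t N ^+ 2].
Proof.
move=> a0 aA; pose E : set R := range (fun N => \sum_(0 <= n < N) a n).
have supE : has_sup E.
  split; first by exists (\sum_(0 <= n < 0) a n); exists 0.
  by exists A => _ [N _ <-].
have ub N : \sum_(0 <= n < N) a n <= sup E by apply: ub_le_sup; [exact: supE.2|exists N].
pose r N := sup E - \sum_(0 <= n < N) a n + N.+1%:R^-1.
have r0 N : 0 < r N by rewrite ltr_wpDl ?subr_ge0// invr_gt0 ltr0n.
exists (fun N => Num.sqrt (r N)); split => [N|e e0|N M NM].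
- by rewrite sqrtr_gt0.
- have e2 : 0 < e ^+ 2 / 2 by rewrite divr_gt0// exprn_gt0.
  have [_ [N1 _ <-] h1] := sup_adherent e2 supE.
  pose N2 := Num.trunc (e ^+ 2 / 2)^-1.
  have h2 : (e ^+ 2 / 2)^-1 < N2.+1%:R by exact: truncnS_gt.
  exists (maxn N1 N2) => M; rewrite geq_max => /andP[NM1 NM2].
  rewrite -[e]gtr0_norm// -sqrtr_sqr ltr_sqrt ?exprn_gt0//.
  have h3 : \sum_(0 <= n < N1) a n <= \sum_(0 <= n < M) a n.
    rewrite [leRHS](@big_cat_nat _ _ _ N1)//= lerDl; exact: sumr_ge0.
  have h4 : M.+1%:R^-1 < e ^+ 2 / 2.
    by rewrite invf_plt ?posrE ?ltr0n//; apply: lt_le_trans h2 _; rewrite ler_nat ltnS.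
  move: h1 => /= h1; rewrite /r.
  have aux (p q s u v : R) : p - v / 2 < q -> q <= s -> u < v / 2 -> p - s + u < v by lra.
  exact: aux h1 h3 h4.
- rewrite sqr_sqrtr ?(ltW (r0 N))//.
  have h1 := ub M; rewrite (@big_cat_nat _ _ _ N)//= in h1.
  have h2 : 0 <= N.+1%:R^-1 :> R by rewrite invr_ge0 ler0n.
  have aux (p q s u : R) : q + s <= p -> 0 <= u -> s <= p - q + u by lra.
  exact: aux h1 h2.
Qed.

Lemma approx_cont (K : R[i] -> Prop) h z : approx_on K h -> K z ->
  forall e : R, 0 < e -> exists2 d : R, 0 < d &
    forall w, K w -> nc (w - z) < d -> nc (h w - h z) < e.
Proof.
move=> ah Kz e e0; have e4 : 0 < e / 4 by rewrite divr_gt0.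
have [g dg gh] := ah _ e4; have [d d0 hd] := cdiff_cont (dg z Kz) e4.
exists d => // w Kw /hd h1.
have -> : h w - h z = (g z - h z) - (g w - h w) + (g w - g z) by ring.
have h2 := gh _ Kz; have h3 := gh _ Kw.
apply: le_lt_trans (ncD _ _) _; have := ncB (g z - h z) (g w - h w); lra.
Qed.

End TailSequence.

(** * Bounded continuation of functions of the model space *)

Section Continuation.
Variable R : realType.
Implicit Types (x y M : R) (l z : R[i]).
Local Notation lam := (@lam R).
Local Notation BN := (@BN R).
Local Notation tm := (@tm R).

Lemma omega_den l n : in_omega l -> l - conjc (lam n) != 0.
Proof.
move=> /omega_scale_exists[Y [Y1 h]]; rewrite -nc_gt0.
rewrite lt_neqAle nc_ge0 andbT eq_sym; apply/negP => /eqP E.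
have [] := h n; rewrite E expr0n /= => h0 _.
have := sqr_ge0 (n.+1%:R - complex.Re l); have : 0 < Y ^+ 2 by rewrite exprn_gt0//; lra.
lra.
Qed.

Lemma cdiff_tm_omega n l : in_omega l -> cdiff (tm n) l.
Proof.
move=> lo; apply: cdiffM.
  by apply: cdiff_BN => m _; exact: omega_den.
apply: cdiffV; last exact: omega_den.
by apply: cdiffB; [exact: cdiff_id|exact: cdiff_cst].
Qed.

(** With the weight t matched to the tail of the coefficients, the bound is proportional to t and
    uniform over the region. *)
Lemma cauchy_schwarz_tm (c : nat -> R[i]) l (N M : nat) (t : R) : in_omega l -> (N <= M)%N -> 0 < t ->
  \sum_(N <= n < M) nc (c n) ^+ 2 <= t ^+ 2 ->
  nc (\sum_(N <= n < M) tm n l * c n) <= t * (1 + COmega R).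
Proof.
move=> lo NM t0 hc; apply: le_trans (nc_sum _ _ _) _.
apply: (@le_trans _ _ (\sum_(N <= n < M) (t * nc (tm n l) ^+ 2 + t^-1 * nc (c n) ^+ 2))).
  apply: ler_sum => n _; rewrite ncM.
  have -> : t * nc (tm n l) ^+ 2 + t^-1 * nc (c n) ^+ 2 =
      t^-1 * ((t * nc (tm n l) - nc (c n)) ^+ 2 + t * nc (tm n l) * nc (c n)) + nc (tm n l) * nc (c n).
    by field; rewrite gt_eqF.
  rewrite lerDr mulr_ge0 ?invr_ge0 ?(ltW t0)// addr_ge0 ?sqr_ge0//.
  by rewrite !mulr_ge0 ?nc_ge0// ltW.
rewrite big_split /= -!mulr_sumr mulrDr mulr1 addrC; apply: lerD.
  by rewrite ler_pdivrMl// -expr2.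
rewrite ler_wpM2l ?(ltW t0)//; apply: le_trans (tm_omega M lo).
rewrite -(big_mkord xpredT (fun n => nc (tm n l) ^+ 2)) [leRHS](@big_cat_nat _ _ _ N)//= lerDr.
by apply: sumr_ge0 => n _; rewrite exprn_ge0// nc_ge0.
Qed.

(** Bessel's inequality and [tm_omega] make the partial sums uniformly Cauchy on the whole region.
    They are differentiable there, which is all that [approx_on] records about the limit. *)
Lemma model_space_continuation f : model_space (@B1 R) f -> exists F,
  [/\ forall l, 0 < complex.Im l -> F l = f l,
      exists2 S : R, 0 < S & forall l, in_omega l -> nc (F l) <= S &
      approx_on (fun l => in_omega l) F].
Proof.
move=> mf; have [M hf] := H2_hardy mf.1.
have [c hc] := choice (fun n => ip_tm_lim n hf).
have [|t [t0 tlim tS]] := tail_sequence (a := fun n => nc (c n) ^+ 2) _ (fun N => bessel N hf hc).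
  by move=> n; rewrite exprn_ge0// nc_ge0.
have C1 : 1 <= 1 + COmega R by rewrite lerDl; exact: COmega_ge0.
have C0 : 0 < 1 + COmega R by lra.
have p1 : 1 <= pi :> R by have := pi_ge2 R; lra.
have p0 : 0 < pi :> R by lra.
(* The factor 1 / pi makes up for the square norm of [tm n]. *)
pose FN N l := (pi^-1)%:C * \sum_(0 <= n < N) tm n l * c n : R[i].
pose d N := t N * (1 + COmega R).
have d0 N : 0 < d N by rewrite mulr_gt0.
have dlim (e : R) : 0 < e -> exists N, d N < e.
  by move=> e0; have [N hN] := tlim _ (divr_gt0 e0 C0); exists N; rewrite /d -ltr_pdivlMr// hN.
have FC l : in_omega l -> forall N K, (N <= K)%N -> nc (FN K l - FN N l) <= d N.
  move=> lo N K NK; rewrite /FN (@big_cat_nat _ _ _ N 0 K)//= mulrDr addrAC subrr add0r ncM nc_real.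
  rewrite ger0_norm ?invr_ge0 ?(ltW p0)// -[leRHS]mul1r; apply: ler_pM; rewrite ?nc_ge0 ?invr_ge0 ?(ltW p0)//.
    by rewrite invf_le1.
  exact: (cauchy_schwarz_tm lo NK (t0 N) (tS _ _ NK)).
have [F hF] : {F : R[i] -> R[i] & forall l, in_omega l -> forall N, nc (FN N l - F l) <= d N}.
  apply: (@choice _ _ (fun l v => in_omega l -> forall N, nc (FN N l - v) <= d N)) => l.
  case: (boolP (in_omega l)) => [lo|_]; last by exists 0.
  by have [v hv] := complex_cauchy dlim (FC l lo); exists v.
exists F; split.
- move=> l l0; have lo : in_omega l by rewrite /in_omega (ltW l0).
  apply/eqP; rewrite -subr_eq0; apply/eqP/nc_small => e e0.
  have e2 : 0 < e / 2 by rewrite divr_gt0.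
  have [N0 hN0] := expansion hf mf hc l0 e2; have e4 : 0 < e / 4 by rewrite divr_gt0.
  have [N1 hN1] := dlim _ e4.
  have h1 := hN0 (maxn N0 N1) (leq_maxl _ _); set K := (maxn N0 N1).+1 in h1.
  have NK : (N1 <= K)%N by rewrite /K leqW// leq_maxr.
  have h2 : nc (FN K l - f l) <= e / 2.
    apply: le_trans h1.
    have -> : (2 * pi)%:C * 'i * f l - 2 * 'i * (\sum_(n < K) tm n l * c n) =
        (2 * pi)%:C * 'i * (f l - FN K l).
      rewrite /FN big_mkord mulrBr; congr (_ - _).
      have -> : (2 * pi)%:C = 2 * pi%:C :> R[i] by apply: eqC; rewrite /=; ring.
      have pp : pi%:C * (pi^-1)%:C = 1 :> R[i].
        by rewrite -rmorphM mulfV ?gt_eqF// rmorph1.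
      have -> : forall u, 2 * pi%:C * 'i * ((pi^-1)%:C * u) = (pi%:C * (pi^-1)%:C) * (2 * 'i * u) :> R[i].
        by move=> u; ring.
      by rewrite pp mul1r.
    rewrite !ncM nc_dist nc_real ger0_norm ?mulr_ge0 ?(ltW p0)//.
    have -> : nc ('i : R[i]) = 1 by rewrite (nc_imag 1) normr1.
    by rewrite mulr1 ler_peMl ?nc_ge0//; lra.
  have h3 := hF l lo N1; have h4 := FC l lo N1 K NK.
  have -> : F l - f l = (FN K l - f l) - (FN K l - FN N1 l) - (FN N1 l - F l) by ring.
  apply: le_trans (ncB _ _) _.
  by have := ncB (FN K l - f l) (FN K l - FN N1 l); lra.
- exists (d 0%N) => // l lo; have := hF l lo 0%N.
  by rewrite /FN big_geq// mulr0 sub0r ncN.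
- move=> e e0; have [N hN] := dlim _ e0; exists (FN N) => l lo; last first.
    exact: le_trans (hF l lo N) (ltW hN).
  apply: cdiffM; first exact: cdiff_cst.
  apply: cdiff_sum => n _; apply: cdiffM; last exact: cdiff_cst.
  exact: cdiff_tm_omega.
Qed.

End Continuation.

(** * A quantitative identity principle in discs and in the half-plane *)

Section Identity.
Variable R : realType.
Implicit Types (f h : R[i] -> R[i]) (x y Y S r : R) (z w : R[i]).

(* On the annulus of centre c the function f (z) / (z - c)^n vanishes near the inner
   circle and is at most S / r^n on the outer one. *)
Lemma vanish_disc f c S r : 0 <= S -> 1 < r ->
  (forall z, nc (z - c) <= r -> cdiff f z) -> (forall z, nc (z - c) <= r -> nc (f z) <= S) ->
  (forall z, nc (z - c) < 1 -> f z = 0) -> forall z, nc (z - c) < r -> f z = 0.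
Proof.
move=> S0 r1 df fS f0 z zr; have r0 : 0 < r by lra.
have [z1|z1] := ltP (nc (z - c)) 1; first exact: f0.
pose K w := 1 / 2 <= nc (w - c) <= r.
have zc0 : 0 < nc (z - c) by lra.
have neq w : 1 / 2 <= nc (w - c) -> w - c != 0 by rewrite -nc_gt0; lra.
have cK : ccompact K.
  split.
    move=> w hw; apply/andP; split; apply/ler_addgt0Pr => e e0; have [v /andP[v1 v2] vw] := hw e e0.
      have := ncD (w - c) (v - w); have -> : w - c + (v - w) = v - c by ring.
      lra.
    have := ncB (v - c) (v - w); have -> : v - c - (v - w) = w - c by ring.
    lra.
  exists (r + nc c) => w /andP[_ w2]; have := ncD (w - c) c; rewrite subrK; lra.
have bd n : nc (f z) <= S * (nc (z - c) / r) ^+ n.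
  have M0 : 0 <= S / r ^+ n by rewrite divr_ge0// exprn_ge0// ltW.
  have := @max_modulus R K (fun w => f w * (w - c)^-1 ^+ n) _ cK M0.
  have zK : K z by apply/andP; split; lra.
  move=> /(_ _ _ z zK) h; have {h} : nc (f z * (z - c)^-1 ^+ n) <= S / r ^+ n.
    apply: h => w /andP[w1 w2].
      apply: cdiffM; first exact: df.
      apply: cdiffX; apply: cdiffV; last exact: neq.
      by apply: cdiffB; [exact: cdiff_id|exact: cdiff_cst].
    have [w3|w3] := ltP (nc (w - c)) 1.
      by left; rewrite f0// mul0r nc0.
    have [w4|w4] := ltP (nc (w - c)) r; last first.
      left; have wr : nc (w - c) = r by apply/eqP; rewrite eq_le w2 w4.
      rewrite ncM ncX ncV wr -exprVn; apply: ler_wpM2r; last exact: fS.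
      by rewrite exprn_ge0// invr_ge0 ltW.
    right; exists (Num.min (1 / 2) (r - nc (w - c))); first by rewrite lt_min; lra.
    move=> v; rewrite le_min => /andP[v1 v2]; apply/andP; split.
      have := ncB (v - c) (v - w); have -> : v - c - (v - w) = w - c by ring.
      lra.
    have := ncD (w - c) (v - w); have -> : w - c + (v - w) = v - c by ring.
    lra.
  rewrite ncM ncX ncV -exprVn => h.
  rewrite exprMn mulrCA mulrC -ler_pdivrMr ?exprn_gt0// -exprVn; exact: h.
apply: nc_small => e e0.
have q1 : `|nc (z - c) / r| < 1.
  by rewrite ger0_norm ?divr_ge0 ?nc_ge0 ?(ltW r0)// ltr_pdivrMr// mul1r.
have /cvgrPdist_lt/(_ e e0) := cvg_geometric S q1.
move=> [n _ hn]; have := hn n (leqnn n); rewrite /geometric /= sub0r normrN => h.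
exact: le_trans (bd n) (le_trans (ler_norm _) (ltW h)).
Qed.

(** No chain of discs is needed: a single disc, centred high on the imaginary axis, contains the
    given point and has its unit core inside the half-strip. *)
Lemma half_plane_vanish f S : (forall z, 0 < complex.Im z -> cdiff f z) ->
  (forall z, 0 < complex.Im z -> nc (f z) <= S) ->
  (forall z, `|complex.Re z| < 1 -> 3 < complex.Im z -> f z = 0) ->
  forall z, 0 < complex.Im z -> f z = 0.
Proof.
move=> df fS f0 [x y] /= y0.
have S0 : 0 <= S := le_trans (nc_ge0 _) (fS ('i) ltr01).
(* The distance from x + i y to i Y is below Y - y / 2 because x^2 + y^2 < Y y; the 6 keeps the unit
   disc about i Y above height 3. *)
pose Y := (x ^+ 2 + y ^+ 2) / y + y + 6.
have q0 : 0 <= (x ^+ 2 + y ^+ 2) / y by rewrite divr_ge0 ?addr_ge0 ?sqr_ge0// ltW.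
have Y6 : y + 6 <= Y by rewrite /Y; lra.
have YE : x ^+ 2 + y ^+ 2 < Y * y.
  rewrite /Y [X in _ < X]mulrDl [X in _ < X + _]mulrDl divfK ?gt_eqF//.
  have := mulr_gt0 y0 y0; lra.
pose c : R[i] := 0 +i* Y; pose r := Y - y / 2.
have up z : nc (z - c) <= r -> 0 < complex.Im z.
  move=> zr; have := nc_Im (z - c); rewrite ImD ImN /= ler_norml => /andP[h1 _].
  move: zr h1; rewrite /r; lra.
apply: (@vanish_disc f c S r) => //.
- by rewrite /r; lra.
- by move=> z /up; exact: df.
- by move=> z /up; exact: fS.
- move=> z z1; apply: f0.
    have := nc_Re (z - c); rewrite ReD ReN /= subr0; lra.
  have := nc_Im (z - c); rewrite ImD ImN /= ler_norml => /andP[h1 _]; lra.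
- have r0 : 0 <= r by rewrite /r; lra.
  rewrite -(ltr_pXn2r (n := 2))// ?nnegrE ?nc_ge0// nc_sq !(ReD, ReN) !(ImD, ImN) /= /r subr0; nra.
Qed.

End Identity.

(** * Majorants that decay too fast are not admissible *)

Section NotAdmissible.
Variable R : realType.
Implicit Types (f h F : R[i] -> R[i]) (x y Y S r t : R) (z w l : R[i]).

(** This shapes [in_omega]: for u = s + i t with s >= 1, its three pieces answer to t <= 0, t >= 1
    and 0 < t < 1. *)
Lemma neg_sqr_omega (u : R[i]) : 1 <= complex.Re u -> in_omega (- u ^+ 2).
Proof.
case: u => s t /= s1; rewrite /in_omega ReN ImN expr2 ReM ImM /=.
have [t0|t0] := leP t 0; first by apply/or3P/Or31; nra.
have [ts|ts] := leP 1 t; first by apply/or3P/Or32; nra.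
by apply/or3P/Or33; nra.
Qed.

(** Supplies the half-strip on which f is known to vanish once F (- u^2) does. The real part of the
    root has square (|z| - Re z) / 2, which exceeds 1 at these heights. *)
Lemma neg_sqr_root z : `|complex.Re z| < 1 -> 3 < complex.Im z ->
  exists2 u : R[i], 1 < complex.Re u & - u ^+ 2 = z.
Proof.
case: z => x y /=; rewrite ltr_norml => /andP[x1 x2] y3.
pose s := Num.sqrt (x ^+ 2 + y ^+ 2).
have s2 : s ^+ 2 = x ^+ 2 + y ^+ 2 by rewrite sqr_sqrtr// addr_ge0 ?sqr_ge0.
have s0 : 0 <= s := sqrtr_ge0 _.
have sx : 2 + x < s by nra.
pose p := (s - x) / 2; have p1 : 1 < p by rewrite /p; lra.
have p0 : 0 < p by lra.
have qp : Num.sqrt p ^+ 2 = p by rewrite sqr_sqrtr// ltW.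
have q1 : 1 < Num.sqrt p by rewrite -[ltLHS]sqrtr1 ltr_sqrt.
have q0 : Num.sqrt p != 0 by rewrite gt_eqF//; lra.
exists (Num.sqrt p -i* (y / (2 * Num.sqrt p))) => //.
apply: eqC; rewrite ?ReN ?ImN expr2 ?ReM ?ImM /=.
  have -> : - (Num.sqrt p * Num.sqrt p - - (y / (2 * Num.sqrt p)) * - (y / (2 * Num.sqrt p))) =
    y ^+ 2 / (4 * Num.sqrt p ^+ 2) - Num.sqrt p ^+ 2 by field.
  rewrite qp; have : y ^+ 2 = 4 * p * (p + x).
    have -> : 4 * p * (p + x) = s ^+ 2 - x ^+ 2 by rewrite /p; field.
    by rewrite s2; ring.
  by move=> ->; field; rewrite gt_eqF.
by field.
Qed.

Lemma itv_ae_point (P : R -> Prop) (a b : R) : a < b ->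
  {ae @lebesgue_measure R, forall x, P x} -> exists2 x, a < x < b & P x.
Proof.
move=> ab [A [mA A0 PA]]; apply: contrapT => h.
have sub : `]a, b[ `<=` A.
  move=> x; rewrite /= in_itv /= => xab; apply: PA => /= Px; apply: h; by exists x.
have : (lebesgue_measure (`]a, b[%classic : set R) <= lebesgue_measure A)%E.
  by apply: le_measure => //; rewrite inE //; exact: measurable_itv.
rewrite A0 lebesgue_measure_itv /= lte_fin ab.
by rewrite -EFinB lee_fin; lra.
Qed.

(** The alternative w = 0 stands for Omega = +oo, where - ln w would not be meaningful. *)
Lemma sqrt_decay_majorant (w eps x : R) : 0 < eps -> 0 <= w ->
  w = 0 \/ Num.sqrt x <= eps * (- ln w) -> w <= expR (- (Num.sqrt x / eps)).
Proof.
move=> e0 w0 [->|h]; first exact: expR_ge0.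
move: w0; rewrite le_eqVlt => /orP[/eqP<-|w0]; first exact: expR_ge0.
rewrite -[leLHS]lnK ?posrE// ler_expR.
have : Num.sqrt x / eps <= - ln w by rewrite ler_pdivrMr// mulrC.
lra.
Qed.

(** Along real u the majorant hypothesis reads |F (- u^2)| <= exp (- N u) for every N and large u.
    It is available almost everywhere only, and continuity of F extends it to all points. *)
Lemma continuation_decay F (w : R -> R) S : 0 < S ->
  (forall l, in_omega l -> nc (F l) <= S) -> approx_on (fun l => in_omega l) F ->
  (forall t, t <= 0 -> 0 <= w t) ->
  (forall eps : R, 0 < eps ->
     \forall t \near -oo, w t = 0 \/ Num.sqrt `|t| <= eps * (- ln (w t))) ->
  {ae @lebesgue_measure R, forall t, t < 0 -> nc (F t%:C) <= w t} ->
  forall u : R[i], 1 < complex.Re u -> F (- u ^+ 2) = 0.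
Proof.
move=> S0 FS aF w0 hw hae; apply: (@pl_zero _ S S0); split.
- move=> e e0; have [g dg gF] := aF e e0; exists (fun u => g (- u ^+ 2)) => u u1.
    apply: (@cdiff_comp _ (fun v => - v ^+ 2) g); last exact: dg (neg_sqr_omega u1).
    by apply: cdiffN; apply: cdiffX; exact: cdiff_id.
  exact: gF (neg_sqr_omega u1).
- by move=> u /neg_sqr_omega; exact: FS.
move=> N N0; have Ni : 0 < N^-1 by rewrite invr_gt0.
have [T [_ hT]] := hw _ Ni.
(* Up to X the bound S is enough; beyond it every t < - x^2 lies where the majorant obeys the
   hypothesis with eps = 1 / N. *)
pose X := Num.max 1 (Num.sqrt `|T|).
exists (Num.max 1 (S * expR (N * X))); first by rewrite le_max ler01.
move=> x x1; have x0 : 0 <= x by lra.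
have xo : in_omega (- x%:C ^+ 2) by apply: neg_sqr_omega.
have xE : - x%:C ^+ 2 = (- x ^+ 2)%:C :> R[i] by rewrite rmorphN rmorphXn.
have [xX|xX] := leP x X.
  rewrite le_max; apply/orP; right; apply: ler_pM; rewrite ?nc_ge0 ?expR_ge0 ?FS//.
  by rewrite ler_expR ler_wpM2l// ltW.
rewrite le_max; apply/orP; left; rewrite -ler_pdivlMr ?expR_gt0// div1r -expRN.
(* A point t slightly to the left of - x^2 where the almost everywhere bound holds; moving left only
   improves the bound. *)
apply/ler_addgt0Pr => e e0; have [d d0 hd] := approx_cont aF xo e0.
have ab : - x ^+ 2 - d < - x ^+ 2 by lra.
have [t /andP[t1 t2] Pt] := itv_ae_point ab hae.
have xx : 0 <= x ^+ 2 := sqr_ge0 _.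
have t0 : t < 0 by lra.
have h1 := Pt t0.
have tT : t < T.
  move: xX; rewrite gt_max => /andP[_ h].
  have : `|T| < x ^+ 2.
    by rewrite -(sqr_sqrtr (normr_ge0 T)) ltr_pXn2r// nnegrE sqrtr_ge0.
  have := ler_norm (- T); rewrite normrN; lra.
have h2 := sqrt_decay_majorant Ni (w0 t (ltW t0)) (hT t tT).
have h3 : x <= Num.sqrt `|t|.
  rewrite -[x]ger0_norm// -sqrtr_sqr ler_sqrt// ltr0_norm//; lra.
have h4 : w t <= expR (- (N * x)).
  apply: le_trans h2 _; rewrite ler_expR lerN2 invrK mulrC ler_wpM2r// ltW//.
have to : in_omega t%:C by rewrite /in_omega /= lexx.
have h5 := hd t%:C to; rewrite xE -rmorphB (nc_real (t - - x ^+ 2)) in h5.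
have {h5}: nc (F t%:C - F (- x ^+ 2)%:C) < e.
  apply: h5; rewrite ltr_norml; apply/andP; split; lra.
rewrite xE nc_dist => h5; have := ncBD (F (- x ^+ 2)%:C) (F t%:C); lra.
Qed.

Lemma not_admissible (w : R -> R) :
  (forall t, t <= 0 -> 0 <= w t) ->
  (forall eps : R, 0 < eps ->
     \forall t \near -oo, w t = 0 \/ Num.sqrt `|t| <= eps * (- ln (w t))) ->
  ~ Adm_minus (@B1 R) w.
Proof.
move=> w0 hw [f [mf [z [z0 /eqP fz]] hae]]; apply: fz.
have [F [Ff [S S0 FS] aF]] := model_space_continuation mf.
(* F is continuous up to the real axis, so its values there are the boundary values of f. *)
have {}hae : {ae @lebesgue_measure R, forall t, t < 0 -> nc (F t%:C) <= w t}.
  case: hae => A [mA A0 hA]; exists A; split=> // t nt; apply: hA => ht.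
  apply: nt => t0; have [c [/lim0P bv cw]] := ht t0.
  suff -> : F t%:C = c by [].
  apply: lim0_uniq bv => e e0.
  have to : in_omega t%:C by rewrite /in_omega /= lexx.
  have [d d0 hd] := approx_cont aF to e0; exists d => // y /andP[y0 yd].
  rewrite -Ff//; apply: hd; first by rewrite /in_omega /= (ltW y0).
  have -> : t +i* y - t%:C = 0 +i* y by apply: eqC; rewrite /=; ring.
  by rewrite nc_imag gtr0_norm.
have F0 := continuation_decay S0 FS aF w0 hw hae.
apply: (@half_plane_vanish _ f S) z0 => [v v0|v v0|v v1 v2].
- by have [M hf] := H2_hardy mf.1; exact: hf.1.
- by rewrite -Ff// FS// /in_omega (ltW v0).
- have [u u1 E] := neg_sqr_root v1 v2; rewrite -Ff; last by lra.
  by rewrite -E F0.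
Qed.

End NotAdmissible.

(** * Growth and repeated differences of the coefficients of exp (- a s / (1 - s)) *)

Section Laguerre.
Variable R : realType.
Implicit Types (u : nat -> R) (s x C : R).

Definition backdiff u n : R := u n - (if n is m.+1 then u m else 0).

Lemma backdiffS u n : backdiff u n.+1 = u n.+1 - u n. Proof. by []. Qed.

Lemma sum_backdiff u s N :
  \sum_(n < N.+1) backdiff u n * s ^+ n = (1 - s) * \sum_(n < N.+1) u n * s ^+ n + u N * s ^+ N.+1.
Proof.
elim: N => [|N IH].
  by rewrite !big_ord_recr !big_ord0 /= /backdiff; ring.
by rewrite big_ord_recr IH /= backdiffS [in RHS]big_ord_recr /= !exprS; ring.
Qed.

Variable a : R.
Hypothesis a0 : 0 < a.

(** Pairs of consecutive coefficients turn the three-term recurrence into a structural recursion. *)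
Fixpoint laguerre_pair n : R * R := if n is m.+1 then
  let p := laguerre_pair m in
  (p.2, ((2 * m.+1%:R - a) * p.2 - m%:R * p.1) / m.+2%:R) else (1, - a).

(* Taylor coefficients of exp (- a s / (1 - s)); backdiff multiplies the
   generating function by 1 - s. *)
Definition laguerre n := (laguerre_pair n).1.
Definition laguerre_diff j := iter j backdiff laguerre.

(** Coefficients of (1 - s)^2 G' + a G = 0, the equation of the generating function G. *)
Lemma laguerreS n : n.+1%:R * laguerre n.+1 =
  (2 * n%:R - a) * laguerre n - (if n is m.+1 then m%:R * laguerre m else 0).
Proof.
rewrite /laguerre; case: n => [|n] /=; first by ring.
by rewrite mulrCA mulfV ?mulr1// pnatr_eq0.
Qed.

Lemma laguerre_diff0 j : laguerre_diff j 0 = 1.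
Proof. by elim: j => //= j; rewrite /backdiff subr0. Qed.

(** Coefficients of (1 - s) H' = - (j + 1) H - a K, where H and K are the generating function times
    (1 - s)^(j + 1) and (1 - s)^j. *)
Lemma laguerre_diffS j n : n.+1%:R * laguerre_diff j.+1 n.+1 =
  (n%:R - j.+1%:R) * laguerre_diff j.+1 n - a * laguerre_diff j n.
Proof.
elim: j n => [|j IH] n.
  rewrite /= backdiffS mulrBr laguerreS; case: n => [|n].
    by rewrite /backdiff /laguerre /=; ring.
  by rewrite backdiffS; ring.
have D i m : laguerre_diff i.+1 m.+1 = laguerre_diff i m.+1 - laguerre_diff i m by [].
rewrite D mulrBr IH; case: n => [|n]; first by rewrite !laguerre_diff0; ring.
by rewrite [laguerre_diff j.+2 n.+1]D; have := IH n; rewrite D; lra.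
Qed.

(** The source of decay: two more differences gain a factor 1 / (n + 1). *)
Lemma laguerre_diffSS j n : n.+1%:R * laguerre_diff j.+2 n.+1 =
  - (j.+2%:R * laguerre_diff j.+1 n) - a * laguerre_diff j n.
Proof.
have -> : laguerre_diff j.+2 n.+1 = laguerre_diff j.+1 n.+1 - laguerre_diff j.+1 n by [].
by rewrite mulrBr laguerre_diffS; ring.
Qed.

Let c := laguerre.
Let d n := laguerre_diff 1 n.
(** The recurrence discretises x y'' + 2 y' + a y = 0, whose energy x y'^2 + a y^2 has derivative -
    3 y'^2. Taking c_n c_(n+1) in place of a square makes the increment a quadratic form in the
    differences alone. *)
Let energy n := n.+1%:R * d n.+1 ^+ 2 + a * (c n * c n.+1).

Let dE n : d n.+1 = c n.+1 - c n. Proof. by []. Qed.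

Let energy_step n : energy n.+1 = energy n - d n.+1 ^+ 2 - 2 * d n.+1 * d n.+2.
Proof.
have := laguerre_diffS 0 n.+1; rewrite -/(d _) -/(d n.+1) -[laguerre_diff 0]/c => E.
have {E} E : a * c n.+1 = n%:R * d n.+1 - n.+2%:R * d n.+2.
  by rewrite E; ring.
have F : a * (c n.+1 * c n.+2) - a * (c n * c n.+1) = a * c n.+1 * (d n.+2 + d n.+1).
  by rewrite !dE; ring.
have G : a * (c n.+1 * c n.+2) = a * (c n * c n.+1) + (n%:R * d n.+1 - n.+2%:R * d n.+2) * (d n.+2 + d n.+1).
  by rewrite -E -F; ring.
by rewrite /energy G; ring.
Qed.

(** Since d_(n+1) = c_(n+1) - c_n, the product c_n c_(n+1) is the mean of the squares minus
    d_(n+1)^2 / 2, and the leading coefficient outweighs this loss once n >= a. *)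
Let energy_ge n : a <= n%:R -> (n%:R + 2) / 2 * d n.+1 ^+ 2 <= energy n /\ a / 2 * c n ^+ 2 <= energy n.
Proof.
move=> an; have E : energy n = (n.+1%:R - a / 2) * d n.+1 ^+ 2 + a / 2 * (c n ^+ 2 + c n.+1 ^+ 2).
  by rewrite /energy dE; field.
have n1 : n.+1%:R = n%:R + 1 :> R by rewrite natr1.
have h1 := sqr_ge0 (d n.+1); have h2 := mulr_ge0 (ltW a0) (sqr_ge0 (c n)).
have h3 := mulr_ge0 (ltW a0) (sqr_ge0 (c n.+1)).
have h4 : 0 <= (n%:R - a) * d n.+1 ^+ 2 by rewrite mulr_ge0// subr_ge0.
have h5 := mulr_ge0 (ltW a0) h1.
rewrite E n1; split; lra.
Qed.

(* The energy grows by a factor at most 1 + O(1/n) at each step, hence polynomially. *)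
Let energy_growth n0 : a <= n0%:R -> (0 < n0)%N -> exists2 K, 0 <= K & forall n, (n0 <= n)%N ->
  energy n <= K * (n%:R * n.+1%:R).
Proof.
move=> an0 n00; exists `|energy n0| => // n; elim: n => [|n IH].
  by rewrite leqn0 => /eqP E; rewrite E in n00.
rewrite leq_eqVlt => /orP[/eqP <-|]; last rewrite ltnS => hn.
  apply: le_trans (ler_norm _) _; rewrite ler_peMr// -natrM ler1n muln_gt0 n00//.
have {}IH := IH hn.
have an : a <= n%:R by apply: le_trans an0 _; rewrite ler_nat.
have an1 : a <= n.+1%:R by apply: le_trans an _; rewrite ler_nat.
have [h1 _] := energy_ge an1.
have h2 := sqr_ge0 (d n.+1 + d n.+2).
have h3 : energy n.+1 <= energy n + d n.+2 ^+ 2 by rewrite energy_step; lra.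
have n1 : n.+1%:R = n%:R + 1 :> R by rewrite natr1.
have n2 : n.+2%:R = n%:R + 2 :> R by ring.
have n0' : 1 <= n%:R :> R by rewrite ler1n (leq_trans n00).
have K0 := normr_ge0 (energy n0).
rewrite n1 in h1 IH; rewrite n1 n2.
suff : (n%:R + 1) * energy n.+1 <= (n%:R + 1) * (`|energy n0| * ((n%:R + 1) * (n%:R + 2))).
  by rewrite ler_pM2l//; lra.
have h4 : (n%:R + 1) * energy n.+1 <= (n%:R + 3) * energy n by nra.
apply: le_trans h4 _.
have h5 : (n%:R + 3) * energy n <= (n%:R + 3) * (`|energy n0| * (n%:R * (n%:R + 1))).
  by rewrite ler_wpM2l//; lra.
apply: le_trans h5 _.
have -> : (n%:R + 3) * (`|energy n0| * (n%:R * (n%:R + 1))) =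
   `|energy n0| * (n%:R + 1) * (n%:R * (n%:R + 3)) by ring.
have -> : (n%:R + 1) * (`|energy n0| * ((n%:R + 1) * (n%:R + 2))) =
   `|energy n0| * (n%:R + 1) * ((n%:R + 1) * (n%:R + 2)) by ring.
apply: ler_wpM2l; last by lra.
by apply: mulr_ge0 => //; lra.
Qed.

(** The energy is O (n^2) and controls c_n^2 from the index a on. [C1] collects the finitely many
    earlier coefficients. *)
Lemma laguerre_growth : exists2 C, 0 <= C & forall n, `|laguerre n| <= C * n.+1%:R.
Proof.
pose n0 := (Num.trunc a).+1.
have an0 : a <= n0%:R by apply/ltW/truncnS_gt.
have [K K0 hK] := energy_growth an0 isT.
pose C1 := \sum_(m < n0) `|laguerre m|; pose C2 := 1 + 2 * K / a.
have C10 : 0 <= C1 by apply: sumr_ge0.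
have C20 : 1 <= C2 by rewrite lerDl divr_ge0 ?mulr_ge0// ltW.
have C30 : 0 <= C1 + C2 by lra.
exists (C1 + C2) => // n.
have n1 : 1 <= n.+1%:R :> R by rewrite ler1n.
have [nn0|nn0] := ltnP n n0.
  apply: (@le_trans _ _ C1).
    by rewrite /C1 (bigD1 (Ordinal nn0))//= lerDl; exact: sumr_ge0.
  by apply: (@le_trans _ _ ((C1 + C2) * 1)); rewrite ?ler_wpM2l//; lra.
have an : a <= n%:R by apply: le_trans an0 _; rewrite ler_nat.
have [_ h1] := energy_ge an; have h2 := hK n nn0.
have nn : n.+1%:R = n%:R + 1 :> R by rewrite natr1.
have n0' : 0 <= n%:R :> R := ler0n _ _.
apply: (@le_trans _ _ (C2 * n.+1%:R)); last by rewrite ler_wpM2r//; lra.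
rewrite -(ler_pXn2r (n := 2))// ?nnegrE ?normr_ge0 ?mulr_ge0//; last by lra.
rewrite real_normK ?num_real// exprMn.
have h3 : c n ^+ 2 <= 2 * K / a * (n%:R * n.+1%:R).
  have : a / 2 * c n ^+ 2 <= a / 2 * (2 * K / a * (n%:R * n.+1%:R)).
    by have -> : a / 2 * (2 * K / a * (n%:R * n.+1%:R)) = K * (n%:R * n.+1%:R);
      [field; rewrite gt_eqF|exact: le_trans h1 h2].
  by rewrite ler_pM2l// divr_gt0.
apply: le_trans h3 _; apply: ler_pM.
- by rewrite divr_ge0 ?mulr_ge0// ltW.
- by rewrite mulr_ge0.
- by rewrite /C2; have : 0 <= 2 * K / a; [rewrite divr_ge0 ?mulr_ge0// ltW|nra].
- by rewrite expr2 ler_wpM2r// ler_nat.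
Qed.

(** Starts from linear growth and gains one power of n per two differences; the odd order follows
    from the even one without a gain. *)
Lemma laguerre_diff_decay k : exists2 C, 0 <= C & forall n,
  `|laguerre_diff k.*2 n| * n.+1%:R ^+ k <= C * n.+1%:R /\
  `|laguerre_diff k.*2.+1 n| * n.+1%:R ^+ k <= C * n.+1%:R.
Proof.
(* A further difference keeps the order of decay; 2^q compensates the shift from n + 2 to n + 1. *)
have twice j (C : R) q : 0 <= C -> (forall n, `|laguerre_diff j n| * n.+1%:R ^+ q <= C * n.+1%:R) ->
    forall n, `|laguerre_diff j.+1 n| * n.+1%:R ^+ q <= (1 + 2 ^+ q) * C * n.+1%:R.
  move=> C0 hC n.
  have Q0 : 0 <= 2 ^+ q * C * n.+1%:R by rewrite !mulr_ge0 ?exprn_ge0.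
  case: n Q0 => [|n] Q0.
    by have := hC 0%N; rewrite !laguerre_diff0 => h; apply: le_trans h _; lra.
  rewrite [laguerre_diff j.+1]/= backdiffS.
  apply: (@le_trans _ _ ((`|laguerre_diff j n.+1| + `|laguerre_diff j n|) * n.+2%:R ^+ q)).
    by rewrite ler_wpM2r ?exprn_ge0// ler_normB.
  rewrite mulrDl mulrDl mul1r mulrDl lerD//.
  apply: (@le_trans _ _ (`|laguerre_diff j n| * (2 ^+ q * n.+1%:R ^+ q))).
    rewrite ler_wpM2l// -exprMn lerXn2r ?nnegrE ?mulr_ge0//.
    by rewrite -natrM ler_nat mul2n -addnn addnS ltnS leq_addr.
  rewrite mulrCA -[2 ^+ q * C * _]mulrA ler_wpM2l ?exprn_ge0//.
  by apply: le_trans (hC n) _; rewrite ler_wpM2l// ler_nat.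
elim: k => [|k [C C0 IH]].
  have [C C0 hC] := laguerre_growth.
  have h : forall n, `|laguerre_diff 0 n| * n.+1%:R ^+ 0 <= C * n.+1%:R.
    by move=> n; rewrite expr0 mulr1; exact: hC.
  exists ((1 + 2 ^+ 0) * C) => [|n]; first by rewrite mulr_ge0.
  split; last exact: twice.
  by apply: le_trans (h n) _; rewrite expr0 ler_wpM2r// ler_peMl//; lra.
have even n : `|laguerre_diff k.+1.*2 n| * n.+1%:R ^+ k.+1 <=
    2 ^+ k.+1 * (k.*2.+2%:R + a) * C * n.+1%:R.
  have k2 : 1 <= k.*2.+2%:R :> R by rewrite ler1n.
  have two : 1 <= 2 ^+ k.+1 :> R by rewrite exprn_ege1// ler1n.
  have K1 : 1 <= 2 ^+ k.+1 * (k.*2.+2%:R + a) by apply: mulr_ege1 => //; apply: le_trans k2 _; rewrite lerDl ltW.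
  case: n => [|n].
    have := (IH 0%N).1; rewrite !laguerre_diff0 !expr1n => h; apply: le_trans h _.
    by rewrite ler_wpM2r// ler_peMl.
  have h : `|laguerre_diff k.*2.+2 n.+1| * n.+1%:R ^+ k.+1 <= (k.*2.+2%:R + a) * (C * n.+1%:R).
    rewrite exprS mulrA [`|_| * _]mulrC -[n.+1%:R in X in X * _](@normr_nat R) -normrM laguerre_diffSS.
    apply: (@le_trans _ _ ((k.*2.+2%:R * `|laguerre_diff k.*2.+1 n| + a * `|laguerre_diff k.*2 n|) * n.+1%:R ^+ k)).
      rewrite ler_wpM2r ?exprn_ge0//; apply: le_trans (ler_normB _ _) _.
      by rewrite normrN !normrM normr_nat (gtr0_norm a0).
    rewrite [leLHS]mulrDl [leRHS]mulrDl -!mulrA; apply: lerD; apply: ler_wpM2l => //; rewrite ?(ltW a0)//.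
      exact: (IH n).2.
    exact: (IH n).1.
  apply: (@le_trans _ _ (`|laguerre_diff k.*2.+2 n.+1| * (2 ^+ k.+1 * n.+1%:R ^+ k.+1))).
    rewrite doubleS ler_wpM2l// -exprMn lerXn2r ?nnegrE ?mulr_ge0//.
    by rewrite -natrM ler_nat mul2n -addnn addnS ltnS leq_addr.
  rewrite mulrCA -!mulrA ler_wpM2l ?exprn_ge0//; apply: le_trans h _.
  apply: ler_wpM2l; first by rewrite addr_ge0 ?(ltW a0).
  by apply: ler_wpM2l => //; rewrite ler_nat.
have D0 : 0 <= 2 ^+ k.+1 * (k.*2.+2%:R + a) * C.
  by rewrite !mulr_ge0 ?exprn_ge0// addr_ge0// ltW.
exists ((1 + 2 ^+ k.+1) * (2 ^+ k.+1 * (k.*2.+2%:R + a) * C)) => [|n].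
  by rewrite mulr_ge0// addr_ge0// exprn_ge0.
split; last exact: twice.
apply: le_trans (even n) _; rewrite ler_wpM2r// ler_peMl// lerDl exprn_ge0//.
Qed.

End Laguerre.

(** * Summation of the generating functions on (0, 1) *)

Section GeneratingFunction.
Variable R : realType.
Implicit Types (u v : nat -> R) (s x q C : R).

Lemma cvg0_le u v : (forall n, `|u n| <= v n) -> v @ \oo --> (0 : R) -> u @ \oo --> (0 : R).
Proof.
move=> uv /cvgrPdist_le v0; apply/cvgrPdist_le => e e0.
have := v0 e e0; apply: filterS => n; rewrite !sub0r !normrN; apply: le_trans.
exact: le_trans (uv n) (ler_norm _).
Qed.

Lemma natmul_geometric q n : 0 <= q < 1 -> n.+1%:R * q ^+ n * (1 - q) <= 1.
Proof.
move=> /andP[q0 q1]; suff : n.+1%:R * q ^+ n * (1 - q) <= 1 - q ^+ n.+1.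
  by move=> /le_trans; apply; rewrite lerBlDr lerDl exprn_ge0.
elim: n => [|n IH]; first by rewrite expr0 expr1; lra.
have h : q ^+ n.+1 * (1 - q) <= 1 - q.
  by rewrite ler_piMl ?exprn_ile1 ?(ltW q1)//; lra.
have -> : n.+2%:R * q ^+ n.+1 * (1 - q) = q * (n.+1%:R * q ^+ n * (1 - q)) + q ^+ n.+1 * (1 - q).
  by rewrite exprS; ring.
apply: (@le_trans _ _ (q * (1 - q ^+ n.+1) + q ^+ n.+1 * (1 - q))).
  by rewrite lerD2r ler_wpM2l.
by rewrite [q ^+ n.+2]exprS; lra.
Qed.

Lemma cvg_natmul_geometric q : 0 <= q < 1 -> (fun n => n.+1%:R * q ^+ n) @ \oo --> (0 : R).
Proof.
(* With r^2 = q the term is (n + 1) r^n times r^n, and the first factor is bounded by 1 / (1 -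
   r). *)
move=> /andP[q0 q1]; pose r := Num.sqrt q.
have r0 : 0 <= r := sqrtr_ge0 _.
have r1 : r < 1 by rewrite -[ltRHS]sqrtr1 ltr_sqrt.
have qr : q = r ^+ 2 by rewrite sqr_sqrtr.
have r2 : 0 < 1 - r by lra.
apply: (@cvg0_le _ (geometric (1 - r)^-1 r)); last first.
  by apply: cvg_geometric; rewrite ger0_norm.
move=> n; rewrite ger0_norm ?mulr_ge0 ?exprn_ge0// qr -exprM mulnC exprM expr2 mulrA /=.
rewrite ler_wpM2r ?exprn_ge0// -[leRHS]mul1r ler_pdivlMr//.
by apply: natmul_geometric; rewrite r0.
Qed.

Variable a : R.
Hypothesis a0 : 0 < a.
Local Notation laguerre := (laguerre a).
Local Notation laguerre_diff := (laguerre_diff a).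

Let P N : {poly R} := \poly_(n < N.+1) laguerre n.

Let PE N x : (P N).[x] = \sum_(n < N.+1) laguerre n * x ^+ n.
Proof. exact: horner_poly. Qed.

Let PS N : P N.+1 = P N + laguerre N.+1 *: 'X^(N.+1).
Proof. by rewrite /P !poly_def big_ord_recr. Qed.

(** A partial sum solves the equation of the generating function up to the two terms at the cut. *)
Lemma laguerre_ode N x : (1 - x) ^+ 2 * (P N)^`().[x] + a * (P N).[x] =
  N%:R * laguerre N * x ^+ N.+1 - N.+1%:R * laguerre N.+1 * x ^+ N.
Proof.
elim: N => [|N IH].
  rewrite laguerreS /P poly_def big_ord_recr big_ord0 /= add0r.
  by rewrite expr0 alg_polyC derivC hornerC horner0 /laguerre; ring.
have D : (P N.+1)^`().[x] = (P N)^`().[x] + laguerre N.+1 * (N.+1%:R * x ^+ N).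
  by rewrite PS derivD hornerD derivZ derivXn hornerZ hornerMn hornerXn mulr_natl.
have F : (P N.+1).[x] = (P N).[x] + laguerre N.+1 * x ^+ N.+1.
  by rewrite PS hornerD hornerZ hornerXn.
have -> : (1 - x) ^+ 2 * (P N.+1)^`().[x] + a * (P N.+1).[x] =
   ((1 - x) ^+ 2 * (P N)^`().[x] + a * (P N).[x]) +
   ((1 - x) ^+ 2 * (laguerre N.+1 * (N.+1%:R * x ^+ N)) + a * (laguerre N.+1 * x ^+ N.+1)).
  by rewrite D F; ring.
by rewrite IH [N.+2%:R * _](laguerreS a N.+1) !exprS; ring.
Qed.

Let E x := expR (a * ((1 - x)^-1 - 1)).

(** An integrating factor replaces the theory of power series: only the terms at the cut survive in
    the derivative of the partial sum times [E], and the mean value theorem on [0, s] starts from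
    the value 1 at 0. *)
Lemma laguerre_partial_sum s N C : 0 < s < 1 -> 0 <= C ->
  (forall n, `|laguerre n| <= C * n.+1%:R) ->
  `|(P N).[s] * E s - 1| <= (1 - s) ^- 2 * E s * (2 * C) * (N.+1%:R ^+ 2 * s ^+ N).
Proof.
move=> /andP[s0 s1] C0 hC.
pose g x := (P N).[x] * E x.
pose dg x := (1 - x) ^- 2 * E x * (N%:R * laguerre N * x ^+ N.+1 - N.+1%:R * laguerre N.+1 * x ^+ N).
have dE x : x < 1 -> is_derive x 1 E (E x * (a * (1 - x) ^- 2)).
  move=> x1; have x2 : 1 - x != 0 by rewrite subr_eq0 eq_sym lt_eqF.
  have d1 : is_derive x 1 (fun y : R => 1 - y) (0 - 1).
    exact: (is_deriveB (is_derive_cst (1 : R) x 1) (is_derive_id x 1)).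
  have d2 := @is_deriveV R (fun y => 1 - y) x _ 1 x2 d1.
  have d3 := is_deriveB d2 (is_derive_cst (1 : R) x 1).
  have d4 := is_deriveZ a d3.
  have d5 := @is_derive1_comp R expR (fun y => a * ((1 - y)^-1 - 1)) x _ _ (is_derive_expR _) d4.
  by apply: (is_derive_eq d5); rewrite /E /GRing.scale /=; ring.
have dG x : x < 1 -> is_derive x 1 g (dg x).
  move=> x1; have x2 : 1 - x != 0 by rewrite subr_eq0 eq_sym lt_eqF.
  have d1 := is_deriveM (is_derive_poly (P N) x) (dE x x1).
  apply: (is_derive_eq d1).
  by rewrite /dg -laguerre_ode /GRing.scale /=; field.
have [||z] := @MVT R g dg 0 s s0.
- by move=> x; rewrite in_itv /= => /andP[_ xs]; apply: dG; exact: lt_trans s1.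
- apply: derivable_within_continuous => x; rewrite in_itv /= => /andP[_ xs].
  by have [] := dG x (le_lt_trans xs s1).
rewrite in_itv /= subr0 => /andP[z0 zs].
have -> : g 0 = 1.
  rewrite /g /E subr0 invr1 subrr mulr0 expR0 mulr1 PE big_ord_recl /= expr0 mulr1.
  rewrite big1 ?addr0// => i _; by rewrite expr0n mulr0.
rewrite -/(g s) => ->.
have q1 : 0 < 1 - s by lra.
have q2 : 0 < 1 - z by lra.
have E0 x : 0 <= E x by exact: expR_ge0.
have i0 x : 0 <= (1 - x) ^- 2 by rewrite invr_ge0 sqr_ge0.
rewrite /dg; set X := N%:R * _ * _ - _; rewrite !normrM (ger0_norm (E0 z)) (ger0_norm (i0 z)) (gtr0_norm s0) -!mulrA.
have sN0 : 0 <= s ^+ N by rewrite exprn_ge0// ltW.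
have h1 : (1 - z) ^- 2 <= (1 - s) ^- 2.
  by rewrite lef_pV2 ?posrE ?exprn_gt0// ler_pXn2r ?nnegrE//; lra.
have h2 : E z <= E s.
  by rewrite ler_expR ler_wpM2l ?(ltW a0)// lerD2r lef_pV2 ?posrE//; lra.
apply: ler_pM => //; first by rewrite mulr_ge0// mulr_ge0// ltW.
apply: ler_pM => //; first by rewrite mulr_ge0// ltW.
apply: (@le_trans _ _ `|X|); first by rewrite ler_piMr// ltW.
apply: le_trans (ler_normB _ _) _; rewrite !normrM !normr_nat !normrX (gtr0_norm z0).
have hz : z ^+ N <= s ^+ N by rewrite lerXn2r ?nnegrE ?(ltW z0) ?(ltW zs) ?(ltW s0).
have hz0 : 0 <= z ^+ N by rewrite exprn_ge0// ltW.
have hz1 : z ^+ N.+1 <= s ^+ N.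
  by apply: le_trans hz; rewrite exprS ler_piMl//; lra.
have t1 : N%:R * `|laguerre N| * z ^+ N.+1 <= N%:R * (C * N.+1%:R) * s ^+ N.
  by apply: ler_pM => //; rewrite ?mulr_ge0 ?exprn_ge0 ?(ltW z0)// ler_wpM2l.
have t2 : N.+1%:R * `|laguerre N.+1| * z ^+ N <= N.+1%:R * (C * N.+2%:R) * s ^+ N.
  by apply: ler_pM => //; rewrite ?mulr_ge0 // ler_wpM2l.
apply: le_trans (lerD t1 t2) _; rewrite le_eqVlt; apply/orP; left; apply/eqP.
by rewrite -!natr1; ring.
Qed.

Let E_inv x : (E x)^-1 = expR (- (a * ((1 - x)^-1 - 1))). Proof. by rewrite expRN. Qed.

(** Each difference multiplies the limit by 1 - s; the boundary term vanishes because coefficients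
    grow at most linearly. *)
Lemma laguerre_diff_cvg j s : 0 < s < 1 ->
  (fun N => \sum_(n < N.+1) laguerre_diff j n * s ^+ n) @ \oo -->
  (1 - s) ^+ j * expR (- (a * ((1 - s)^-1 - 1))).
Proof.
move=> /andP[s0 s1]; elim: j => [|j IH]; last first.
  rewrite exprS -mulrA -[X in _ --> X]addr0.
  have [C C0 hC] := laguerre_growth a0.
  have bd i n : `|laguerre_diff i n| <= 2 ^+ i * C * n.+1%:R.
    elim: i n => [|i IHi] n; first by rewrite expr0 mul1r; exact: hC.
    rewrite /= /backdiff; apply: le_trans (ler_normB _ _) _; rewrite exprS.
    have h1 := IHi n; case: n h1 => [|n] h1.
      by rewrite normr0 addr0; apply: le_trans h1 _; rewrite -!mulrA ler_peMl ?mulr_ge0 ?exprn_ge0// ler1n.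
    have h2 : `|laguerre_diff i n| <= 2 ^+ i * C * n.+2%:R.
      by apply: le_trans (IHi n) _; rewrite ler_wpM2l ?mulr_ge0 ?exprn_ge0// ler_nat.
    by apply: le_trans (lerD h1 h2) _; lra.
  apply: (@cvg_trans _ ((fun N => (1 - s) * \sum_(n < N.+1) laguerre_diff j n * s ^+ n +
      laguerre_diff j N * s ^+ N.+1) @ \oo)).
    apply: near_eq_cvg; near=> N; by rewrite [laguerre_diff j.+1]/= sum_backdiff.
  apply: cvgD; first by apply: cvgM; [exact: cvg_cst|exact: IH].
  apply: (@cvg0_le _ (fun n => 2 ^+ j * C * (n.+1%:R * s ^+ n))).
    move=> n; rewrite normrM normrX (gtr0_norm s0) [leRHS]mulrA; apply: ler_pM => //.
    - by rewrite exprn_ge0// ltW.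
    - by rewrite exprS ler_piMl ?exprn_ge0 ?(ltW s0)// ltW.
  rewrite -[X in _ --> X](mulr0 (2 ^+ j * C)); apply: cvgM; first exact: cvg_cst.
  by apply: cvg_natmul_geometric; rewrite (ltW s0).
have [C C0 hC] := laguerre_growth a0.
rewrite expr0 mul1r; pose r := Num.sqrt s.
have r0 : 0 <= r := sqrtr_ge0 _.
have r1 : r < 1 by rewrite -[ltRHS]sqrtr1 ltr_sqrt.
have sr : s = r ^+ 2 by rewrite sqr_sqrtr// ltW.
have E0 : 0 < E s by exact: expR_gt0.
pose K := (1 - s) ^- 2 * (2 * C).
have h : (fun N => \sum_(n < N.+1) laguerre_diff 0 n * s ^+ n - (E s)^-1) @ \oo --> (0 : R).
  apply: (@cvg0_le _ (fun n => K * ((n.+1%:R * r ^+ n) * (n.+1%:R * r ^+ n)))).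
    move=> N; have h := @laguerre_partial_sum s N C; rewrite s0 s1 in h.
    have {}h := h isT C0 hC; rewrite PE in h.
    rewrite -(ler_pM2r E0) -[X in _ * X <= _](gtr0_norm E0) -normrM mulrBl mulVf ?gt_eqF//.
    apply: le_trans h _; rewrite sr -exprM mulnC exprM /K -sr expr2; lra.
  rewrite -[X in _ --> X](mulr0 K) -[X in _ --> K * X](mulr0 0).
  have c1 : (fun n => n.+1%:R * r ^+ n) @ \oo --> (0 : R) by apply: cvg_natmul_geometric; rewrite r0.
  by apply: cvgM; [exact: cvg_cst|exact: cvgM].
rewrite -E_inv; move/cvgrPdist_le: h => h; apply/cvgrPdist_le => e e0.
by apply: filterS (h e e0) => N; rewrite sub0r normrN distrC.
Unshelve. all: by end_near.
Qed.

End GeneratingFunction.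

(** * Absolutely convergent series of Cauchy kernels, and their membership in the model space *)

Section AbsoluteSeries.
Variable R : realType.
Implicit Types (x y m e : R) (z w c : R[i]) (k : nat -> R[i]).
Local Notation lam := (@lam R).
Local Notation BN := (@BN R).

(** Summation against b as an operator with an explicit error. The weight n + 2 admits the bound of
    [kern_lam_weight], in which a square-integrable function of z is the constant m. *)
Lemma series_operator (b : nat -> R[i]) (A : R) :
  (forall N, \sum_(0 <= n < N) nc (b n) * n.+2%:R <= A) ->
  exists (L : (nat -> R[i]) -> R[i]) (tau : nat -> R), [/\ forall N, 0 < tau N,
    forall e, 0 < e -> exists N, forall M, (N <= M)%N -> tau M < e &
    forall k m N, 0 <= m -> (forall n, nc (k n) <= m * n.+2%:R) ->
      nc (\sum_(0 <= n < N) b n * k n - L k) <= m * tau N].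
Proof.
move=> bA.
have [|t [t0 tlim tS]] := tail_sequence (a := fun n => nc (b n) * n.+2%:R) _ bA.
  by move=> n; rewrite mulr_ge0 ?nc_ge0.
pose tau N := t N ^+ 2.
have tau0 N : 0 < tau N by rewrite exprn_gt0.
have taulim e : 0 < e -> exists N, forall M, (N <= M)%N -> tau M < e.
  move=> e0; have [|N hN] := tlim (Num.sqrt e); first by rewrite sqrtr_gt0.
  exists N => M /hN h; rewrite -[e]sqr_sqrtr ?(ltW e0)//.
  by rewrite ltr_pXn2r// ?nnegrE ?sqrtr_ge0// ltW.
pose S k N := \sum_(0 <= n < N) b n * k n.
have SC k m N M : 0 <= m -> (forall n, nc (k n) <= m * n.+2%:R) -> (N <= M)%N ->
    nc (S k M - S k N) <= m * tau N.
  move=> m0 km NM; rewrite /S (@big_cat_nat _ _ _ N 0 M)//= addrAC subrr add0r.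
  apply: le_trans (nc_sum _ _ _) _; apply: le_trans (_ : m * \sum_(N <= n < M) nc (b n) * n.+2%:R <= _).
    by rewrite mulr_sumr; apply: ler_sum => n _; rewrite ncM mulrCA ler_wpM2l ?nc_ge0.
  by rewrite ler_wpM2l// tS.
have H k : exists v, forall m N, 0 <= m -> (forall n, nc (k n) <= m * n.+2%:R) ->
    nc (S k N - v) <= m * tau N.
  (* Sequences without a weighted bound get the value 0, so that the operator is total. *)
  have [[m [m0 km]]|nk] := pselect (exists m, 0 <= m /\ forall n, nc (k n) <= m * n.+2%:R); last first.
    by exists 0 => m N m0 km; exfalso; apply: nk; exists m.
  have m1 : 0 < m + 1 by rewrite ltr_wpDl.
  have dlim e : 0 < e -> exists N, m * tau N < e.
    move=> e0; have [N hN] := taulim _ (divr_gt0 e0 m1); exists N.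
    have := hN N (leqnn N); rewrite ltr_pdivlMr// => h; apply: le_lt_trans h.
    by rewrite mulrC ler_wpM2l ?(ltW (tau0 N))// lerDl.
  have [v hv] := complex_cauchy (u := S k) dlim (fun N M NM => SC k m N M m0 km NM).
  (* [v] was built from one constant m. The estimate for another constant m' passes through a later
     partial sum, where m tau M is negligible. *)
  exists v => m' N m'0 km'; apply/ler_addgt0Pr => e e0.
  have [N1 hN1] := taulim _ (divr_gt0 e0 m1).
  pose M := maxn N N1; have h1 := SC k m' N M m'0 km' (leq_maxl _ _).
  have h2 := hv M; have h3 := hN1 M (leq_maxr _ _).
  have h4 : m * tau M <= e.
    move: h3; rewrite ltr_pdivlMr// => /ltW; apply: le_trans.
    by rewrite mulrC ler_wpM2l ?(ltW (tau0 M))// lerDl.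
  have -> : S k N - v = (S k M - v) - (S k M - S k N) by ring.
  by apply: le_trans (ncB _ _) _; lra.
have [L hL] := choice H; exists L, tau; split=> // k m N m0 km; exact: hL.
Qed.

Variables (b : nat -> R[i]) (L : (nat -> R[i]) -> R[i]) (tau : nat -> R).
Hypothesis tau0 : forall N, 0 < tau N.
Hypothesis taulim : forall e, 0 < e -> exists N, forall M, (N <= M)%N -> tau M < e.
Hypothesis hL : forall k m N, 0 <= m -> (forall n, nc (k n) <= m * n.+2%:R) ->
  nc (\sum_(0 <= n < N) b n * k n - L k) <= m * tau N.

Definition weighted k := exists2 m, 0 <= m & forall n, nc (k n) <= m * n.+2%:R.

Lemma series_bound k m : 0 <= m -> (forall n, nc (k n) <= m * n.+2%:R) -> nc (L k) <= m * tau 0.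
Proof. by move=> m0 km; have := hL 0 m0 km; rewrite big_geq// sub0r ncN. Qed.

Lemma series_uniq k c : weighted k ->
  (forall e, 0 < e -> exists N, forall M, (N <= M)%N -> nc (\sum_(0 <= n < M) b n * k n - c) <= e) ->
  L k = c.
Proof.
move=> [m m0 km] h; apply/eqP; rewrite -subr_eq0; apply/eqP/nc_small => e e0.
have m1 : 0 < m + 1 by rewrite ltr_wpDl.
have e2 : 0 < e / 2 by rewrite divr_gt0.
have [N hN] := h _ e2; have [N1 hN1] := taulim (divr_gt0 e2 m1).
pose M := maxn N N1; have h1 := hN M (leq_maxl _ _); have h2 := hL M m0 km.
have h3 : m * tau M <= e / 2.
  have := hN1 M (leq_maxr _ _); rewrite ltr_pdivlMr// => /ltW; apply: le_trans.
  by rewrite mulrC ler_wpM2l ?(ltW (tau0 M))// lerDl.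
have -> : L k - c = (\sum_(0 <= n < M) b n * k n - c) - (\sum_(0 <= n < M) b n * k n - L k) by ring.
by apply: le_trans (ncB _ _) _; lra.
Qed.

Lemma series_lin k1 k2 c : weighted k1 -> weighted k2 ->
  L (fun n => k1 n + c * k2 n) = L k1 + c * L k2.
Proof.
move=> [m1 m10 h1] [m2 m20 h2]; apply: series_uniq.
  exists (m1 + nc c * m2) => [|n]; first by rewrite addr_ge0// mulr_ge0// nc_ge0.
  by apply: le_trans (ncD _ _) _; rewrite mulrDl lerD// ncM -mulrA ler_wpM2l// nc_ge0.
move=> e e0; have C0 : 0 < m1 + nc c * m2 + 1.
  by rewrite ltr_wpDl// addr_ge0// mulr_ge0// nc_ge0.
have [N hN] := taulim (divr_gt0 e0 C0); exists N => M NM.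
have -> : \sum_(0 <= n < M) b n * (k1 n + c * k2 n) - (L k1 + c * L k2) =
    (\sum_(0 <= n < M) b n * k1 n - L k1) + c * (\sum_(0 <= n < M) b n * k2 n - L k2).
  under eq_bigr do rewrite mulrDr mulrCA.
  by rewrite big_split /= -mulr_sumr; ring.
apply: le_trans (ncD _ _) _; rewrite ncM.
have g1 := hL M m10 h1; have g2 := hL M m20 h2.
have g3 : nc c * nc (\sum_(0 <= n < M) b n * k2 n - L k2) <= nc c * (m2 * tau M).
  by rewrite ler_wpM2l ?nc_ge0.
have := hN M NM; rewrite ltr_pdivlMr// => g4; have := tau0 M.
lra.
Qed.

Lemma series_single : L (fun n => (n == 0%N)%:R) = b 0.
Proof.
apply: series_uniq.
  exists 1 => // n; rewrite mul1r; apply: (@le_trans _ _ 1); last by rewrite ler1n.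
  by case: eqP => _; rewrite ?nc1 ?nc0.
move=> e e0; exists 1%N => M M1; rewrite big_ltn// mulr1 big1_seq ?addr0 ?subrr ?nc0 ?(ltW e0)//.
by move=> n /=; rewrite mem_index_iota => /andP[n1 _]; rewrite gtn_eqF// mulr0.
Qed.

Definition cauchy_series z := L (fun n => kern (lam n) z).

Lemma kern_lam_bound n z e : 0 < e -> e - 1 <= complex.Im z -> nc (kern (lam n) z) <= e^-1.
Proof.
move=> e0 h; rewrite /kern ncV lef_pV2 ?posrE//; last first.
  by rewrite nc_gt0; apply: lam_sub_neq; lra.
apply: le_trans (nc_Im _); rewrite ImD ImN /=; apply: le_trans (ler_norm _); lra.
Qed.

Lemma weight_le (m : R) n : 0 <= m -> m <= m * n.+2%:R.
Proof. by move=> m0; rewrite ler_peMr// ler1n. Qed.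

Lemma kern_lam_diff n z w : - 1 < complex.Im z -> - 1 < complex.Im w ->
  kern (lam n) w = kern (lam n) z + (- (w - z)) * (kern (lam n) w * kern (lam n) z).
Proof.
move=> z1 w1; rewrite /kern; have h1 := @lam_sub_neq R n z z1; have h2 := @lam_sub_neq R n w w1.
by field; rewrite h1 h2.
Qed.

(** The resolvent identity [kern_lam_diff] exhibits the slope function as another such series; a
    second use of it shows that the slope function is continuous. *)
Lemma cdiff_cauchy_series z : - 1 < complex.Im z -> cdiff cauchy_series z.
Proof.
(* Half the distance from z to the line Im = - 1 that carries the poles. *)
move=> z1; pose e : R := (complex.Im z + 1) / 2.
have e0 : 0 < e by rewrite divr_gt0//; lra.
have i0 : 0 <= e^-1 by rewrite invr_ge0 ltW.
have near w : nc (w - z) < e -> e - 1 <= complex.Im w.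
  move=> wz; have := nc_Im (w - z); rewrite ImD ImN ler_norml => /andP[h _].
  have : complex.Im z + 1 = e + e by rewrite /e; field.
  lra.
have zz : e - 1 <= complex.Im z by apply: near; rewrite subrr nc0.
have w1 w : e - 1 <= complex.Im w -> - 1 < complex.Im w by move=> h; lra.
have bd1 w n : e - 1 <= complex.Im w -> nc (kern (lam n) w) <= e^-1 := @kern_lam_bound n w e e0.
have bd2 w n : e - 1 <= complex.Im w -> nc (kern (lam n) w * kern (lam n) z) <= e^-1 * e^-1.
  by move=> we; rewrite ncM; apply: ler_pM; rewrite ?nc_ge0 ?bd1.
have bd3 w n : e - 1 <= complex.Im w ->
    nc (kern (lam n) w * kern (lam n) z * kern (lam n) z) <= e^-1 * e^-1 * e^-1.
  by move=> we; rewrite ncM; apply: ler_pM; rewrite ?nc_ge0 ?bd1 ?bd2.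
have ii : 0 <= e^-1 * e^-1 by rewrite mulr_ge0.
have iii : 0 <= e^-1 * e^-1 * e^-1 by rewrite mulr_ge0.
have W1 w : e - 1 <= complex.Im w -> weighted (fun n => kern (lam n) w).
  by move=> we; exists e^-1 => // n; apply: le_trans (bd1 w n we) _; exact: weight_le.
have W2 w : e - 1 <= complex.Im w -> weighted (fun n => kern (lam n) w * kern (lam n) z).
  by move=> we; exists (e^-1 * e^-1) => // n; apply: le_trans (bd2 w n we) _; exact: weight_le.
have W3 w : e - 1 <= complex.Im w -> forall n,
    nc (kern (lam n) w * kern (lam n) z * kern (lam n) z) <= e^-1 * e^-1 * e^-1 * n.+2%:R.
  by move=> we n; apply: le_trans (bd3 w n we) _; exact: weight_le.
exists (fun w => - L (fun n => kern (lam n) w * kern (lam n) z)); last first.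
  exists e => // w /near we; rewrite /cauchy_series.
  have -> : (fun n => kern (lam n) w) =
      (fun n => kern (lam n) z + (- (w - z)) * (kern (lam n) w * kern (lam n) z)).
    by apply/funext => n; apply: kern_lam_diff; exact: w1.
  by rewrite series_lin//; [ring|exact: W1|exact: W2].
apply: ccontN => q q0.
pose C := e^-1 * e^-1 * e^-1 * tau 0.
have C0 : 0 <= C by rewrite mulr_ge0// ltW.
exists (Num.min e (q / (C + 1))); first by rewrite lt_min e0 divr_gt0// ltr_wpDl.
move=> w; rewrite lt_min => /andP[/near we wq].
have -> : (fun n => kern (lam n) w * kern (lam n) z) = (fun n => kern (lam n) z * kern (lam n) z +
    (- (w - z)) * (kern (lam n) w * kern (lam n) z * kern (lam n) z)).
  apply/funext => n; rewrite [in LHS](@kern_lam_diff n z w); [ring|exact: w1|exact: w1].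
rewrite series_lin; [|exact: W2|by exists (e^-1 * e^-1 * e^-1) => // n; exact: W3].
rewrite addrAC subrr add0r ncM ncN.
have h := series_bound iii (W3 w we).
apply: le_lt_trans (_ : nc (w - z) * C < _); first by rewrite ler_wpM2l ?nc_ge0.
move: wq; rewrite ltr_pdivlMr; last by rewrite ltr_wpDl.
by apply: le_lt_trans; rewrite ler_wpM2l ?nc_ge0// lerDl.
Qed.

(** z + i is z - conj (lam n) plus n + 1, and |z - conj (lam n)| >= 1. All kernels are thus
    dominated by the one at i, at the price of the weight. *)
Lemma kern_lam_weight n z : 0 <= complex.Im z -> nc (kern (lam n) z) <= nc (kern 'i z) * n.+2%:R.
Proof.
move=> z0; have h1 := @lam_den R n z z0.
have i0 : z - conjc 'i != 0 by apply: kern_den => /=; lra.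
have h2 : nc (z - conjc 'i) <= n.+2%:R * nc (z - conjc (lam n)).
  have -> : z - conjc 'i = (z - conjc (lam n)) + (n.+1%:R)%:C.
    by case: z {z0 h1 i0} => p q; apply: eqC; rewrite /= ?oppr0; ring.
  apply: le_trans (ncD _ _) _; rewrite nc_real normr_nat -[n.+2]add1n natrD mulrDl mul1r lerD2l.
  by rewrite ler_peMr.
have d1 : 0 < nc (z - conjc (lam n)) by lra.
have d2 : 0 < nc (z - conjc 'i) by rewrite nc_gt0.
by rewrite /kern !ncV [leRHS]mulrC ler_pdivlMr// ler_pdivrMl// [leRHS]mulrC.
Qed.

Lemma cauchy_series_approx N z : 0 <= complex.Im z ->
  nc (\sum_(0 <= n < N) b n * kern (lam n) z - cauchy_series z) <= nc (kern 'i z) * tau N.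
Proof. by move=> z0; apply: hL => [|n]; [exact: nc_ge0|exact: kern_lam_weight]. Qed.

Lemma cauchy_series_bound z : 0 <= complex.Im z -> nc (cauchy_series z) <= nc (kern 'i z) * tau 0.
Proof. by move=> z0; apply: series_bound => [|n]; [exact: nc_ge0|exact: kern_lam_weight]. Qed.

Lemma hardy_kern_dominated h C : 0 <= C -> (forall z, 0 < complex.Im z -> cdiff h z) ->
  (forall z, 0 < complex.Im z -> nc (h z) <= C * nc (kern 'i z)) -> hardy h (C ^+ 2 * pi).
Proof.
move=> C0 dh hC; split=> // y y0.
have i0 : 0 < complex.Im ('i : R[i]) by [].
have [_ /(_ y y0) hk] := hardy_kern i0; rewrite divr1 in hk.
by apply: sqint_le hk _ C0 _ => [|x]; [exact: hardy_cmeas|exact: hC].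
Qed.

Let fK K z := \sum_(0 <= n < K) b n * kern (lam n) z.

Let dfK K z : 0 < complex.Im z -> cdiff (fK K) z.
Proof.
move=> z0; apply: cdiff_sum => n _; apply: cdiffM; first exact: cdiff_cst.
by apply: cdiff_kern => /=; lra.
Qed.

Let df z : 0 < complex.Im z -> cdiff cauchy_series z.
Proof. by move=> z0; apply: cdiff_cauchy_series; lra. Qed.

Lemma hardy_cauchy_series : hardy cauchy_series (tau 0 ^+ 2 * pi).
Proof.
apply: hardy_kern_dominated => //; first exact: ltW.
by move=> z z0; rewrite mulrC; exact: cauchy_series_bound (ltW z0).
Qed.

Let hardy_fK K : hardy (fK K) ((tau 0 + tau K) ^+ 2 * pi).
Proof.
apply: hardy_kern_dominated; [by rewrite addr_ge0// ltW|exact: dfK|move=> z z0].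
have h1 := cauchy_series_bound (ltW z0); have h2 := cauchy_series_approx K (ltW z0).
rewrite mulrDl; have := ncD (fK K z - cauchy_series z) (cauchy_series z); rewrite subrK.
rewrite -/(fK K z) in h2; lra.
Qed.

Let hardy_diff K : hardy (fun z => cauchy_series z - fK K z) (tau K ^+ 2 * pi).
Proof.
apply: hardy_kern_dominated; first exact: ltW.
  by move=> z z0; apply: cdiffB; [exact: df|exact: dfK].
by move=> z z0; rewrite nc_dist mulrC; exact: cauchy_series_approx (ltW z0).
Qed.

Let hardy_BN N g M : hardy g M -> hardy (fun z => g z * BN N z) M.
Proof.
move=> hg; apply: hardyM hg _ _ => z z0; last exact: BN_le1 (ltW z0).
by apply: cdiff_BN => n _; apply: lam_sub_neq; lra.
Qed.

(** The kernels of the partial sum evaluate g times the partial product at zeros of index below K,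
    where that product vanishes. *)
Let partial_orth K N g M : hardy g M -> (K <= N)%N -> lim0 (ip (fK K) (fun z => g z * BN N z)) 0.
Proof.
move=> hg KN; have hB := hardy_BN N hg.
have l0 n : 0 < complex.Im (lam n) by [].
have h : lim0 (ip (fun z => g z * BN N z) (fK K)) 0.
  pose u n y := conjc (b n) * ip (fun z => g z * BN N z) (kern (lam n)) y.
  pose v n := if (n < K)%N then 0 else conjc (b n) * ((2 * pi)%:C * 'i * (g (lam n) * BN N (lam n))).
  have E y : 0 < y -> \sum_(n <- index_iota 0 K) u n y = ip (fun z => g z * BN N z) (fK K) y.
    by move=> y0; rewrite -(ip_sum _ _ hB (fun n => hardy_kern (l0 n))).
  apply: (lim0_ext E).
  have V : \sum_(n <- index_iota 0 K) v n = 0.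
    by rewrite big_seq big1// => n; rewrite mem_index_iota /v => /andP[_ ->].
  rewrite -[X in lim0 _ X]V; apply: (@lim0_sum _ _ _ u v) => n.
  have hn : lim0 (u n) _ := lim0Z (conjc (b n)) (ip_kern_lim hB (l0 n)).
  by rewrite /v; case: ifP hn => // nK; rewrite BN_lam ?(leq_trans nK)// !mulr0.
move=> e /h[d d0 hd]; exists d => // y yd; have /andP[y0 _] := yd.
by rewrite (ip_conj hB (hardy_fK K) y0) subr0 nc_conj -[ip _ _ _]subr0; exact: hd.
Qed.

(** In the pairing of the series with B1 g, B1 is replaced by a partial product at the cost of
    [sqint_B1_tail], as the series is dominated by the kernel at i, and the series by a partial sum
    at the cost of tau K. [partial_orth] disposes of the rest once the product has at least K
    factors. *)
Lemma cauchy_series_model : model_space (@B1 R) cauchy_series.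
Proof.
split; first exact: hardy_H2 hardy_cauchy_series.
move=> g Hg; have [M hg] := H2_hardy Hg; apply/lim0P.
have M0 : 0 <= M := sqint_ge0 (hg.2 1 ltr01).
move=> e e0; have p0 : 0 < pi :> R := pi_gt0 R.
(* Order of choices: t makes M / t small, then [eta] and [q] make the two square norms small even
   after multiplication by t. The total stays below 3 e / 4. *)
pose t := 8 * (M + 1) / e.
have t0 : 0 < t by rewrite divr_gt0// mulr_gt0// ltr_wpDl.
have Mt : M / t <= e / 8.
  have -> : e / 8 = (M + 1) / t by rewrite /t; field; rewrite !gt_eqF// ltr_wpDl.
  by rewrite ler_wpM2r ?invr_ge0 ?(ltW t0)// lerDl.
pose T := tau 0 ^+ 2 + 1; have T0 : 0 < T by rewrite ltr_wpDl ?sqr_ge0.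
pose eta := e / (8 * t * T).
have t8 : 0 < 8 * t by exact: mulr_gt0.
have eta0 : 0 < eta by apply: divr_gt0 => //; exact: mulr_gt0.
have i0 : 0 < complex.Im ('i : R[i]) by [].
have [N0 hN0] := sqint_B1_tail i0 eta0.
pose q := e / (8 * t * pi).
have q0 : 0 < q by apply: divr_gt0 => //; exact: mulr_gt0.
have sq0 : 0 < Num.sqrt q by rewrite sqrtr_gt0.
have [K hK] := taulim sq0; have {}hK := hK K (leqnn K).
pose N := maxn N0 K; have {}hN0 := hN0 N (leq_maxl _ _).
have KN : (K <= N.+1)%N by rewrite leqW// leq_maxr.
have [d d0 hd] := partial_orth hg KN (divr_gt0 e0 (ltr0n _ 4)).
exists (Num.min d 1); first by rewrite lt_min d0 ltr01.
move=> y /andP[y0]; rewrite lt_min => /andP[yd y1].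
have s1 := hN0 y; rewrite y0 (ltW y1) in s1; have {}s1 := s1 isT.
have cf := hardy_cmeas df y0; have sg := sqint_conj (hg.2 y y0).
have cB : cmeas (fun x => conjc (B1 (x +i* y) - BN N.+1 (x +i* y))).
  apply: cmeas_conj; apply: cmeasB; first exact: cmeas_B1 (ltW y0).
  by apply: cmeas_cont; exact: pcont_BN (ltW y0).
have s2 : sqint (fun x => cauchy_series (x +i* y) * conjc (B1 (x +i* y) - BN N.+1 (x +i* y)))
    (tau 0 ^+ 2 * eta).
  apply: sqint_le s1 (cmeasM cf cB) (ltW (tau0 0)) _ => x.
  rewrite !ncM nc_conj ncV.
  have h : nc (cauchy_series (x +i* y)) <= (nc (x +i* y - conjc 'i))^-1 * tau 0.
    by rewrite -ncV; apply: (@cauchy_series_bound (x +i* y)); exact: ltW.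
  have B0 := nc_ge0 (B1 (x +i* y) - BN N.+1 (x +i* y)).
  by apply: le_trans (ler_wpM2r B0 h) _; rewrite le_eqVlt; apply/orP; left; apply/eqP; ring.
have [j1 b1] := sqint_mul s2 sg; have {}b1 := b1 t t0.
have hB := hardy_BN N.+1 hg.
have j2 := ip_integrable (hardy_diff K) hB y0.
have [_ b2] := sqint_mul ((hardy_diff K).2 y y0) (sqint_conj (hB.2 y y0)); have {}b2 := b2 t t0.
have j3 := ip_integrable (hardy_fK K) hB y0.
have b3 := hd y; rewrite y0 yd subr0 in b3; have {}b3 := b3 isT.
have mT : measurable (setT : set (measurableTypeR R)) by exact: measurableT.
have -> : ip_at cauchy_series (fun z => B1 z * g z) y =
  cint setT (fun x => cauchy_series (x +i* y) * conjc (B1 (x +i* y) - BN N.+1 (x +i* y)) * conjc (g (x +i* y))) +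
  (ip (fun z => cauchy_series z - fK K z) (fun z => g z * BN N.+1 z) y + ip (fK K) (fun z => g z * BN N.+1 z) y).
  rewrite /ip -cintD// -cintD//; last exact: cintegrableD.
  apply: eq_cint => x _; rewrite NumconjE !conjcM conjcB; ring.
rewrite subr0; apply: le_lt_trans (ncD _ _) _.
have b4 := ncD (ip (fun z => cauchy_series z - fK K z) (fun z => g z * BN N.+1 z) y)
  (ip (fK K) (fun z => g z * BN N.+1 z) y).
have aux (u v : R) : 0 < u -> 0 < v -> e / 8 = u * (v * (e / (8 * u * v))).
  by move=> u0 v0; field; rewrite !gt_eqF.
have e1 : t * (tau 0 ^+ 2 * eta) <= e / 8.
  rewrite (aux t T t0 T0) -/eta.
  by rewrite ler_wpM2l ?(ltW t0)// ler_wpM2r ?(ltW eta0)// lerDl.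
have e2 : t * (tau K ^+ 2 * pi) <= e / 8.
  rewrite (aux t pi t0 p0) -/q [pi * q]mulrC.
  rewrite ler_wpM2l ?(ltW t0)// ler_wpM2r ?(ltW p0)// -[q]sqr_sqrtr ?(ltW q0)//.
  by rewrite ler_pXn2r ?nnegrE ?(ltW (tau0 K)) ?(ltW sq0)// ltW.
rewrite /ip in b4 b3 *; lra.
Qed.

(* If the series vanished on the upper half-plane it would vanish up to Im z = -1,
   where its first term has a pole. *)
Lemma cauchy_series_neq0 : b 0 != 0 -> exists z, 0 < complex.Im z /\ cauchy_series z != 0.
Proof.
move=> b0; apply: contrapT => hn.
have f0 z : 0 < complex.Im z -> cauchy_series z = 0.
  by move=> z0; apply/eqP; apply: contrapT => /negP h; apply: hn; exists z.
have {hn}f1 z : - 1 < complex.Im z -> cauchy_series z = 0.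
  move=> z1; pose e : R := (complex.Im z + 1) / 2.
  have e0 : 0 < e by rewrite divr_gt0//; lra.
  have i0 : 0 <= e^-1 by rewrite invr_ge0 ltW.
  have ee : complex.Im z + 1 = e + e by rewrite /e; field.
  (* Translation by v carries the half-plane Im > e - 1, where the series is bounded, to the upper
     half-plane. *)
  pose v : R[i] := 0 +i* (1 - e).
  have -> : z = z + v - v by rewrite addrK.
  have up w : 0 < complex.Im w -> e - 1 <= complex.Im (w - v).
    by move=> w0; rewrite ImD ImN /=; lra.
  apply: (@half_plane_vanish R (fun w => cauchy_series (w - v)) (e^-1 * tau 0)).
  - move=> w /up wu; apply: (@cdiff_comp R (fun w => w - v) cauchy_series).
      by apply: cdiffB; [exact: cdiff_id|exact: cdiff_cst].
    by apply: cdiff_cauchy_series; lra.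
  - move=> w /up wu; apply: series_bound => // n.
    by apply: le_trans (kern_lam_bound n e0 wu) _; exact: weight_le.
  - by move=> w _ w3; apply: f0; rewrite ImD ImN /=; lra.
  - by rewrite ImD /=; lra.
have B0 : 0 < nc (b 0) by rewrite nc_gt0.
(* Distance to the first pole, small enough for |b 0| / e to exceed the bound tau 0 of all other
   terms together. *)
pose e : R := Num.min 1 (nc (b 0) / (2 * tau 0)).
have e0 : 0 < e by rewrite lt_min ltr01 divr_gt0// mulr_gt0.
have e1 : e * tau 0 <= nc (b 0) / 2.
  have : e <= nc (b 0) / (2 * tau 0) by rewrite /e ge_min lexx orbT.
  by rewrite ler_pdivlMr ?mulr_gt0// => h; rewrite ler_pdivlMr//; lra.
pose z : R[i] := 1 +i* (e - 1).
have z1 : - 1 < complex.Im z by rewrite /=; lra.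
pose k n := if n is m.+1 then kern (lam m.+1) z else 0.
have k1 n : nc (k n) <= 1 * n.+2%:R.
  rewrite mul1r; apply: (@le_trans _ _ 1); last by rewrite ler1n.
  case: n => [|n]; first by rewrite /k nc0.
  rewrite /k /kern ncV invf_le1; last by rewrite nc_gt0; exact: lam_sub_neq.
  apply: le_trans (nc_Re _); rewrite ReD ReN /= distrC; apply: le_trans (ler_norm _).
  by rewrite -addn1 natrD addrK ler1n.
have E : cauchy_series z = L k + kern (lam 0) z * b 0.
  rewrite -series_single -series_lin; first last.
  - exists 1 => // n; rewrite mul1r; apply: (@le_trans _ _ 1); last by rewrite ler1n.
    by case: eqP => _; rewrite ?nc1 ?nc0.
  - by exists 1.
  congr (L _); apply/funext => -[|n] /=; first by rewrite mulr1 add0r.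
  by rewrite mulr0 addr0.
have h1 := series_bound ler01 k1.
have h2 : L k = - (kern (lam 0) z * b 0).
  by move: E; rewrite f1// => /esym/eqP; rewrite addr_eq0 => /eqP.
have h3 : nc (kern (lam 0) z) = e^-1.
  have -> : kern (lam 0) z = (0 +i* e)^-1 by rewrite /kern; congr (_^-1); apply: eqC; rewrite /=; ring.
  by rewrite ncV nc_imag gtr0_norm.
move: h1; rewrite h2 ncN ncM h3 mul1r mulrC ler_pdivrMr// mulrC; lra.
Qed.

End AbsoluteSeries.

(** * Decay along the negative axis through a Laplace transform *)

Section LaplaceDecay.
Variable R : realType.
Implicit Types (s t x T : R) (m z : R[i]).
Local Notation lam := (@lam R).

Lemma sum_inv_sqr N : \sum_(0 <= n < N) (n.+1%:R ^+ 2)^-1 <= 2 :> R.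
Proof.
suff : \sum_(0 <= n < N) (n.+1%:R ^+ 2)^-1 <= 2 - 2 / N.+1%:R :> R.
  by move=> /le_trans; apply; rewrite lerBlDr lerDl divr_ge0.
elim: N => [|N IH]; first by rewrite big_geq// divr1 subrr.
rewrite big_nat_recr //=; apply: le_trans (lerD IH (lexx _)) _.
have n0 : 0 <= N%:R :> R := ler0n _ _.
have -> : N.+1%:R = N%:R + 1 :> R by rewrite natr1.
have -> : N.+2%:R = N%:R + 2 :> R by ring.
have h1 : N%:R + 1 != 0 :> R by rewrite gt_eqF//; lra.
have h2 : N%:R + 2 != 0 :> R by rewrite gt_eqF//; lra.
rewrite -subr_ge0.
have -> : 2 - 2 / (N%:R + 2) - (2 - 2 / (N%:R + 1) + ((N%:R + 1) ^+ 2)^-1) =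
   N%:R / ((N%:R + 2) * (N%:R + 1) ^+ 2) :> R by field; rewrite h1 h2.
by rewrite divr_ge0// mulr_ge0 ?sqr_ge0//; lra.
Qed.

Lemma pcont_cexp m T : pcont `[0, T] (fun x => cexp (- m * x%:C)).
Proof.
have h : pcont (`[0, T]%classic : set R) (fun x => - m * x%:C).
  by apply: (@pcont_lip _ _ _ (nc m)) => u v _ _; rewrite -mulrBr -rmorphB ncM ncN nc_real.
exact: (pcont_comp h (fun x _ => cdiff_cont (cdiff_cexp _))).
Qed.

Lemma cint_exp m T : 0 < T -> 0 <= complex.Re m -> m != 0 ->
  cint `[0, T] (fun x => cexp (- m * x%:C)) = (1 - cexp (- m * T%:C)) / m.
Proof.
move=> T0 m0 mn; pose G x := - (m^-1) * cexp (- m * x%:C).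
have -> : (1 - cexp (- m * T%:C)) / m = G T - G 0.
  by rewrite /G mulr0 cexp0; ring.
have m1 : 0 < nc m by rewrite nc_gt0.
have c1 x : 0 <= x -> nc (cexp (- m * x%:C)) <= 1.
  move=> x0; rewrite nc_cexp -expR0 ler_expR ReM ReN /= mulr0 subr0 mulNr oppr_le0.
  exact: mulr_ge0.
apply: cint_ftc => //; last first.
  move=> x /andP[x0 xT] e e0; have [d d0 hd] := cexp_slope0 e0.
  exists (d / nc m); first by rewrite divr_gt0.
  move=> t /andP[t0 tT]; rewrite ltr_pdivlMr// => td.
  have hh : nc (- m * (t - x)%:C) < d by rewrite ncM ncN nc_real mulrC.
  have -> : G t - G x - (t - x)%:C * cexp (- m * x%:C) =
      - (m^-1) * cexp (- m * x%:C) * (cexp (- m * (t - x)%:C) - 1 - (- m * (t - x)%:C)).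
    have -> : cexp (- m * (t - x)%:C) = cexp (- m * t%:C) * cexp (- (- m * x%:C)).
      by rewrite -cexpD; congr cexp; rewrite rmorphB /=; ring.
    have cc : cexp (- m * x%:C) * cexp (- (- m * x%:C)) = 1 by rewrite -cexpD subrr cexp0.
    rewrite !mulrBr.
    have -> : - m^-1 * cexp (- m * x%:C) * (cexp (- m * t%:C) * cexp (- (- m * x%:C))) =
        - m^-1 * cexp (- m * t%:C) * (cexp (- m * x%:C) * cexp (- (- m * x%:C))) by ring.
    by rewrite cc /G; field.
  have h1 := hd _ hh.
  have k1 : nc (- m^-1 * cexp (- m * x%:C)) <= (nc m)^-1.
    by rewrite ncM ncN ncV -[leRHS]mulr1 ler_wpM2l ?invr_ge0 ?nc_ge0// c1.
  rewrite ncM; apply: le_trans (ler_pM (nc_ge0 _) (nc_ge0 _) k1 h1) _.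
  by rewrite ncM ncN nc_real mulrCA mulKf// gt_eqF.
exact: pcont_cexp.
Qed.

Lemma exp_sqrt_amgm (a t x : R) : 0 < a -> 0 <= t -> 0 < x ->
  2 * (Num.sqrt a * Num.sqrt t) <= t * x + a / x.
Proof.
move=> a0 t0 x0; have xn : x != 0 by rewrite gt_eqF.
have sa : Num.sqrt a ^+ 2 = a by rewrite sqr_sqrtr// ltW.
have st : Num.sqrt t ^+ 2 = t by rewrite sqr_sqrtr.
have -> : t * x + a / x = (Num.sqrt t * x - Num.sqrt a) ^+ 2 / x + 2 * (Num.sqrt a * Num.sqrt t).
  by rewrite -{1}st -{1}sa; field.
by rewrite lerDr divr_ge0 ?sqr_ge0// ltW.
Qed.

Variables (a kappa : R) (L : (nat -> R[i]) -> R[i]) (tau : nat -> R).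
Hypotheses (a0 : 0 < a) (kappa0 : 0 < kappa).
Let d := laguerre_diff a 8.
Let b n : R[i] := (kappa * d n)%:C.
Hypothesis tau0 : forall N, 0 < tau N.
Hypothesis taulim : forall e : R, 0 < e -> exists N, forall M, (N <= M)%N -> tau M < e.
Hypothesis hL : forall k (m : R) N, 0 <= m -> (forall n, nc (k n) <= m * n.+2%:R) ->
  nc (\sum_(0 <= n < N) b n * k n - L k) <= m * tau N.

Lemma real_series (k : nat -> R) (c : R) : (forall n, `|k n| <= 1) ->
  (fun N => \sum_(n < N.+1) d n * k n) @ \oo --> c -> L (fun n => (k n)%:C) = (kappa * c)%:C.
Proof.
move=> k1 kc; apply: (series_uniq tau0 taulim hL).
  exists 1 => // n; rewrite nc_real mul1r; apply: le_trans (k1 n) _; by rewrite ler1n.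
move=> e e0; move/cvgrPdist_le: kc => /(_ (e / kappa) (divr_gt0 e0 kappa0))[N _ hN].
exists N.+1 => -[//|M] NM; have := hN M NM; rewrite ler_pdivlMr//; apply: le_trans.
rewrite big_mkord.
have -> : \sum_(n < M.+1) b n * (k n)%:C = (kappa * \sum_(n < M.+1) d n * k n)%:C.
  rewrite mulr_sumr rmorph_sum /=; apply: eq_bigr => n _.
  by rewrite /b -rmorphM /= mulrA.
by rewrite -rmorphB nc_real -mulrBr normrM (gtr0_norm kappa0) mulrC distrC.
Qed.

(** At s = exp (- x) the full series is kappa (1 - s)^8 exp (a - a / (1 - s)), and 1 - s <= x. With
    the factor exp (- t x) the exponent is at most a - (t x + a / x), to which [exp_sqrt_amgm]
    applies; tau N pays for the truncation. *)
Lemma weighted_power_sum t x N : 0 <= t -> 0 <= x ->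
  expR (- (t * x)) * nc (\sum_(0 <= n < N) b n * (expR (- x) ^+ n)%:C) <=
  tau N + kappa * expR (a - 2 * (Num.sqrt a * Num.sqrt t)).
Proof.
move=> t0 x0; pose s := expR (- x); have s0 : 0 < s := expR_gt0 _.
have s1 : s <= 1 by rewrite -expR0 ler_expR oppr_le0.
have k1 n : `|s ^+ n| <= 1 by rewrite ger0_norm ?exprn_ge0 ?exprn_ile1 ?(ltW s0).
have w : forall n, nc (s ^+ n)%:C <= 1 * n.+2%:R.
  by move=> n; rewrite nc_real mul1r; apply: le_trans (k1 n) _; rewrite ler1n.
have h1 := hL N ler01 w; rewrite mul1r in h1.
have tx0 : 0 <= t * x by exact: mulr_ge0.
have e1 : expR (- (t * x)) <= 1 by rewrite -expR0 ler_expR oppr_le0.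
have K0 : 0 <= kappa * expR (a - 2 * (Num.sqrt a * Num.sqrt t)).
  by rewrite mulr_ge0 ?expR_ge0// ltW.
suff h2 : expR (- (t * x)) * nc (L (fun n => (s ^+ n)%:C)) <=
    kappa * expR (a - 2 * (Num.sqrt a * Num.sqrt t)).
  have h3 : nc (\sum_(0 <= n < N) b n * (s ^+ n)%:C) <= tau N + nc (L (fun n => (s ^+ n)%:C)).
    have := ncD (\sum_(0 <= n < N) b n * (s ^+ n)%:C - L (fun n => (s ^+ n)%:C))
      (L (fun n => (s ^+ n)%:C)); rewrite subrK; lra.
  apply: le_trans (ler_wpM2l (expR_ge0 _) h3) _; rewrite mulrDr lerD//.
  by rewrite ler_piMl// ltW.
move: x0; rewrite le_eqVlt => /orP[/eqP x0|x0].
  have sE : s = 1 by rewrite /s -x0 oppr0 expR0.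
  (* At s = 1 the sum of eighth differences telescopes to a seventh difference, which tends to 0. *)
  have -> : L (fun n => (s ^+ n)%:C) = (kappa * 0)%:C.
    apply: real_series k1 _; rewrite sE.
    have [C C0 hC] := laguerre_diff_decay a0 3.
    apply: (@cvg0_le _ _ (fun n => C * n.+1%:R^-1)); last first.
      rewrite -[X in _ --> X](mulr0 C); apply: cvgM; first exact: cvg_cst.
      exact: cvg_harmonic.
    move=> n; rewrite /d (sum_backdiff (laguerre_diff a 7)) subrr mul0r add0r expr1n mulr1.
    have [_] := hC n; have n1 : 1 <= n.+1%:R :> R by rewrite ler1n.
    have n0 : 0 < n.+1%:R :> R by lra.
    rewrite exprSr mulrA ler_pM2r// => h; rewrite ler_pdivlMr//; apply: le_trans h.
    by rewrite ler_wpM2l// expr2 ler_peMr// ltW.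
  by rewrite mulr0 nc_real normr0 mulr0.
have s1' : s < 1 by rewrite -expR0 ltr_expR oppr_lt0.
have -> : L (fun n => (s ^+ n)%:C) = (kappa * ((1 - s) ^+ 8 * expR (- (a * ((1 - s)^-1 - 1)))))%:C.
  by apply: real_series k1 _; apply: laguerre_diff_cvg => //; rewrite s0.
have q0 : 0 < 1 - s by lra.
have q1 : (1 - s) ^+ 8 <= 1 by rewrite exprn_ile1//; lra.
rewrite nc_real ger0_norm; last first.
  by rewrite !mulr_ge0 ?expR_ge0 ?exprn_ge0// ltW.
rewrite mulrCA ler_wpM2l ?(ltW kappa0)// mulrCA.
apply: le_trans (_ : 1 * (expR (- (t * x)) * expR (- (a * ((1 - s)^-1 - 1)))) <= _).
  by rewrite ler_wpM2r// mulr_ge0// expR_ge0.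
rewrite mul1r -expRD ler_expR.
have h4 := exp_sqrt_amgm a0 t0 x0.
have h5 : 1 - s <= x by have := expR_ge1Dx (- x); rewrite -/s; lra.
have h6 : a / x <= a / (1 - s) by rewrite ler_wpM2l ?(ltW a0)// lef_pV2.
lra.
Qed.

Lemma axis_decay (A1 T t : R) : 0 < T -> 0 <= t -> 2 * (Num.sqrt a * Num.sqrt t) <= (t + 1) * T ->
  (forall N, \sum_(0 <= n < N) `|d n| <= A1) ->
  nc (cauchy_series L (- t)%:C) <=
  kappa * (2 * T * expR a + A1) * expR (- (2 * (Num.sqrt a * Num.sqrt t))).
Proof.
move=> T0 t0 tT dA; pose X := expR (- (2 * (Num.sqrt a * Num.sqrt t))).
have X0 : 0 < X := expR_gt0 _.
pose m n : R[i] := (n.+1%:R + t) -i* 1.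
have Rm n : 1 + t <= complex.Re (m n) by rewrite /= lerD2r ler1n.
have Rm0 n : 0 <= complex.Re (m n) by apply: le_trans (Rm n); lra.
have m1 n : 1 <= nc (m n) by apply: le_trans (nc_Re _); apply: le_trans (ler_norm _); have := Rm n; lra.
have mn n : m n != 0 by rewrite -nc_gt0; exact: lt_le_trans ltr01 (m1 n).
have km n : kern (lam n) (- t)%:C = - (m n)^-1.
  by rewrite /kern -invrN; congr (_^-1); apply: eqC; rewrite /= ?oppr0; ring.
have km2 n : kern (lam n) (- t)%:C = - cint `[0, T] (fun x => cexp (- m n * x%:C)) - cexp (- m n * T%:C) / m n.
  by rewrite km cint_exp//; field.
have mI : measurable (`[0, T]%classic : set (measurableTypeR R)) by exact: measurable_itv.
have pc n := @pcont_cexp (m n) T.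
have ci n := cintegrableZ (b n) mI (pcont_integrable (pc n)).
have main N : nc (\sum_(0 <= n < N) b n * kern (lam n) (- t)%:C) <=
    2 * (tau N + kappa * (expR a * X)) * T + kappa * A1 * X.
  have [_ E] := cint_sum (index_iota 0 N) mI ci.
  have -> : \sum_(0 <= n < N) b n * kern (lam n) (- t)%:C =
     - cint `[0, T] (fun x => \sum_(n <- index_iota 0 N) b n * cexp (- m n * x%:C)) -
     \sum_(0 <= n < N) b n * (cexp (- m n * T%:C) / m n).
    rewrite E -sumrN -sumrB; apply: eq_bigr => n _.
    by rewrite (cintZ _ mI (pcont_integrable (pc n))) km2; ring.
  apply: le_trans (ncB _ _) _; rewrite ncN lerD//.
    have -> : 2 * (tau N + kappa * (expR a * X)) * T = 2 * (tau N + kappa * (expR a * X)) * (T - 0).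
      by rewrite subr0.
    apply: cint_le_itv; first exact: ltW.
      elim: (index_iota 0 N) => [|n l IH].
        move=> x _ e e0; exists 1 => // u _ _; by rewrite !big_nil subrr nc0.
      rewrite (_ : (fun x => _) = (fun x => b n * cexp (- m n * x%:C) + \sum_(i <- l) b i * cexp (- m i * x%:C))).
        by apply: pcontD_itv => //; apply: pcontM_itv => //; exact: pcont_cst.
      by apply/funext => x; rewrite big_cons.
    move=> x /andP[x0 xT].
    have := weighted_power_sum N t0 x0.
    have -> : expR a * X = expR (a - 2 * (Num.sqrt a * Num.sqrt t)) by rewrite /X -expRD.
    apply: le_trans.
    (* The common factor has modulus exp (- (1 + t) x), at most the weight exp (- t x) of
       [weighted_power_sum]. *)
    have -> : \sum_(n <- index_iota 0 N) b n * cexp (- m n * x%:C) =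
        cexp ((- (1 + t) * x) +i* x) * \sum_(0 <= n < N) b n * (expR (- x) ^+ n)%:C.
      rewrite mulr_sumr; apply: eq_bigr => n _; rewrite [RHS]mulrCA; congr (b n * _).
      have -> : (expR (- x) ^+ n)%:C = cexp ((n%:R * - x)%:C).
        by rewrite /cexp /= cos0 sin0 -expRM_natl; apply: eqC; rewrite /=; ring.
      rewrite -cexpD; congr cexp; apply: eqC; rewrite /= -?natr1; ring.
    rewrite ncM nc_cexp /= ler_wpM2r ?nc_ge0// ler_expR; lra.
  apply: le_trans (nc_sum _ _ _) _.
  apply: (@le_trans _ _ (\sum_(0 <= n < N) kappa * X * `|d n|)); last first.
    by rewrite -mulr_sumr [leRHS]mulrAC ler_wpM2l// mulr_ge0// ltW.
  apply: ler_sum => n _; rewrite ncM /b nc_real normrM (gtr0_norm kappa0).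
  have h : nc (cexp (- m n * T%:C) / m n) <= X.
    rewrite ncM ncV nc_cexp; apply: le_trans (_ : X * 1 <= _); last by rewrite mulr1.
    apply: ler_pM; rewrite ?expR_ge0 ?invr_ge0 ?nc_ge0//; last by rewrite invf_le1// (lt_le_trans ltr01).
    rewrite ler_expR ReM ReN /= mulr0 subr0 mulNr lerN2; apply: le_trans tT _.
    by rewrite ler_wpM2r ?(ltW T0)//; have := Rm n; rewrite /= addrC.
  by rewrite [leLHS]mulrAC ler_wpM2r// ler_wpM2l// ltW.
apply/ler_addgt0Pr => e e0.
have T20 : 0 < 2 * T + 1 by lra.
have [N hN] := taulim (divr_gt0 e0 T20); have {}hN := hN N (leqnn N).
rewrite ltr_pdivlMr// in hN.
have h1 := main N.
have w : forall n, nc (kern (lam n) (- t)%:C) <= 1 * n.+2%:R.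
  move=> n; rewrite km ncN ncV mul1r; apply: (@le_trans _ _ 1); last by rewrite ler1n.
  by rewrite invf_le1// (lt_le_trans ltr01).
have h2 := hL N ler01 w; rewrite mul1r nc_dist -/(cauchy_series L (- t)%:C) in h2.
have h3 := ncD (cauchy_series L (- t)%:C - \sum_(0 <= n < N) b n * kern (lam n) (- t)%:C)
  (\sum_(0 <= n < N) b n * kern (lam n) (- t)%:C).
rewrite subrK in h3; rewrite -/X; lra.
Qed.

End LaplaceDecay.

(** * Admissibility of the square-root majorants *)

Section Admissible.
Variable R : realType.

Lemma sqrt_majorant_admissible (A : R) : 0 < A ->
  Adm_minus (@B1 R) (fun t : R => expR (- (A * Num.sqrt `|t|))).
Proof.
(* Gives 2 sqrt a = A, the rate in [axis_decay]. *)
move=> A0; pose a := (A / 2) ^+ 2; have a0 : 0 < a by rewrite exprn_gt0// divr_gt0.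
have sa : Num.sqrt a = A / 2 by rewrite sqrtr_sqr ger0_norm// divr_ge0// ltW.
have [C C0 hC] := laguerre_diff_decay a0 4.
(* Eight differences leave O (n^-3), still summable after multiplication by the weight n + 2. *)
have dC n : `|laguerre_diff a 8 n| * n.+2%:R <= 2 * C * (n.+1%:R ^+ 2)^-1.
  have [h _] := hC n; have n0 : 0 < n.+1%:R :> R by rewrite ltr0n.
  rewrite ler_pdivlMr ?exprn_gt0//.
  have n2 : n.+2%:R <= 2 * n.+1%:R :> R by rewrite -natrM ler_nat mul2n -addnn addnS ltnS leq_addr.
  rewrite -(ler_pM2r n0); apply: le_trans (_ : 2 * (`|laguerre_diff a 8 n| * n.+1%:R ^+ 4) <= _).
    have aux (D p q : R) : 0 <= D -> 0 <= p -> q <= 2 * p -> D * q * p ^+ 2 * p <= 2 * (D * p ^+ 4).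
      move=> D0 p0 qp.
      have -> : D * q * p ^+ 2 * p = D * p ^+ 3 * q by ring.
      have -> : 2 * (D * p ^+ 4) = D * p ^+ 3 * (2 * p) by ring.
      by rewrite ler_wpM2l// mulr_ge0// exprn_ge0.
    exact: aux (normr_ge0 _) (ltW n0) n2.
  by rewrite -mulrA ler_wpM2l.
pose A1 := 4 * C + 1.
have A10 : 0 < A1 by rewrite ltr_wpDl// mulr_ge0.
have dA N : \sum_(0 <= n < N) `|laguerre_diff a 8 n| * n.+2%:R <= A1.
  apply: le_trans (ler_sum _ (fun n _ => dC n)) _; rewrite -mulr_sumr /A1.
  have h := ler_wpM2l (mulr_ge0 (ler0n R 2) C0) (sum_inv_sqr R N).
  by apply: le_trans h _; lra.
(* A sqrt t <= (t + 1) (A + 1) for every t >= 0, so that one cut-off serves all t. *)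
pose T := A + 1; have T0 : 0 < T by rewrite /T; lra.
have D0 : 0 < 2 * T * expR a + A1.
  by rewrite addr_gt0// mulr_gt0 ?expR_gt0// mulr_gt0.
(* Normalises the constant of [axis_decay] to 1. *)
pose kappa := (2 * T * expR a + A1)^-1.
have kappa0 : 0 < kappa by rewrite invr_gt0.
pose b n : R[i] := (kappa * laguerre_diff a 8 n)%:C.
have bA N : \sum_(0 <= n < N) nc (b n) * n.+2%:R <= kappa * A1.
  under eq_bigr do rewrite nc_real normrM (gtr0_norm kappa0) -mulrA.
  by rewrite -mulr_sumr ler_wpM2l// ltW.
have [L [tau [tau0 taulim hL]]] := series_operator bA.
exists (cauchy_series L); split.
- exact: cauchy_series_model tau0 taulim hL.
- apply: (cauchy_series_neq0 tau0 taulim hL).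
  by rewrite /b laguerre_diff0 mulr1 -nc_gt0 nc_real gtr0_norm.
apply: aeW => x x0; exists (cauchy_series L x%:C); split.
  apply/lim0P; apply: (@lim0_cont _ _ _ _ 1).
    move=> y y0; have -> : x +i* y - x%:C = 0 +i* y by apply: eqC; rewrite /=; ring.
    by rewrite nc_imag gtr0_norm// mul1r.
  by apply/cdiff_cont/(cdiff_cauchy_series tau0 taulim hL); rewrite /= ltrN10.
pose t := - x; have t0 : 0 <= t by rewrite oppr_ge0 ltW.
have -> : x%:C = (- t)%:C by rewrite opprK.
have st : 0 <= Num.sqrt t := sqrtr_ge0 _.
have stt : Num.sqrt t ^+ 2 = t by rewrite sqr_sqrtr.
have tT : 2 * (Num.sqrt a * Num.sqrt t) <= (t + 1) * T.
  have -> : 2 * (Num.sqrt a * Num.sqrt t) = A * Num.sqrt t by rewrite sa; field.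
  have h1 := mulr_ge0 (ltW A0) (sqr_ge0 (Num.sqrt t - 1)); have h2 := mulr_ge0 (ltW A0) st.
  have -> : (t + 1) * T = (Num.sqrt t ^+ 2 + 1) * (A + 1) by rewrite stt.
  by have := sqr_ge0 (Num.sqrt t); lra.
have dA1 N : \sum_(0 <= n < N) `|laguerre_diff a 8 n| <= A1.
  apply: le_trans (dA N); apply: ler_sum => n _.
  by rewrite ler_peMr// ler1n.
have := axis_decay a0 kappa0 tau0 taulim hL T0 t0 tT dA1.
rewrite /kappa mulVf ?gt_eqF// mul1r ltr0_norm// -/t sa.
by have -> : 2 * (A / 2 * Num.sqrt t) = A * Num.sqrt t by field.
Qed.

End Admissible.

Theorem theorem1p2 (R : realType) :
  (forall A : R, 0 < A ->
     Adm_minus (@B1 R) (fun t : R => expR (- (A * Num.sqrt `|t|)))) /\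
  (forall w : R -> R,
     (forall t : R, t <= 0 -> 0 <= w t) ->
     (forall eps : R, 0 < eps ->
        \forall t \near -oo, w t = 0 \/ Num.sqrt `|t| <= eps * (- ln (w t))) ->
     ~ Adm_minus (@B1 R) w).
Proof.
by split=> [A|w]; [exact: sqrt_majorant_admissible|exact: not_admissible].
Qed.
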